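(* Let $A\in\mathbb{R}^{n\times n}$ be nilpotent with nilpotency index $q\le n$ ($A^q=0$, $A^{q-1}\ne0$), let $B_0\in\mathbb{R}^{n\times m}$ be such that $(A,B_0)$ is controllable, let $\tau_M>0$, $\tau_0\in[0,\tau_M]$ an unknown constant, $h\ge\tau_M$, and let $S$ be an admissible weighting function. Let $B=B_0+\Delta B$ with $\Delta B\in\mathbb{R}^{n\times m}$ unknown, $|\Delta B|\le\varepsilon$, where $\varepsilon\ge0$ is known. Let $f(t,x)$ be continuous in $t$ and locally Lipschitz in $x$ with $|f(t,x)|\le f_0|x|$, where $f_0\ge0$ is known, and let $w_1,w_2$ be piecewise continuous, locally bounded disturbances. Consider $$\dot x(t)=Ax(t)+Bu(t)+f(t,x(t))+w_1(t),\qquad y(t)=x(t-\tau_0)+w_2(t),$$ under the controller $u(t)=-K(t)S(t)g(t)y(t-h)$, $t\ge0$. With the quantities $\rho(l)=\rho_0(l)+\rho_1f_0$ and $\delta$ defined in the context, assume that $\rho(l)<1$ holds for all values $\tau_0\in[0,\tau_M]$ of the delay and all integers $l\ge q$. Then the solution of the closed-loop system satisfies, for all $t\ge 3(q+1)h$, $$|x(t)|\le |x|_{[0,3(q+1)h]}\,e^{\frac{\ln(\rho(q))\,(t-3(q+1)h)}{3(q+1)h}}+\frac{\delta\,\bigl(|w_1|_{[0,t]}+|w_2|_{[0,t]}\bigr)}{(1-\rho(q))^2}. \qquad(\star)$$ Moreover, as $\varepsilon\to0$ and $f_0\to0$ (with $A,B_0,S,h,\tau_M$ fixed), the upper bound $\bar\rho(\varepsilon,f_0)$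 on $\rho(q)$ given in the context tends to zero, and hence the exponential convergence rate $-\ln(\rho(q))/(3(q+1)h)$ in $(\star)$ tends to infinity; therefore $(\star)$ is an almost fixed-time ISS estimate. In particular, if $\Delta B=0$ and $f_0=0$, then $\rho(q)=0$ and $$|x(t)|\le\delta\bigl(|w_1|_{[t-3(q+1)h,t]}+|w_2|_{[t-3(q+1)h,t]}\bigr)\quad\text{for all } t\ge3(q+1)h,$$ i.e. the closed-loop system is fixed-time ISS with respect to $(w_1,w_2)$.
   Context: $|\cdot|$ is the Euclidean norm on vectors and the induced matrix norm; $|\phi|_J$ is the supremum of $|\phi|$ over the interval $J$. In $(\star)$, if $\rho(q)=0$ the exponential factor is read as $0$. Admissible weighting function: $S:\mathbb{R}_{\ge0}\to\mathbb{R}$ such that (1) $S$ is continuously differentiable and $3h$-periodic; (2) $S(t)\ge0$ on $[2h,3h]$ and $S(h_\ast)>0$ for some $h_\ast\in(2h,3h)$; (3) $S(2h)=S(3h)=0$, $S'(2h)=S'(3h)=0$. For $l\in\mathbb{Z}_{\ge0}$: $g(t)=0$ for $t\in[3lh,(3l+2)h]$, $g(t)=1$ for $t\in((3l+2)h,(3l+3)h)$. The matrix $W_{\mathrm c}=\int_{2h}^{3h}e^{-As}B_0S(s)B_0^{\mathrm T}e^{-A^{\mathrm T}s}ds$ is invertible since $(A,B_0)$ is controllable. With $l=\lfloor t/(3h)\rfloor$, $K(t)=B_0^{\mathrm T}e^{-A^{\mathrm T}(t-3lh)}W_{\mathrm c}^{-1}e^{-A(t-3lh-h)}$. Constants (they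 depend on $\tau_0$ and $\Delta B$). For $s\in[2h,3h]$, $$\Delta(s)=I_n-\int_{2h}^{s}e^{-Ar}B_0S(r)B_0^{\mathrm T}e^{-A^{\mathrm T}r}dr\,W_{\mathrm c}^{-1}e^{-A\tau_0},$$ $$\Theta(s)=-\int_{2h}^{s}e^{A(s-r)}\Delta B\,S(r)B_0^{\mathrm T}e^{-A^{\mathrm T}r}dr\,W_{\mathrm c}^{-1}e^{-A\tau_0},$$ $$F=e^{3Ah}(I_n-e^{-A\tau_0})-e^{3Ah}\int_{2h}^{3h}e^{-As}\Delta B\,S(s)B_0^{\mathrm T}e^{-A^{\mathrm T}s}ds\,W_{\mathrm c}^{-1}e^{-A\tau_0},$$ $$\eta=\sup_{s\in[2h,3h]}\left\{e^{3|A|h}+e^{3|A|h}|\Delta(s)|+|\Theta(s)|\right\},$$ $$\alpha_1=\int_{2h}^{3h}\left|e^{-As}BS(s)B_0^{\mathrm T}e^{-A^{\mathrm T}s}W_{\mathrm c}^{-1}e^{-A(s-h)}\right|\int_0^{s-h-\tau_0}\left|e^{A(s-h-\tau_0-r)}\right|dr\,ds+\int_0^{3h}e^{|A|s}ds,$$ $$\alpha_2=\int_{2h}^{3h}\left|e^{-As}BS(s)B_0^{\mathrm T}e^{-A^{\mathrm T}s}W_{\mathrm c}^{-1}e^{-A(s-h)}\right|ds,$$ $$\rho_0(l)=\eta|F^l|,\qquad \rho_1=\alpha_1\eta\sup_{l\in\mathbb{N}}\left\{\sum_{i=0}^{l-1}|F^i|e^{3|A|h}\right\}+e^{3|A|h}\int_0^{3h}e^{|A|s}ds+e^{3|A|h}\alpha_1,$$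 $$\delta=\eta\sup_{l\in\mathbb{Z}_{\ge0}}\left\{\sum_{i=0}^{l-1}|F^i|\right\}e^{3|A|h}(\alpha_1+\alpha_2)+e^{3|A|h}\int_0^{3h}e^{|A|s}ds+e^{3|A|h}(\alpha_1+\alpha_2).$$ Upper bound $\bar\rho$. Let $$c_\Theta=\sup_{\theta\in[2h,3h],\,\tau_0\in[0,\tau_M]}\int_{2h}^{\theta}|e^{A(\theta-\sigma)}|\,S(\sigma)\,|K(\sigma)|\,|e^{A(\sigma-h-\tau_0)}|\,d\sigma$$ (with $K$ evaluated by its formula with $l=0$), $M=1+\sup_{\tau_0\in[0,\tau_M]}|e^{3Ah}(I_n-e^{-A\tau_0})|$, and let $\bar\eta,\bar\alpha_1$ be finite uniform upper bounds on $\eta,\alpha_1$ over $\tau_0\in[0,\tau_M]$ and $|\Delta B|\le1/c_\Theta$. For $\varepsilon<1/(2qM^{q-1}c_\Theta)$ one has $\rho(q)\le\bar\rho(\varepsilon,f_0)$ for all $\tau_0\in[0,\tau_M]$, $|\Delta B|\le\varepsilon$, where $$\bar\rho(\varepsilon,f_0)=\bar\eta\,qM^{2q-2}c_\Theta\,\varepsilon+e^{3|A|h}\left(2\bar\alpha_1\bar\eta\sum_{j=0}^{q-1}M^j+\int_0^{3h}e^{|A|s}ds+\bar\alpha_1\right)f_0 .$$ Almost fixed-time ISS estimate: an ISS estimate such that the time after which it applies is uniform with respect to the initial condition and whose guaranteed exponential convergence rate tends to infinity as the uncertainty bounds (here $\varepsilon$, $f_0$) tend to zero. Fixed-time ISS: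 a time-delay system $\dot x(t)=F_0(t,x_t,d(t))$ with piecewise continuous, locally bounded disturbance $d$ is fixed-time input-to-state stable if there are $\varphi\in\mathcal K$ and constants $T_1\ge T_2\ge0$ such that, for every admissible initial function and every $d$, the solution is uniquely determined and satisfies $|x(t)|\le\varphi(|d|_{[t-T_2,t]})$ for all $t\ge T_1$. *)

(* Defs.v *)
From HB Require Import structures.
From mathcomp Require Import all_boot all_order all_algebra.
From mathcomp Require Import all_classical all_reals all_analysis.

Set Implicit Arguments.
Unset Strict Implicit.
Unset Printing Implicit Defensive.

Import Order.TTheory GRing.Theory Num.Theory.
Import numFieldNormedType.Exports.

Local Open Scope classical_set_scope.
Local Open Scope ring_scope.

Section Norms.
Context {R : realType}.

(* The norm [`|_|] that the library puts on matrices is the entrywise maximum,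
   hence these two definitions; the topologies agree. *)
Definition enorm n (v : 'cV[R]_n) : R := Num.sqrt (\sum_i v i 0 ^+ 2).

Definition opnorm p n (M : 'M[R]_(p, n)) : R :=
  sup [set enorm (M *m v) | v in [set v : 'cV[R]_n | enorm v <= 1]].

Definition norm_on n (x : R -> 'cV[R]_n) (a b : R) : R :=
  sup [set enorm (x t) | t in `[a, b]].

End Norms.

Section MatrixCalculus.
Context {R : realType}.

Definition expmx n (A : 'M[R]_n) : 'M[R]_n :=
  limn (series (fun k => (k`!%:R)^-1 *: A ^+ k)).

Definition integral_on (a b : R) (f : R -> R) : R :=
  \int[lebesgue_measure]_(s in `[a, b]) f s.

Definition mxintegral p n (a b : R) (M : R -> 'M[R]_(p, n)) : 'M[R]_(p, n) :=
  \matrix_(i, j) integral_on a b (fun s => M s i j).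

End MatrixCalculus.

Section Systems.
Context {R : realType}.

(* Only the values on [0, +oo[ matter.  Discontinuities are finitely many in
   every bounded interval; one-sided limits at them are not required. *)
Definition piecewise_continuous p (d : R -> 'cV[R]_p) : Prop :=
  forall T : R,
    finite_set [set t : R | 0 < t < T /\ ~ {for t, continuous d}].

Definition locally_bounded p (d : R -> 'cV[R]_p) : Prop :=
  forall T : R, exists C : R, forall t, 0 <= t <= T -> enorm (d t) <= C.

Definition disturbance p (d : R -> 'cV[R]_p) : Prop :=
  piecewise_continuous d /\ locally_bounded d.

Definition initial_function n (r : R) (phi : R -> 'cV[R]_n) : Prop :=
  {within `[- r, 0], continuous phi}.

(* [x] solves x'(t) = F x t for t > 0 with x = phi on [-r, 0].  [F x t] may use
   the values of [x] on [t - r, t].  The right-hand sides are only piecewise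
   continuous in time, so a solution is a continuous function that satisfies
   the equation outside a set which is finite in every bounded interval. *)
Definition is_solution n (r : R) (F : (R -> 'cV[R]_n) -> R -> 'cV[R]_n)
    (phi x : R -> 'cV[R]_n) : Prop :=
  [/\ {within `[- r, +oo[, continuous x},
      forall t, - r <= t <= 0 -> x t = phi t
    & forall T : R, exists2 E : set R, finite_set E &
        forall t, 0 < t < T -> ~ E t -> is_derive t 1 x (F x t)].

Definition classK (phi : R -> R) : Prop :=
  [/\ {within `[0, +oo[, continuous phi}, phi 0 = 0
    & forall s t, 0 <= s -> s < t -> phi s < phi t].

(* The disturbance enters [G] as a whole function, since it may act with a
   delay (measurement noise does so through a delayed output). *)
Definition fixed_time_ISS n p (r : R)
    (G : (R -> 'cV[R]_p) -> (R -> 'cV[R]_n) -> R -> 'cV[R]_n) : Prop :=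
  exists (phi : R -> R) (T1 T2 : R),
    [/\ classK phi, 0 <= T2, T2 <= T1
      & forall (x0 : R -> 'cV[R]_n) (d : R -> 'cV[R]_p),
          initial_function r x0 -> disturbance d ->
          exists x : R -> 'cV[R]_n,
            [/\ is_solution r (G d) x0 x,
                forall y, is_solution r (G d) x0 y ->
                  forall t, - r <= t -> y t = x t
              & forall t, T1 <= t ->
                  enorm (x t) <= phi (norm_on d (t - T2) t)]].

(* exp (- lam s), read as 0 for an infinite rate, also at s = 0. *)
Definition decay (lam : \bar R) (s : R) : R :=
  if lam is r%:E then expR (- (r * s)) else 0.

(* An ISS estimate that applies from time [T] on, with rate [lam]. *)
Definition ISS_estimate n p1 p2 (r : R)
    (G : (R -> 'cV[R]_p1) -> (R -> 'cV[R]_p2) -> (R -> 'cV[R]_n) ->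
         R -> 'cV[R]_n)
    (T : R) (lam : \bar R) (gain : R -> R) : Prop :=
  [/\ 0 <= T, (0 < lam)%E, classK gain
    & forall (x0 : R -> 'cV[R]_n) (w1 : R -> 'cV[R]_p1) (w2 : R -> 'cV[R]_p2)
             (x : R -> 'cV[R]_n),
        initial_function r x0 -> disturbance w1 -> disturbance w2 ->
        is_solution r (G w1 w2) x0 x ->
        forall t, T <= t ->
          enorm (x t) <= norm_on x 0 T * decay lam (t - T)
                         + gain (norm_on w1 0 t + norm_on w2 0 t)].

(* The pairs (eps, f0) of nonnegative uncertainty bounds tend to (0, 0). *)
Definition bounds_to_0 : set_system (R * R) :=
  within [set b : R * R | 0 <= b.1 /\ 0 <= b.2] (nbhs ((0, 0) : R * R)).

(* [unc b] is the set of uncertainties compatible with the bounds [b].  The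
   time [T] depends neither on the initial function nor on the uncertainty. *)
Definition almost_fixed_time_ISS_estimate n p1 p2 (U : Type)
    (unc : R * R -> set U) (r : U -> R)
    (G : U -> (R -> 'cV[R]_p1) -> (R -> 'cV[R]_p2) -> (R -> 'cV[R]_n) ->
         R -> 'cV[R]_n)
    (T : R) (lam : R * R -> U -> \bar R) (gain : R * R -> U -> R -> R) :
    Prop :=
  (\forall b \near bounds_to_0, forall u, unc b u ->
     ISS_estimate (r u) (G u) T (lam b u) (gain b u)) /\
  (forall a : R, \forall b \near bounds_to_0, forall u, unc b u ->
     (a%:E < lam b u)%E).

(* Any state can be steered to any other in finite time. *)
Definition controllable n m (A : 'M[R]_n) (B : 'M[R]_(n, m)) : Prop :=
  forall xi0 xi1 : 'cV[R]_n,
    exists (T : R) (u : R -> 'cV[R]_m) (x : R -> 'cV[R]_n),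
      [/\ 0 < T, disturbance u,
          is_solution 0 (fun x t => A *m x t + B *m u t) (fun=> xi0) x
        & x T = xi1].

(* [S] is a function on [0, +oo[; at 0 its one-sided continuous
   differentiability follows from periodicity. *)
Definition admissible_weight (h : R) (S : R -> R) : Prop :=
  [/\ forall t, 0 < t -> derivable S t 1 /\ {for t, continuous (S^`())%classic},
      forall t, 0 <= t -> S (t + 3 * h) = S t,
      forall t, 2 * h <= t <= 3 * h -> 0 <= S t,
      exists2 t, 2 * h < t < 3 * h & 0 < S t
    & [/\ S (2 * h) = 0, S (3 * h) = 0,
          (S^`())%classic (2 * h) = 0 & (S^`())%classic (3 * h) = 0]].

(* Bound and regularity of the unknown f(t, x), t >= 0; the local Lipschitz
   constant is locally uniform in t. *)
Definition nonlinearity n (f0 : R) (f : R -> 'cV[R]_n -> 'cV[R]_n) : Prop :=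
  [/\ forall v, {within `[0, +oo[, continuous (fun t => f t v)},
      forall t0 v0, 0 <= t0 -> exists e L : R, 0 < e /\
        forall t v v', 0 <= t -> `|t - t0| < e ->
          enorm (v - v0) < e -> enorm (v' - v0) < e ->
          enorm (f t v - f t v') <= L * enorm (v - v')
    & forall t v, 0 <= t -> enorm (f t v) <= f0 * enorm v].

Definition uncertainty n m (tauM eps f0 tau0 : R) (dB : 'M[R]_(n, m))
    (f : R -> 'cV[R]_n -> 'cV[R]_n) : Prop :=
  [/\ 0 <= tau0 <= tauM, opnorm dB <= eps & nonlinearity f0 f].

End Systems.

Section ClosedLoop.
Context {R : realType} {n m : nat}.
Variables (A : 'M[R]_n) (B0 : 'M[R]_(n, m)) (h : R) (S : R -> R).

Definition Wc : 'M[R]_n :=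
  mxintegral (2 * h) (3 * h) (fun s =>
    expmx (- s *: A) *m B0 *m (S s *: B0^T) *m expmx (- s *: A^T)).

Definition period (t : R) : R := (Num.floor (t / (3 * h)))%:~R.

Definition gate (t : R) : R :=
  if (3 * period t + 2) * h < t then 1 else 0.

(* K on the l-th period [3 l h, 3 (l + 1) h[ *)
Definition feedback_gain (l t : R) : 'M[R]_(m, n) :=
  B0^T *m expmx (- (t - 3 * l * h) *: A^T) *m invmx Wc
    *m expmx (- (t - 3 * l * h - h) *: A).

Definition K (t : R) : 'M[R]_(m, n) := feedback_gain (period t) t.

Definition output (tau0 : R) (x w2 : R -> 'cV[R]_n) (t : R) : 'cV[R]_n :=
  x (t - tau0) + w2 t.

(* For t < 2 h the gate vanishes, so that [y (t - h)] is never used before y is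
   defined. *)
Definition control (y : R -> 'cV[R]_n) (t : R) : 'cV[R]_m :=
  - ((S t * gate t) *: (K t *m y (t - h))).

Definition closed_loop (tau0 : R) (dB : 'M[R]_(n, m))
    (f : R -> 'cV[R]_n -> 'cV[R]_n) (w1 w2 x : R -> 'cV[R]_n) (t : R) :
    'cV[R]_n :=
  A *m x t + (B0 + dB) *m control (output tau0 x w2) t + f t (x t) + w1 t.

Section Constants.
Variables (tau0 : R) (dB : 'M[R]_(n, m)).

Let eA : R := expR (3 * opnorm A * h).
Let iA : R := integral_on 0 (3 * h) (fun s => expR (opnorm A * s)).

Definition Delta (s : R) : 'M[R]_n :=
  1%:M - mxintegral (2 * h) s (fun r =>
           expmx (- r *: A) *m B0 *m (S r *: B0^T) *m expmx (- r *: A^T))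
         *m invmx Wc *m expmx (- tau0 *: A).

Definition Theta (s : R) : 'M[R]_n :=
  - (mxintegral (2 * h) s (fun r =>
       expmx ((s - r) *: A) *m dB *m (S r *: B0^T) *m expmx (- r *: A^T))
     *m invmx Wc *m expmx (- tau0 *: A)).

Definition Fmx : 'M[R]_n :=
  expmx ((3 * h) *: A) *m (1%:M - expmx (- tau0 *: A))
  - expmx ((3 * h) *: A)
    *m mxintegral (2 * h) (3 * h) (fun s =>
         expmx (- s *: A) *m dB *m (S s *: B0^T) *m expmx (- s *: A^T))
    *m invmx Wc *m expmx (- tau0 *: A).

Definition eta : R :=
  sup [set eA + eA * opnorm (Delta s) + opnorm (Theta s)
      | s in `[2 * h, 3 * h]].

Let feedback_norm (s : R) : R :=
  opnorm (expmx (- s *: A) *m (B0 + dB) *m (S s *: B0^T)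
          *m expmx (- s *: A^T) *m invmx Wc *m expmx (- (s - h) *: A)).

Definition alpha1 : R :=
  integral_on (2 * h) (3 * h) (fun s => feedback_norm s *
    integral_on 0 (s - h - tau0) (fun r =>
      opnorm (expmx ((s - h - tau0 - r) *: A)))) + iA.

Definition alpha2 : R := integral_on (2 * h) (3 * h) feedback_norm.

Definition rho0 (l : nat) : R := eta * opnorm (Fmx ^+ l).

Definition rho1 : R :=
  alpha1 * eta
    * sup (range (fun l : nat => \sum_(0 <= i < l) opnorm (Fmx ^+ i) * eA))
  + eA * iA + eA * alpha1.

Definition rho (f0 : R) (l : nat) : R := rho0 l + rho1 * f0.

Definition delta : R :=
  eta * sup (range (fun l : nat => \sum_(0 <= i < l) opnorm (Fmx ^+ i)))
    * eA * (alpha1 + alpha2)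
  + eA * iA + eA * (alpha1 + alpha2).

End Constants.

Section UpperBound.
Variables (tauM : R) (q : nat).

Definition c_Theta : R :=
  sup [set integral_on (2 * h) z.1 (fun s =>
         opnorm (expmx ((z.1 - s) *: A)) * S s * opnorm (feedback_gain 0 s)
         * opnorm (expmx ((s - h - z.2) *: A)))
      | z in `[2 * h, 3 * h] `*` `[0, tauM]].

Definition Mbound : R :=
  1 + sup [set opnorm (expmx ((3 * h) *: A) *m (1%:M - expmx (- tau0 *: A)))
          | tau0 in `[0, tauM]].

Definition uniform_bounds (etab alpha1b : R) : Prop :=
  forall tau0 dB, 0 <= tau0 <= tauM -> opnorm dB <= 1 / c_Theta ->
    eta tau0 dB <= etab /\ alpha1 tau0 dB <= alpha1b.

Definition rhobar (etab alpha1b eps f0 : R) : R :=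
  etab * q%:R * Mbound ^+ (2 * q - 2) * c_Theta * eps
  + expR (3 * opnorm A * h)
    * (2 * alpha1b * etab * \sum_(0 <= j < q) Mbound ^+ j
       + integral_on 0 (3 * h) (fun s => expR (opnorm A * s)) + alpha1b) * f0.

End UpperBound.

(* -ln(rho) / (3 (q + 1) h), which is +oo for rho = 0. *)
Definition conv_rate (q : nat) (rho : R) : \bar R :=
  if rho == 0 then +oo%E else (- ln rho / (3 * q.+1%:R * h))%:E.

End ClosedLoop.

(* Main.v *)
(* In the coordinates z = exp(-At) x the state moves only through perturbations
   while the control is off.  As tau0 <= h, the measurements used in the control
   phase of a period all come from the free phase of that period, so that the
   state at the end of the period is F times the state at its start, up to
   perturbations weighted by alpha1 and alpha2.  Going back from t over the
   current period and q full ones gives the delay inequality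
     |x(t)| <= rho(q) sup_[t - T, t] |x| + delta (|w1| + |w2|),  T = 3(q + 1)h,
   and a Halanay argument turns it into exponential decay.  The nominal part
   exp(3Ah) (I - exp(-A tau0)) of F is A times a polynomial in A, so its q-th
   power vanishes; hence |F^q| is of the order of |Theta(3h)| <= c_Theta |dB|,
   which makes rho(q) small with eps and f0, and zero when dB = 0 and f0 = 0.
   In the last case the closed loop is solved explicitly, period by period. *)

Require Import Defs.
From HB Require Import structures.
From mathcomp Require Import all_boot all_order all_algebra.
From mathcomp Require Import all_classical all_reals all_analysis.
From mathcomp Require Import ring lra.

Set Implicit Arguments.
Unset Strict Implicit.
Unset Printing Implicit Defensive.

Import Order.TTheory GRing.Theory Num.Theory.
Import numFieldNormedType.Exports.

Local Open Scope classical_set_scope.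
Local Open Scope ring_scope.

(** * Norms *)

(** Solutions satisfy their equation only off a locally finite set, and the control switches inside
    each period. The estimates therefore do not integrate the equation: a vector function is
    compared with a scalar one by a mean value inequality that tolerates finitely many exceptional
    points, and the integrals in the constants enter as antiderivatives. The nonlinearity counts as
    a perturbation of size f0 sup |x| over the window, which is why rho1 f0 joins the contraction
    factor while w1 and w2 go to delta. The suprema over l are finite as soon as |F^q| < 1, because
    the powers of F can be grouped in blocks of q; and eta >= 1 gives |F^q| <= rho(q). The window of
    the delay inequality is closed and contains t, so the inequality is implicit in |x(t)|; this is
    why the Halanay argument works with maxima on a compact interval. Well-posedness is part of
    fixed-time ISS, where f0 = 0 forces f = 0. *)

Section EuclideanNorm.
Context {R : realType}.

Lemma enorm_ge0 n (v : 'cV[R]_n) : 0 <= enorm v.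
Proof. exact: sqrtr_ge0. Qed.

Lemma sum_sqr_ge0 n (v : 'cV[R]_n) : 0 <= \sum_i v i 0 ^+ 2.
Proof. by apply: sumr_ge0 => i _; exact: sqr_ge0. Qed.

Lemma enorm_sqr n (v : 'cV[R]_n) : enorm v ^+ 2 = \sum_i v i 0 ^+ 2.
Proof. by rewrite sqr_sqrtr ?sum_sqr_ge0. Qed.

Lemma coord_le_enorm n (v : 'cV[R]_n) i : `|v i 0| <= enorm v.
Proof.
rewrite -sqrtr_sqr ler_sqrt ?sum_sqr_ge0//.
by rewrite (bigD1 i)//= lerDl sumr_ge0// => j _; exact: sqr_ge0.
Qed.

Lemma enorm_eq0 n (v : 'cV[R]_n) : enorm v = 0 -> v = 0.
Proof.
move=> v0; apply/colP => i; rewrite mxE; apply/eqP.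
by rewrite -normr_eq0 eq_le normr_ge0 andbT -v0 coord_le_enorm.
Qed.

Lemma enorm_le0 n (v : 'cV[R]_n) : enorm v <= 0 -> v = 0.
Proof.
by move=> v0; apply: enorm_eq0; apply/eqP; rewrite eq_le v0 enorm_ge0.
Qed.

Lemma enormZ n a (v : 'cV[R]_n) : enorm (a *: v) = `|a| * enorm v.
Proof.
rewrite /enorm -sqrtr_sqr -sqrtrM ?sqr_ge0// mulr_sumr; congr Num.sqrt.
by apply: eq_bigr => i _; rewrite mxE exprMn.
Qed.

Lemma enorm0 n : enorm (0 : 'cV[R]_n) = 0.
Proof. by rewrite -[X in enorm X](scale0r 0) enormZ normr0 mul0r. Qed.

Lemma enormN n (v : 'cV[R]_n) : enorm (- v) = enorm v.
Proof. by rewrite -scaleN1r enormZ normrN1 mul1r. Qed.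

Lemma cauchy_schwarz n (u v : 'cV[R]_n) :
  \sum_i u i 0 * v i 0 <= enorm u * enorm v.
Proof.
have [/eqP u0|u0] := boolP (enorm u == 0).
  rewrite (enorm_eq0 u0) enorm0 mul0r big1// => i _; by rewrite mxE mul0r.
have [/eqP v0|v0] := boolP (enorm v == 0).
  rewrite (enorm_eq0 v0) enorm0 mulr0 big1// => i _; by rewrite mxE mulr0.
have u_gt0 : 0 < enorm u by rewrite lt_def u0 enorm_ge0.
have v_gt0 : 0 < enorm v by rewrite lt_def v0 enorm_ge0.
(* Expanding this sum of squares gives 2 |u| |v| (|u| |v| - <u, v>). *)
have : 0 <= \sum_i (enorm v * u i 0 - enorm u * v i 0) ^+ 2.
  by apply: sumr_ge0 => i _; exact: sqr_ge0.
have -> : \sum_i (enorm v * u i 0 - enorm u * v i 0) ^+ 2 =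
    enorm v ^+ 2 * (\sum_i u i 0 ^+ 2) + enorm u ^+ 2 * (\sum_i v i 0 ^+ 2)
    - (2 * enorm u * enorm v) * \sum_i u i 0 * v i 0.
  rewrite !mulr_sumr -big_split/= -sumrB; apply: eq_bigr => i _; ring.
rewrite -!enorm_sqr => H.
have {}H : 0 <= (2 * enorm u * enorm v) *
    (enorm u * enorm v - \sum_i u i 0 * v i 0) by apply: le_trans H _; lra.
by move: H; rewrite pmulr_rge0 ?subr_ge0// !mulr_gt0.
Qed.

(** The test vector is v / |v|. This duality turns a bound on a vector into scalar bounds, to which
    real calculus applies; the triangle inequality and the mean value inequality both rest on it. *)
Lemma enorm_dual n (v : 'cV[R]_n) C : 0 <= C ->
  (forall u : 'cV[R]_n, enorm u <= 1 -> \sum_i u i 0 * v i 0 <= C) ->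
  enorm v <= C.
Proof.
move=> C0 H; have [->//|v0] := eqVneq (enorm v) 0.
have v_gt0 : 0 < enorm v by rewrite lt_def v0 enorm_ge0.
have := H ((enorm v)^-1 *: v); rewrite enormZ ger0_norm ?invr_ge0 ?enorm_ge0//.
rewrite mulVf// lexx => /(_ isT).
rewrite (eq_bigr (fun i => (enorm v)^-1 * v i 0 ^+ 2)); last first.
  by move=> i _; rewrite mxE; ring.
by rewrite -mulr_sumr -enorm_sqr expr2 mulrA mulVf// mul1r.
Qed.

Lemma enormD n (u v : 'cV[R]_n) : enorm (u + v) <= enorm u + enorm v.
Proof.
apply: enorm_dual; first by rewrite addr_ge0 ?enorm_ge0.
move=> w w1.
rewrite (eq_bigr (fun i => w i 0 * u i 0 + w i 0 * v i 0)); last first.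
  by move=> i _; rewrite mxE mulrDr.
rewrite big_split/= lerD//.
  by apply: le_trans (cauchy_schwarz _ _) _; rewrite ler_piMl ?enorm_ge0.
by apply: le_trans (cauchy_schwarz _ _) _; rewrite ler_piMl ?enorm_ge0.
Qed.

Lemma enorm_le_sum n (v : 'cV[R]_n) : enorm v <= \sum_i `|v i 0|.
Proof.
apply: enorm_dual; first by apply: sumr_ge0 => i _; exact: normr_ge0.
move=> u u1; apply: ler_sum => i _; apply: le_trans (ler_norm _) _.
by rewrite normrM ler_piMl ?normr_ge0// (le_trans (coord_le_enorm _ _)).
Qed.

Lemma enorm_usubmx n1 n2 (v : 'cV[R]_(n1 + n2)) : enorm (usubmx v) <= enorm v.
Proof.
rewrite ler_sqrt ?sum_sqr_ge0// big_split_ord/= (eq_bigr (fun i =>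
  v (lshift n2 i) 0 ^+ 2)); last by move=> i _; rewrite mxE.
by rewrite lerDl sumr_ge0// => i _; exact: sqr_ge0.
Qed.

Lemma enorm_dsubmx n1 n2 (v : 'cV[R]_(n1 + n2)) : enorm (dsubmx v) <= enorm v.
Proof.
rewrite ler_sqrt ?sum_sqr_ge0// big_split_ord/= (eq_bigr (fun i =>
  v (rshift n1 i) 0 ^+ 2)); last by move=> i _; rewrite mxE.
by rewrite lerDr sumr_ge0// => i _; exact: sqr_ge0.
Qed.

End EuclideanNorm.

Section OperatorNorm.
Context {R : realType}.

Lemma enorm_mulmx_le_sum p n (M : 'M[R]_(p, n)) (v : 'cV[R]_n) :
  enorm (M *m v) <= (\sum_i \sum_j `|M i j|) * enorm v.
Proof.
apply: le_trans (enorm_le_sum _) _; rewrite mulr_suml; apply: ler_sum => i _.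
rewrite mxE mulr_suml; apply: le_trans (ler_norm_sum _ _ _) _.
by apply: ler_sum => j _; rewrite normrM ler_wpM2l ?normr_ge0 ?coord_le_enorm.
Qed.

(** The crude bound by the sum of the entries makes the [sup] in [opnorm] a genuine supremum instead
    of the default 0. *)
Lemma has_sup_opnorm p n (M : 'M[R]_(p, n)) :
  has_sup [set enorm (M *m v) | v in [set v : 'cV[R]_n | enorm v <= 1]].
Proof.
split; first by exists (enorm (M *m 0)), 0; rewrite //= enorm0.
exists (\sum_i \sum_j `|M i j|) => _ [v /= v1 <-].
apply: le_trans (enorm_mulmx_le_sum _ _) _; rewrite ler_piMr//.
by apply: sumr_ge0 => i _; apply: sumr_ge0 => j _; exact: normr_ge0.
Qed.

Lemma opnorm_ge0 p n (M : 'M[R]_(p, n)) : 0 <= opnorm M.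
Proof.
apply: (@le_trans _ _ (enorm (M *m 0))); first exact: enorm_ge0.
by apply: sup_ubound; [case: (has_sup_opnorm M)|exists 0; rewrite //= enorm0].
Qed.

Lemma le_opnorm p n (M : 'M[R]_(p, n)) (v : 'cV[R]_n) :
  enorm (M *m v) <= opnorm M * enorm v.
Proof.
have [v0|v0] := eqVneq (enorm v) 0.
  by rewrite v0 (enorm_eq0 v0) mulmx0 enorm0 mulr0.
have v_gt0 : 0 < enorm v by rewrite lt_def v0 enorm_ge0.
rewrite -ler_pdivrMr// mulrC -[(enorm v)^-1]ger0_norm ?invr_ge0 ?enorm_ge0//.
rewrite -enormZ scalemxAr.
apply: sup_ubound; first by case: (has_sup_opnorm M).
exists ((enorm v)^-1 *: v) => //=.
by rewrite enormZ ger0_norm ?invr_ge0 ?enorm_ge0// mulVf.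
Qed.

Lemma opnorm_le p n (M : 'M[R]_(p, n)) C : 0 <= C ->
  (forall v, enorm (M *m v) <= C * enorm v) -> opnorm M <= C.
Proof.
move=> C0 H; apply: ge_sup; first by case: (has_sup_opnorm M).
move=> _ [v /= v1 <-]; apply: le_trans (H v) _.
by rewrite ler_piMr.
Qed.

Lemma opnorm_le_sum p n (M : 'M[R]_(p, n)) :
  opnorm M <= \sum_i \sum_j `|M i j|.
Proof.
apply: opnorm_le; last exact: enorm_mulmx_le_sum.
by apply: sumr_ge0 => i _; apply: sumr_ge0 => j _; exact: normr_ge0.
Qed.

Lemma opnorm0 p n : opnorm (0 : 'M[R]_(p, n)) = 0.
Proof.
apply/eqP; rewrite eq_le opnorm_ge0 andbT; apply: opnorm_le => // v.
by rewrite mul0mx enorm0 mul0r.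
Qed.

Lemma opnorm_eq0 p n (M : 'M[R]_(p, n)) : opnorm M = 0 -> M = 0.
Proof.
move=> M0; apply/matrixP => i j.
have /enorm_le0/colP/(_ i) : enorm (M *m delta_mx j 0) <= 0.
  by apply: le_trans (le_opnorm _ _) _; rewrite M0 mul0r.
by rewrite -colE !mxE.
Qed.

Lemma opnorm1_le1 n : opnorm (1%:M : 'M[R]_n) <= 1.
Proof. by apply: opnorm_le => // v; rewrite mul1mx mul1r. Qed.

Lemma opnormD p n (M N : 'M[R]_(p, n)) : opnorm (M + N) <= opnorm M + opnorm N.
Proof.
apply: opnorm_le; first by rewrite addr_ge0 ?opnorm_ge0.
move=> v; rewrite mulmxDl mulrDl; apply: le_trans (enormD _ _) _.
by rewrite lerD ?le_opnorm.
Qed.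

Lemma opnormZ_le p n a (M : 'M[R]_(p, n)) : opnorm (a *: M) <= `|a| * opnorm M.
Proof.
apply: opnorm_le; first by rewrite mulr_ge0 ?opnorm_ge0.
by move=> v; rewrite -scalemxAl enormZ -mulrA ler_wpM2l ?le_opnorm.
Qed.

Lemma opnormN p n (M : 'M[R]_(p, n)) : opnorm (- M) = opnorm M.
Proof.
by rewrite /opnorm; congr sup; apply: eq_imagel => v _; rewrite mulNmx enormN.
Qed.

Lemma opnormB p n (M N : 'M[R]_(p, n)) : opnorm (M - N) <= opnorm M + opnorm N.
Proof. by apply: le_trans (opnormD _ _) _; rewrite opnormN. Qed.

Lemma opnormM p n k (M : 'M[R]_(p, n)) (N : 'M[R]_(n, k)) :
  opnorm (M *m N) <= opnorm M * opnorm N.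
Proof.
apply: opnorm_le; first by rewrite mulr_ge0 ?opnorm_ge0.
move=> v; rewrite -mulmxA -mulrA; apply: le_trans (le_opnorm _ _) _.
by rewrite ler_wpM2l ?opnorm_ge0 ?le_opnorm.
Qed.

Lemma opnorm_sum p n (I : Type) (r : seq I) (P : pred I)
    (F : I -> 'M[R]_(p, n)) :
  opnorm (\sum_(i <- r | P i) F i) <= \sum_(i <- r | P i) opnorm (F i).
Proof.
apply: (big_ind2 (fun u a => opnorm u <= a)) => //; first by rewrite opnorm0.
by move=> u a v b ua vb; apply: le_trans (opnormD _ _) _; exact: lerD.
Qed.

Lemma opnormX n (M : 'M[R]_n) k : opnorm (M ^+ k) <= opnorm M ^+ k.
Proof.
elim: k => [|k IH]; first by rewrite !expr0; exact: opnorm1_le1.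
rewrite !exprS; apply: le_trans (opnormM _ _) _.
by rewrite ler_wpM2l ?opnorm_ge0.
Qed.

Lemma dist_opnorm p n (M N : 'M[R]_(p, n)) :
  `|opnorm M - opnorm N| <= opnorm (M - N).
Proof.
rewrite ler_norml; apply/andP; split.
  rewrite lerNl opprB lerBlDr -[opnorm (M - N)]opnormN opprB.
  by apply: le_trans (opnormD _ _); rewrite subrK.
by rewrite lerBlDr; apply: le_trans (opnormD _ _); rewrite subrK.
Qed.

End OperatorNorm.

(** * Calculus of matrix-valued functions *)

Section MatrixCalculusTheory.
Context {R : realType}.

(** Entrywise continuity and, below, entrywise derivatives reduce the calculus rules for matrices,
    products included, to scalar ones; [mx_contP] and [mx_deriveP] tie them to the notions used in
    the definitions. *)
Definition mx_cont p n (M : R -> 'M[R]_(p, n)) (t : R) : Prop :=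
  forall i j, {for t, continuous (fun s => M s i j)}.

Definition mx_derive p n (M : R -> 'M[R]_(p, n)) (t : R) (D : 'M[R]_(p, n)) :=
  forall i j, is_derive t 1 (fun s => M s i j) (D i j).

Lemma continuous_ext (f g : R -> R) (t : R) : f =1 g ->
  {for t, continuous f} -> {for t, continuous g}.
Proof. by move=> /funext ->. Qed.

Lemma is_derive_ext (f g : R -> R) (t df : R) : f =1 g ->
  is_derive t 1 f df -> is_derive t 1 g df.
Proof. by move=> /funext ->. Qed.

Lemma mx_contP p n (M : R -> 'M[R]_(p, n)) t :
  {for t, continuous M} <-> mx_cont M t.
Proof.
split=> [cM i j|cM].
  rewrite /prop_for /continuous_at.
  apply: (@cvg_comp _ _ _ M (fun N : 'M[R]_(p, n) => N i j) _ (nbhs (M t))).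
    exact: cM.
  exact: coord_continuous.
apply/cvgrPdist_le => /= e e0.
near=> s.
rewrite /Num.Def.normr/= mx_normrE (bigmax_le _ (ltW e0))//= => i _.
rewrite !mxE/=.
move: i; near: s; apply: filter_forall => /= i.
by have /cvgrPdist_le := cM i.1 i.2; apply.
Unshelve. all: by end_near. Qed.

Lemma mx_deriveP p n (M : R -> 'M[R]_(p, n)) (t : R) (D : 'M[R]_(p, n)) :
  is_derive t (1 : R) M D <-> mx_derive M t D.
Proof.
split=> [[dM <-] i j|dM].
  rewrite derive_mx// mxE; split=> //.
  by move/derivable_mxP : dM; apply.
have dM1 : derivable M t 1 by apply/derivable_mxP => i j; case: (dM i j).
split=> //; rewrite derive_mx//; apply/matrixP => i j; rewrite mxE.
by case: (dM i j).
Qed.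

Lemma is_derive_continuous (f : R -> R) (t df : R) :
  is_derive t 1 f df -> {for t, continuous f}.
Proof. by case=> + _; move/derivable1_diffP/differentiable_continuous. Qed.

Lemma mx_derive_cont p n (M : R -> 'M[R]_(p, n)) t D :
  mx_derive M t D -> mx_cont M t.
Proof. by move=> dM i j; exact: is_derive_continuous (dM i j). Qed.

Lemma mx_cont_cst p n (M : 'M[R]_(p, n)) t : mx_cont (fun=> M) t.
Proof. by move=> i j; exact: cst_continuous. Qed.

Lemma mx_contD p n (M N : R -> 'M[R]_(p, n)) t :
  mx_cont M t -> mx_cont N t -> mx_cont (fun s => M s + N s) t.
Proof.
move=> cM cN i j.
apply: (@continuous_ext (fun s => M s i j + N s i j)) => [s|]; first by rewrite mxE.
by apply: continuousD; [exact: cM|exact: cN].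
Qed.

Lemma mx_contN p n (M : R -> 'M[R]_(p, n)) t :
  mx_cont M t -> mx_cont (fun s => - M s) t.
Proof.
move=> cM i j.
apply: (@continuous_ext (fun s => - M s i j)) => [s|]; first by rewrite mxE.
by apply: continuousN; exact: cM.
Qed.

Lemma mx_contZ p n (a : R -> R) (M : R -> 'M[R]_(p, n)) t :
  {for t, continuous a} -> mx_cont M t -> mx_cont (fun s => a s *: M s) t.
Proof.
move=> ca cM i j.
apply: (@continuous_ext (fun s => a s * M s i j)) => [s|]; first by rewrite mxE.
by apply: continuousM; [exact: ca|exact: cM].
Qed.

Lemma continuous_sum (I : Type) (r : seq I) (F : I -> R -> R) (t : R) :
  (forall i, {for t, continuous (F i)}) ->
  {for t, continuous (fun s => \sum_(i <- r) F i s)}.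
Proof.
move=> cF; elim: r => [|i r IH].
  apply: (@continuous_ext (fun=> 0)) => [s|]; first by rewrite big_nil.
  exact: cst_continuous.
apply: (@continuous_ext (fun s => F i s + \sum_(j <- r) F j s)) => [s|].
  by rewrite big_cons.
by apply: continuousD; [exact: cF|exact: IH].
Qed.

Lemma mx_contM p n k (M : R -> 'M[R]_(p, n)) (N : R -> 'M[R]_(n, k)) t :
  mx_cont M t -> mx_cont N t -> mx_cont (fun s => M s *m N s) t.
Proof.
move=> cM cN i j.
apply: (@continuous_ext (fun s => \sum_l M s i l * N s l j)) => [s|].
  by rewrite mxE.
apply: continuous_sum => l.
by apply: continuousM; [exact: cM|exact: cN].
Qed.

(** The difference of the norms is dominated by the sum of the entries of |M(t) - M(s)|, a
    continuous function of s that vanishes at s = t. *)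
Lemma continuous_opnorm p n (M : R -> 'M[R]_(p, n)) t :
  mx_cont M t -> {for t, continuous (fun s => opnorm (M s))}.
Proof.
move=> cM.
have cg : {for t, continuous (fun s => \sum_i \sum_j `|(M t - M s) i j|)}.
  apply: continuous_sum => i; apply: continuous_sum => j.
  apply: (@continuous_comp _ _ _ (fun s => (M t - M s) i j) Num.norm).
    apply: mx_contD; first exact: mx_cont_cst.
    exact: mx_contN.
  exact: norm_continuous.
apply/cvgrPdist_le => /= e e0.
near=> s.
apply: le_trans (dist_opnorm _ _) _; apply: le_trans (opnorm_le_sum _) _.
near: s.
have /cvgrPdist_le/(_ e e0) := cg; apply: filterS => s /=.
rewrite subrr big1 => [|i _]; last first.
  by rewrite big1// => j _; rewrite mxE normr0.
rewrite sub0r normrN ger0_norm//.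
by apply: sumr_ge0 => i _; apply: sumr_ge0.
Unshelve. all: by end_near. Qed.

Lemma mx_derive_eq p n (M : R -> 'M[R]_(p, n)) t D D' :
  mx_derive M t D -> D = D' -> mx_derive M t D'.
Proof. by move=> dM <-. Qed.

Lemma mx_derive_cst p n (M : 'M[R]_(p, n)) t : mx_derive (fun=> M) t 0.
Proof. by move=> i j; rewrite mxE; exact: is_derive_cst. Qed.

Lemma mx_deriveD p n (M N : R -> 'M[R]_(p, n)) t DM DN :
  mx_derive M t DM -> mx_derive N t DN ->
  mx_derive (fun s => M s + N s) t (DM + DN).
Proof.
move=> dM dN i j; rewrite mxE.
by apply: is_derive_ext (is_deriveD (dM i j) (dN i j)) => s; rewrite mxE.
Qed.

Lemma mx_deriveN p n (M : R -> 'M[R]_(p, n)) t DM :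
  mx_derive M t DM -> mx_derive (fun s => - M s) t (- DM).
Proof.
move=> dM i j; rewrite mxE.
by apply: is_derive_ext (is_deriveN (dM i j)) => s; rewrite mxE.
Qed.

Lemma mx_deriveB p n (M N : R -> 'M[R]_(p, n)) t DM DN :
  mx_derive M t DM -> mx_derive N t DN ->
  mx_derive (fun s => M s - N s) t (DM - DN).
Proof. by move=> dM dN; apply: mx_deriveD => //; exact: mx_deriveN. Qed.

Lemma is_derive_bigsum (I : Type) (r : seq I) (F dF : I -> R -> R) (t : R) :
  (forall i, is_derive t 1 (F i) (dF i t)) ->
  is_derive t 1 (fun s => \sum_(i <- r) F i s) (\sum_(i <- r) dF i t).
Proof.
move=> cF; elim: r => [|i r IH].
  rewrite big_nil; apply: is_derive_ext (is_derive_cst 0 t 1) => s.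
  by rewrite big_nil.
rewrite big_cons; have cFi := cF i.
by apply: is_derive_ext (is_deriveD cFi IH) => s; rewrite big_cons.
Qed.

Lemma mx_deriveM p n k (M : R -> 'M[R]_(p, n)) (N : R -> 'M[R]_(n, k)) t DM DN :
  mx_derive M t DM -> mx_derive N t DN ->
  mx_derive (fun s => M s *m N s) t (DM *m N t + M t *m DN).
Proof.
move=> dM dN i j.
rewrite !mxE -big_split/=.
apply: (@is_derive_ext (fun s => \sum_l M s i l * N s l j) _ _ _
  (fun s => esym (mxE _ _ _ _))).
apply: (@is_derive_bigsum _ _ (fun l s => M s i l * N s l j)
  (fun l s => DM i l * N t l j + M t i l * DN l j)) => l.
have dMl := dM i l; have dNl := dN l j.
apply: is_derive_eq (is_deriveM dMl dNl) _.
by rewrite addrC /GRing.scale/= [N t l j * _]mulrC.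
Qed.

Lemma is_derive_comp_affine (f : R -> R) (a b t df : R) :
  is_derive (a * t + b) 1 f df ->
  is_derive t 1 (fun s => f (a * s + b)) (a * df).
Proof.
move=> dfat.
have dg : is_derive t 1 (fun s : R => a * s + b) a.
  have d1 := is_deriveD (is_deriveZ a (is_derive_id t (1 : R)))
    (is_derive_cst b t (1 : R)).
  by apply: is_derive_eq d1 _; rewrite addr0 /GRing.scale/= mulr1.
by rewrite mulrC; exact: (@is_derive1_comp _ f (fun s => a * s + b)).
Qed.

Lemma mx_derive_comp_affine p n (M : R -> 'M[R]_(p, n)) (a b t : R) D :
  mx_derive M (a * t + b) D ->
  mx_derive (fun s => M (a * s + b)) t (a *: D).
Proof.
by move=> dM i j; rewrite mxE; exact: (is_derive_comp_affine (dM i j)).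
Qed.

End MatrixCalculusTheory.

(** * Mean value inequalities off finitely many points *)

Section MeanValue.
Context {R : realType}.

Let in_itvP (a b t : R) : t \in `]a, b[ -> a < t < b.
Proof. by rewrite in_itv. Qed.

(** Induction on the exceptional points: one inside ]a, b[ splits the interval into two halves with
    fewer exceptions, one outside is dropped. *)
Lemma nincr_off_finite (f df : R -> R) (E : set R) (a b : R) :
  finite_set E -> a <= b -> {within `[a, b], continuous f} ->
  (forall t, a < t < b -> ~ E t -> is_derive t 1 f (df t) /\ df t <= 0) ->
  f b <= f a.
Proof.
move=> /finite_seqP[s ->]; elim: s a b => [|x s IH] a b ab cf dfP.
  (* [MVT_segment] places c in the closed interval. The surrogate derivative 0 at the end points
     makes that case harmless, as it then says f b = f a. *)
  have [c cab fba] : exists2 c, c \in `[a, b] & f b - f a =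
      (fun c => if c \in `]a, b[ then df c else 0) c * (b - a).
    apply: MVT_segment => // t tab.
    have /in_itvP tab' := tab.
    rewrite tab; suff : is_derive t 1 f (df t) by [].
    by case: (dfP t tab').
  rewrite -subr_le0 fba; case: ifPn => [/in_itvP cab'|_]; last by rewrite mul0r.
  by rewrite mulr_le0_ge0 ?subr_ge0//; case: (dfP c cab').
have [xab|xab] := boolP (a < x < b); last first.
  apply: IH => // t tab st; apply: dfP => //=.
  rewrite inE => /orP[/eqP tx|//]; by rewrite tx in tab; rewrite tab in xab.
have /andP[ax xb] := xab.
apply: (@le_trans _ _ (f x)); apply: IH; [exact: ltW| | |exact: ltW| |].
- apply: continuous_subspaceW cf; by apply: subset_itv; rewrite bnd_simp// ltW.
- move=> t /andP[xt tb] st; apply: dfP; first by rewrite tb (lt_trans ax).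
  rewrite /= inE => /orP[/eqP tx|//]; by rewrite tx ltxx in xt.
- apply: continuous_subspaceW cf; by apply: subset_itv; rewrite bnd_simp// ltW.
- move=> t /andP[at' tx] st; apply: dfP; first by rewrite at' (lt_trans tx).
  rewrite /= inE => /orP[/eqP tx'|//]; by rewrite tx' ltxx in tx.
Qed.

Lemma within_continuous (f : R -> R) (a b : R) :
  (forall t, a <= t <= b -> {for t, continuous f}) ->
  {within `[a, b], continuous f}.
Proof.
by move=> cf; apply: continuous_in_subspaceT => t; rewrite inE /= in_itv => /cf.
Qed.

Lemma ndecr_off_finite (f df : R -> R) (E : set R) (a b : R) :
  finite_set E -> a <= b ->
  (forall t, a <= t <= b -> {for t, continuous f}) ->
  (forall t, a < t < b -> ~ E t -> is_derive t 1 f (df t) /\ 0 <= df t) ->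
  f a <= f b.
Proof.
move=> fE ab cf dfP; rewrite -lerN2.
apply: (@nincr_off_finite (fun t => - f t) (fun t => - df t) E) => //.
  by apply: within_continuous => t tab; apply: continuousN; exact: cf.
by move=> t tab Et; have [? ?] := dfP t tab Et; split; [exact: is_deriveN|rewrite oppr_le0].
Qed.

(** For |u| <= 1 the function <u, phi> - beta has derivative at most |phi'| - beta' <= 0 by
    Cauchy-Schwarz; duality then takes the supremum over u. *)
Lemma mean_value_ineq n (phi dphi : R -> 'cV[R]_n) (beta dbeta : R -> R)
    (E : set R) (a b : R) :
  finite_set E -> a <= b ->
  (forall t, a <= t <= b -> mx_cont phi t) ->
  (forall t, a <= t <= b -> {for t, continuous beta}) ->
  (forall t, a < t < b -> ~ E t ->
    [/\ mx_derive phi t (dphi t), is_derive t 1 beta (dbeta t)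
      & enorm (dphi t) <= dbeta t]) ->
  enorm (phi b - phi a) <= beta b - beta a.
Proof.
move=> fE ab cphi cbeta H.
apply: enorm_dual.
  rewrite subr_ge0; apply: (@ndecr_off_finite _ dbeta E) => // t tab Et.
  by have [_ db dle] := H t tab Et; split=> //; apply: le_trans dle; exact: enorm_ge0.
move=> u u1.
pose f t := \sum_(i <- index_enum 'I_n) u i 0 * phi t i 0 - beta t.
pose df t := \sum_(i <- index_enum 'I_n) u i 0 * dphi t i 0 - dbeta t.
have : f b <= f a.
  apply: (@nincr_off_finite f df E) => //.
    apply: within_continuous => t tab; apply: continuousB; last exact: cbeta.
    apply: continuous_sum => i; apply: continuousM; first exact: cst_continuous.
    exact: cphi.
  move=> t tab Et; have [dp db dle] := H t tab Et; split.
    apply: is_deriveB.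
    apply: (@is_derive_bigsum _ _ _ (fun i s => u i 0 * phi s i 0)
       (fun i s => u i 0 * dphi s i 0)) => i.
    by have ? := dp i 0; exact: is_deriveZ.
  rewrite subr_le0; apply: le_trans dle; apply: le_trans (cauchy_schwarz _ _) _.
  by rewrite ler_piMl ?enorm_ge0.
have -> : \sum_i u i 0 * (phi b - phi a) i 0 =
    \sum_i u i 0 * phi b i 0 - \sum_i u i 0 * phi a i 0.
  by rewrite -sumrB; apply: eq_bigr => i _; rewrite !mxE mulrBr.
rewrite /f; lra.
Qed.

Lemma cst_off_finite p n (M : R -> 'M[R]_(p, n)) (E : set R) (a b : R) :
  finite_set E -> a <= b ->
  (forall t, a <= t <= b -> mx_cont M t) ->
  (forall t, a < t < b -> ~ E t -> mx_derive M t 0) ->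
  M b = M a.
Proof.
move=> fE ab cM dM; apply/matrixP => i j; apply/eqP; rewrite eq_le; apply/andP; split.
  apply: (@nincr_off_finite (fun t => M t i j) (fun=> 0) E) => //.
    by apply: within_continuous => t /cM; apply.
  by move=> t tab Et; split=> //; have := dM t tab Et i j; rewrite mxE.
apply: (@ndecr_off_finite (fun t => M t i j) (fun=> 0) E) => //.
  by move=> t /cM; apply.
by move=> t tab Et; split=> //; have := dM t tab Et i j; rewrite mxE.
Qed.

End MeanValue.

(** * Antiderivatives in place of integrals *)

Section Antiderivatives.
Context {R : realType}.
Let mu := @lebesgue_measure R.

Lemma integral_on_itvB (f : R -> R) (c a b : R) : c <= a -> a <= b ->
  mu.-integrable `[c, b] (EFin \o f) ->
  integral_on a b f = integral_on c b f - integral_on c a f.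
Proof.
move=> ca ab fi; rewrite /integral_on Rintegral_itvB ?bnd_simp//.
rewrite Rintegral_itv_obnd_cbnd//.
apply: integrableS fi => //.
by apply: subset_itv; rewrite bnd_simp.
Qed.

Lemma integral_on_derive (f : R -> R) (c x : R) :
  (forall u, mu.-integrable `[c, u] (EFin \o f)) -> c < x ->
  {for x, continuous f} -> is_derive x 1 (integral_on c ^~ f) (f x).
Proof.
move=> fi cx cf.
have xx1 : x < x + 1 by rewrite ltrDl.
have [dF F'] := continuous_FTC1_closed xx1 (fi _) cx cf.
by apply: DeriveDef; [exact: dF|rewrite derive1E in F'; exact: F'].
Qed.

Lemma integral_on_continuous (f : R -> R) (c x : R) :
  (forall u, mu.-integrable `[c, u] (EFin \o f)) -> c < x ->
  {for x, continuous (integral_on c ^~ f)}.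
Proof.
move=> fi cx; have cx1 : c < x + 1 by rewrite (lt_trans cx)// ltrDl.
have /(continuous_within_itvP _ cx1)[cg _ _] :=
  parameterized_integral_continuous (ltW cx1) (fi (x + 1)).
by apply: cg; rewrite in_itv/= cx ltrDl ltr01.
Qed.

(** The function is continuous on the open set ]a, b[ minus the exceptions; on the remaining finite
    set every function is measurable, because finite sets are closed. *)
Lemma integrable_off_finite (f : R -> R) (a b C : R) (E : set R) :
  finite_set E -> (forall t, a < t < b -> ~ E t -> {for t, continuous f}) ->
  (forall t, a <= t <= b -> `|f t| <= C) ->
  mu.-integrable `[a, b] (EFin \o f).
Proof.
move=> fE cf fC.
pose E' := E `|` [set a; b].
have fE' : finite_set E' by rewrite finite_setU.
have closed_finite (B : set R) : finite_set B -> closed B.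
  by apply: accessible_finite_set_closed.1; exact/hausdorff_accessible/Rhausdorff.
have cE' : closed E' by exact: closed_finite.
pose D := `]a, b[%classic `\` E'.
have oD : open D.
  by rewrite /D setDE; apply: openI; [exact: itv_open|exact: closed_openC].
have mE' : measurable E' by exact: measurable_realfun.closed_measurable.
apply: measurable_bounded_integrable => //.
- by apply: compact_finite_measure; exact: segment_compact.
- have mDE : measurable_fun (D `|` E') f.
    apply/measurable_funU => //; first exact: measurable_realfun.open_measurable.
    split.
      apply: measurable_realfun.open_continuous_measurable_fun => // t; rewrite inE => -[/= tab Et].
      apply: cf; first by rewrite in_itv/= in tab.
      by move=> tE; apply: Et; left.
    move=> _ B mB.
    by apply: measurable_realfun.closed_measurable; apply: closed_finite; exact: finite_setIl.
  apply: measurable_funS mDE => //.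
    apply: measurableU => //; exact: measurable_realfun.open_measurable.
  move=> t /= tab; have [tE|tE] := pselect (E' t); first by right.
  left; split=> //; move: tab; rewrite /= !in_itv/= => /andP[].
  rewrite le_eqVlt => /predU1P[ta|->].
    by exfalso; apply: tE; right; left.
  rewrite le_eqVlt => /predU1P[tb|-> //].
  by exfalso; apply: tE; right; right.
- exists C; split; first exact: num_real.
  move=> M CM t /= tab; apply: le_trans (ltW CM); apply: fC.
  by rewrite in_itv/= in tab.
Qed.

Lemma piecewise_antiderivative (f : R -> R) (c : R) :
  (forall u, finite_set [set t | c < t < u /\ ~ {for t, continuous f}]) ->
  (forall u, exists C, forall t, c <= t <= u -> `|f t| <= C) ->
  [/\ forall x, c < x -> {for x, continuous (integral_on c ^~ f)},
      forall x, c < x -> {for x, continuous f} ->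
        is_derive x 1 (integral_on c ^~ f) (f x)
    & forall a b, c <= a -> a <= b ->
        integral_on a b f = integral_on c b f - integral_on c a f].
Proof.
move=> fE fC.
have fi u : mu.-integrable `[c, u] (EFin \o f).
  have [C Ct] := fC u.
  apply: (@integrable_off_finite f c u C
    [set t | c < t < u /\ ~ {for t, continuous f}]) => // t ctu.
  by move=> H; apply: contrapT => nc; exact: H.
split=> [x cx|x cx|a b ca ab].
- exact: integral_on_continuous.
- exact: integral_on_derive.
- exact: integral_on_itvB.
Qed.

(** Continuity is asked on all of ]c, +oo[ and the antiderivative starts at c' > c. With c < c' < a
    it is differentiable at a from both sides, so no one-sided derivatives occur at the ends of
    [a, b]. *)
Lemma antiderivative (f : R -> R) (c c' : R) : c < c' ->
  (forall x, c < x -> {for x, continuous f}) ->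
  exists F : R -> R,
    (forall x, c' < x -> is_derive x 1 F (f x)) /\
    (forall a b, c' <= a -> a <= b -> integral_on a b f = F b - F a).
Proof.
move=> cc' cf.
have fi u : mu.-integrable `[c', u] (EFin \o f).
  apply: continuous_compact_integrable; first exact: segment_compact.
  apply: within_continuous => t /andP[c't _]; apply: cf.
  exact: lt_le_trans c't.
exists (integral_on c' ^~ f); split=> [x cx|a b ca ab].
  apply: integral_on_derive => //; apply: cf; exact: lt_trans cx.
exact: integral_on_itvB.
Qed.

Lemma integral_on_eq (f g : R -> R) (a b : R) :
  (forall t, a <= t <= b -> f t = g t) -> integral_on a b f = integral_on a b g.
Proof.
by move=> fg; apply: eq_Rintegral => t; rewrite inE/= in_itv/= => /fg.
Qed.

Lemma integral_on_le (f g : R -> R) (c a b : R) : c < a -> a <= b ->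
  (forall x, c < x -> {for x, continuous f}) ->
  (forall x, c < x -> {for x, continuous g}) ->
  (forall x, a <= x <= b -> f x <= g x) ->
  integral_on a b f <= integral_on a b g.
Proof.
move=> ca ab cf cg fg.
have cc' : c < (c + a) / 2 by lra.
have c'a : (c + a) / 2 < a by lra.
have [F [dF ->]] := antiderivative cc' cf => //; last exact: ltW.
have [G [dG ->]] := antiderivative cc' cg => //; last exact: ltW.
suff : G a - F a <= G b - F b by lra.
apply: (@ndecr_off_finite _ (fun t => G t - F t) (fun t => g t - f t) set0) => //.
  move=> t /andP[at' _]; have c't := lt_le_trans c'a at'.
  by apply: continuousB; apply: is_derive_continuous; [exact: dG|exact: dF].
move=> t /andP[at' tb] _; split.
  have ? := dG t (lt_trans c'a at'); have ? := dF t (lt_trans c'a at').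
  exact: is_deriveB.
by rewrite subr_ge0 fg// !ltW.
Qed.

Lemma integral_on_cst (a b k : R) : a <= b ->
  integral_on a b (fun=> k) = k * (b - a).
Proof.
by move=> ab; rewrite /integral_on Rintegral_cst//= lebesgue_measure_itv/=;
  case: ltP => [ab'|ba]; rewrite ?mulr0//; move: ba; rewrite lee_fin => ba;
  have -> : b = a; [apply/eqP; rewrite eq_le ab ba|rewrite subrr mulr0].
Qed.

Lemma integral_on_ge0 (f : R -> R) (a b : R) :
  (forall x, a <= x <= b -> 0 <= f x) -> 0 <= integral_on a b f.
Proof.
by move=> f0; apply: Rintegral_ge0 => x /=; rewrite in_itv/= => /f0.
Qed.

Lemma mx_antiderivative p n (M : R -> 'M[R]_(p, n)) (c c' : R) : c < c' ->
  (forall x, c < x -> mx_cont M x) ->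
  exists F : R -> 'M[R]_(p, n),
    (forall x, c' < x -> mx_derive F x (M x)) /\
    (forall a b, c' <= a -> a <= b -> mxintegral a b M = F b - F a).
Proof.
move=> cc' cM.
have H i j : exists F : R -> R,
    (forall x, c' < x -> is_derive x 1 F (M x i j)) /\
    (forall a b, c' <= a -> a <= b ->
      integral_on a b (fun s => M s i j) = F b - F a).
  by apply: (antiderivative cc') => x cx; exact: cM.
exists (fun x => \matrix_(i, j) sval (cid (H i j)) x); split=> [x cx i j|a b ca ab].
  case: (svalP (cid (H i j))) => + _ => /(_ x cx) dF.
  by apply: is_derive_ext dF => s; rewrite mxE.
apply/matrixP => i j; rewrite !mxE.
by case: (svalP (cid (H i j))) => _; apply.
Qed.

(** Both integrals are increments of antiderivatives F and G; for each v the mean value inequality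
    compares F v with |v| G. *)
Lemma opnorm_mxintegral_le p n (M : R -> 'M[R]_(p, n)) (g : R -> R) (c a b : R) :
  c < a -> a <= b -> (forall x, c < x -> mx_cont M x) ->
  (forall x, c < x -> {for x, continuous g}) ->
  (forall x, a <= x <= b -> opnorm (M x) <= g x) ->
  opnorm (mxintegral a b M) <= integral_on a b g.
Proof.
move=> ca ab cM cg Mg.
have cc' : c < (c + a) / 2 by lra.
have c'a : (c + a) / 2 < a by lra.
apply: opnorm_le.
  apply: integral_on_ge0 => x /Mg; apply: le_trans; exact: opnorm_ge0.
have [F [dF ->]] := mx_antiderivative cc' cM => //; last exact: ltW.
have [G [dG ->]] := antiderivative cc' cg => //; last exact: ltW.
move=> v; rewrite mulmxBl mulrBl.
have dFv x : (c + a) / 2 < x -> mx_derive (fun s => F s *m v) x (M x *m v).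
  move=> cx; apply: mx_derive_eq (mx_deriveM (dF x cx) (mx_derive_cst v x)) _.
  by rewrite mulmx0 addr0.
have dGv x : (c + a) / 2 < x ->
    is_derive x 1 (fun s => G s * enorm v) (g x * enorm v).
  move=> cx; have dGx := dG x cx.
  apply: is_derive_eq (is_deriveM dGx (is_derive_cst (enorm v) x (1 : R))) _.
  by rewrite scaler0 add0r /GRing.scale/= mulrC.
apply: (@mean_value_ineq _ _ (fun s => F s *m v) (fun s => M s *m v)
  (fun s => G s * enorm v)
  (fun s => g s * enorm v) set0) => //.
- by move=> t /andP[at' _]; exact: mx_derive_cont (dFv _ (lt_le_trans c'a at')).
- by move=> t /andP[at' _]; exact: is_derive_continuous (dGv _ (lt_le_trans c'a at')).
- move=> t /andP[at' tb] _; split; first exact: dFv (lt_trans c'a at').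
    exact: dGv (lt_trans c'a at').
  apply: le_trans (le_opnorm _ _) _.
  by rewrite ler_wpM2r ?enorm_ge0// Mg// !ltW.
Qed.

End Antiderivatives.

(** * Exponential of a nilpotent matrix *)

Section NilpotentExponential.
Context {R : realType} {n : nat}.
Variables (A : 'M[R]_n) (q : nat).
Hypothesis Aq : A ^+ q = 0.

Lemma exprZmx (s : R) k : (s *: A) ^+ k = s ^+ k *: A ^+ k.
Proof.
elim: k => [|k IH]; first by rewrite !expr0 scale1r.
rewrite !exprS IH -[LHS]/((s *: A) *m (s ^+ k *: A ^+ k)).
by rewrite -scalemxAl -scalemxAr scalerA.
Qed.

Lemma nilpotent_expr_eq0 k : (q <= k)%N -> A ^+ k = 0.
Proof. by move=> qk; rewrite -(subnK qk) exprD Aq mulr0. Qed.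

(** The partial sums are constant from index q on. The exponential is thus a polynomial in s, which
    makes its derivative and its norm finite computations. *)
Lemma expmx_nilpotent (s : R) :
  expmx (s *: A) = \sum_(k < q) (s ^+ k / k`!%:R) *: A ^+ k.
Proof.
rewrite /expmx.
set u := (X in series X).
have uE m : (q <= m)%N ->
    series u m = \sum_(k < q) (s ^+ k / k`!%:R) *: A ^+ k.
  move=> qm; rewrite seriesEnat/= -(big_mkord predT (fun k => (s ^+ k / k`!%:R) *: A ^+ k)).
  rewrite (@big_cat_nat _ _ _ q)//= [X in _ + X]big_nat_cond [X in _ + X]big1 ?addr0.
    by apply: eq_bigr => k _; rewrite /u exprZmx scalerA mulrC.
  move=> k /andP[/andP[qk _] _].
  by rewrite /u exprZmx nilpotent_expr_eq0// !scaler0.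
apply: cvg_lim => //; apply: (@cvg_near_cst _ _ _ _ \oo).
by exists q => // m /= qm; exact: uE.
Qed.

Lemma expmx_derive (t : R) :
  mx_derive (fun s => expmx (s *: A)) t (A *m expmx (t *: A)).
Proof.
have E s i j : expmx (s *: A) i j =
    \sum_(k <- index_enum 'I_q) (s ^+ k * ((A ^+ k) i j / k`!%:R)).
  rewrite expmx_nilpotent summxE; apply: eq_bigr => k _.
  by rewrite mxE -!mulrA [_^-1 * _]mulrC.
(* Multiplication by A shifts the index: the top term dies since A^(q'+1) = 0, and on the right the
   term k = 0 vanishes through its factor k. *)
have D : A *m expmx (t *: A) =
    \sum_(k < q) (k%:R * t ^+ k.-1 / k`!%:R) *: A ^+ k.
  rewrite expmx_nilpotent mulmx_sumr; case: q Aq => [|q' Aq']; first by rewrite !big_ord0.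
  rewrite big_ord_recr/= big_ord_recl/= mul0r mul0r scale0r add0r.
  rewrite -[X in _ + X]scalemxAr -[A *m A ^+ q']exprS Aq' scaler0 addr0.
  apply: eq_bigr => k _; rewrite -scalemxAr -[A *m _]exprS; congr (_ *: _).
  rewrite /bump/= add1n factS natrM invfM mulrA [_.+1%:R * _]mulrC -!mulrA.
  by rewrite [_.+1%:R * _]mulrA mulfV ?mul1r// pnatr_eq0.
move=> i j; apply: (@is_derive_ext _ _ _ _ _ (fun s => esym (E s i j))).
rewrite D summxE.
apply: (is_derive_eq (is_derive_bigsum _
  (F := fun (k : 'I_q) s => s ^+ k * ((A ^+ k) i j / k`!%:R))
  (dF := fun k s => (((k%:R * s ^+ k.-1 / k`!%:R) *: A ^+ k) : 'M[R]_n) i j) _)) => // k.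
have d1 : is_derive t 1 (fun s : R => s ^+ k) (k%:R * t ^+ k.-1).
  apply: is_derive_ext (is_derive_eq (is_deriveX k (is_derive_id t (1 : R))) _) => [s|].
    by rewrite exprfctE.
  by rewrite /GRing.scale/= mulr1 mulr_natl.
have d2 := is_deriveM d1 (is_derive_cst ((A ^+ k) i j / k`!%:R) t (1 : R)).
apply: is_derive_eq d2 _.
rewrite scaler0 add0r mxE /GRing.scale/=.
by rewrite mulrC [_ i j / _]mulrC mulrA.
Qed.

Lemma expmx_cont (t : R) : mx_cont (fun s => expmx (s *: A)) t.
Proof. exact: mx_derive_cont (expmx_derive t). Qed.

Lemma expmx0 : expmx (0 *: A) = 1%:M.
Proof.
rewrite expmx_nilpotent; case: q Aq => [|q' Aq'].
  by rewrite expr0 big_ord0.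
rewrite big_ord_recl big1 => [|k _]; last by rewrite lift0 expr0n mul0r scale0r.
by rewrite !expr0 addr0 divr1 scale1r.
Qed.

Lemma expmx_comm (s : R) : expmx (s *: A) *m A = A *m expmx (s *: A).
Proof.
rewrite expmx_nilpotent mulmx_suml mulmx_sumr; apply: eq_bigr => k _.
by rewrite -scalemxAl -scalemxAr -[A *m _]exprS -[_ *m A]exprSr.
Qed.

Lemma expmx_rev_derive (s t : R) :
  mx_derive (fun r => expmx ((s - r) *: A)) t (- (expmx ((s - t) *: A) *m A)).
Proof.
have d := @mx_derive_comp_affine _ _ _ (fun r => expmx (r *: A)) (-1) s t
   (A *m expmx ((-1 * t + s) *: A)) (expmx_derive _).
move: d; have -> : -1 * t + s = s - t by rewrite mulN1r addrC.
rewrite expmx_comm scaleN1r; have -> // : (fun r => expmx ((-1 * r + s) *: A)) =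
  (fun r => expmx ((s - r) *: A)).
by apply/funext => r; rewrite mulN1r addrC.
Qed.

Lemma expmx_rev_cont (s t : R) : mx_cont (fun r => expmx ((s - r) *: A)) t.
Proof. exact: mx_derive_cont (expmx_rev_derive s t). Qed.

Lemma expmxN_derive (t : R) :
  mx_derive (fun r => expmx (- r *: A)) t (- (expmx (- t *: A) *m A)).
Proof.
have := expmx_rev_derive 0 t.
have -> : (fun r => expmx ((0 - r) *: A)) = (fun r => expmx (- r *: A)).
  by apply/funext => r; rewrite sub0r.
by rewrite sub0r.
Qed.

Lemma expmxN_cont (t : R) : mx_cont (fun r => expmx (- r *: A)) t.
Proof. exact: mx_derive_cont (expmxN_derive t). Qed.

(** The product has derivative zero in r, as the exponential commutes with A, and equals exp(sA) at
    r = 0. *)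
Lemma expmxB (s r : R) :
  expmx ((s - r) *: A) *m expmx (r *: A) = expmx (s *: A).
Proof.
pose M r := expmx ((s - r) *: A) *m expmx (r *: A).
have dM t : mx_derive M t 0.
  apply: mx_derive_eq (mx_deriveM (expmx_rev_derive s t) (expmx_derive t)) _.
  by rewrite mulNmx mulmxA addrC subrr.
have M0 : M 0 = expmx (s *: A) by rewrite /M subr0 expmx0 mulmx1.
rewrite -M0; have [r0|/ltW r0] := leP 0 r.
  by apply: (@cst_off_finite _ _ _ M set0 0 r) => // t _; exact: mx_derive_cont (dM t).
by apply/esym; apply: (@cst_off_finite _ _ _ M set0 r 0) => // t _;
  exact: mx_derive_cont (dM t).
Qed.

Lemma expmxD (s r : R) :
  expmx ((s + r) *: A) = expmx (s *: A) *m expmx (r *: A).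
Proof. by rewrite -(expmxB (s + r) r) addrK. Qed.

Lemma expmxVl (s : R) : expmx (- s *: A) *m expmx (s *: A) = 1%:M.
Proof. by rewrite -expmxD addNr expmx0. Qed.

Lemma expmxVr (s : R) : expmx (s *: A) *m expmx (- s *: A) = 1%:M.
Proof. by rewrite -expmxD addrN expmx0. Qed.

Lemma trmx_expr k : (A ^+ k)^T = A^T ^+ k.
Proof.
elim: k => [|k IH]; first by rewrite !expr0 trmx1.
by rewrite exprS exprSr trmx_mul IH.
Qed.

Lemma trmx_nilpotent : A^T ^+ q = 0.
Proof. by rewrite -trmx_expr Aq trmx0. Qed.

(** The norm is at most a partial sum of the series for exp(|A| s), whose terms are nonnegative. *)
Lemma opnorm_expmx (s : R) : 0 <= s ->
  opnorm (expmx (s *: A)) <= expR (opnorm A * s).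
Proof.
move=> s0; rewrite expmx_nilpotent; apply: le_trans (opnorm_sum _ _ _) _.
apply: (@le_trans _ _ (series (exp_coeff (opnorm A * s)) q)).
  rewrite seriesEord/=; apply: ler_sum => k _.
  apply: le_trans (opnormZ_le _ _) _.
  rewrite ger0_norm ?divr_ge0 ?exprn_ge0// /exp_coeff/= exprMn.
  rewrite [opnorm A ^+ k * _]mulrC [X in _ <= X]mulrAC ler_wpM2l ?opnormX//.
  by rewrite divr_ge0 ?exprn_ge0.
apply: nondecreasing_cvgn_le; last exact: is_cvg_series_exp_coeff.
apply: nondecreasing_series => k _ _.
by rewrite /exp_coeff/= divr_ge0 ?exprn_ge0 ?mulr_ge0 ?opnorm_ge0.
Qed.

End NilpotentExponential.

Lemma trmx_expmx {R : realType} n (A : 'M[R]_n) q (s : R) : A ^+ q = 0 ->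
  (expmx (s *: A))^T = expmx (s *: A^T).
Proof.
move=> Aq; rewrite (expmx_nilpotent Aq) (expmx_nilpotent (trmx_nilpotent Aq)).
rewrite raddf_sum; apply: eq_bigr => k _.
by rewrite /= linearZ/= trmx_expr.
Qed.

(** Continuity is asked only within [a, b], since the trajectories in [controllable] are continuous
    at their initial time only from the right. *)
Lemma cst_scalar_within {R : realType} (f : R -> R) (E : set R) (a b : R) :
  finite_set E -> a <= b -> {within `[a, b], continuous f} ->
  (forall t, a < t < b -> ~ E t -> is_derive t 1 f 0) -> f b = f a.
Proof.
move=> fE ab cf df; apply/eqP; rewrite eq_le; apply/andP; split.
  by apply: (@nincr_off_finite _ f (fun=> 0) E) => // t tab Et; split=> //; exact: df.
rewrite -lerN2; apply: (@nincr_off_finite _ (fun t => - f t) (fun=> - 0) E) => //.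
  by move=> t; apply: continuousN; exact: cf.
move=> t tab Et; rewrite {2}oppr0; split=> //.
by have ? := df t tab Et; exact: is_deriveN.
Qed.

(** * Invertibility of the controllability Gramian *)

Section Gramian.
Context {R : realType} {n m : nat}.
Variables (A : 'M[R]_n) (B0 : 'M[R]_(n, m)) (h : R) (S : R -> R) (q : nat).
Hypotheses (Aq : A ^+ q = 0) (AB0 : controllable A B0) (h0 : 0 < h).
Hypothesis S_adm : admissible_weight h S.

Lemma weight_cont t : 0 < t -> {for t, continuous S}.
Proof.
by case: S_adm => + _ _ _ _ t0 => /(_ t t0)[/derivable1_diffP/differentiable_continuous].
Qed.

Lemma gram_cont (L : R -> 'M[R]_n) (C : 'M[R]_(n, m)) t : 0 < t -> mx_cont L t ->
  mx_cont (fun s => L s *m C *m (S s *: B0^T) *m expmx (- s *: A^T)) t.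
Proof.
move=> t0 cL; apply: mx_contM; last exact: expmxN_cont (trmx_nilpotent Aq) t.
apply: mx_contM; first by apply: mx_contM => //; exact: mx_cont_cst.
by apply: mx_contZ; [exact: weight_cont|exact: mx_cont_cst].
Qed.

(** Under the hypothesis the input is invisible to v exp(-At) x(t), which is therefore constant
    along every controlled trajectory. Steering v^T to 0 yields v v^T = 0. *)
Lemma controllable_detects (v : 'rV[R]_n) :
  (forall s, v *m expmx (- s *: A) *m B0 = 0) -> v = 0.
Proof.
move=> vEB; have [T [u [x [T0 _ [cx x0 dx] xT]]]] := AB0 v^T 0.
have [E fE dxE] := dx T.
pose f t := \sum_(j <- index_enum 'I_n) (v *m expmx (- t *: A)) 0 j * x t j 0.
have fE' t : f t = (v *m expmx (- t *: A) *m x t) 0 0 by rewrite mxE.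
have : f T = f 0.
  apply: (@cst_scalar_within _ f E) => //; first exact: ltW.
    have csum (r : seq 'I_n) : {within `[0, T], continuous (fun t =>
        \sum_(j <- r) (v *m expmx (- t *: A)) 0 j * x t j 0)}.
      elim: r => [|j r IH].
        rewrite (_ : (fun _ => _) = fun=> 0); first by move=> t; exact: cst_continuous.
        by apply/funext => t; rewrite big_nil.
      rewrite (_ : (fun _ => _) = fun t => (v *m expmx (- t *: A)) 0 j * x t j 0 +
        \sum_(j <- r) (v *m expmx (- t *: A)) 0 j * x t j 0); last first.
        by apply/funext => t; rewrite big_cons.
      have c1 : {within `[0, T], continuous (fun t => (v *m expmx (- t *: A)) 0 j)}.
        apply: within_continuous => t _.
        by apply: mx_contM; [exact: mx_cont_cst|exact: expmxN_cont Aq t].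
      have c2 : {within `[0, T], continuous (fun t => x t j 0)}.
        have cx' : {within `[0, T], continuous x}.
          by apply: continuous_subspaceW cx; apply: subset_itv; rewrite ?bnd_simp ?oppr0.
        move=> t; apply: (@cvg_comp _ _ _ x (fun N : 'cV[R]_n => N j 0) _ (nbhs (x t))).
          exact: cx'.
        exact: coord_continuous.
      by move=> t; exact: (continuousD (continuousM (c1 t) (c2 t)) (IH t)).
    exact: csum.
  move=> t tT Et; have dxt := (mx_deriveP _ _ _).1 (dxE t tT Et).
  have := mx_deriveM (mx_deriveM (mx_derive_cst v t) (expmxN_derive Aq t)) dxt.
  move=> /(_ 0 0); rewrite mul0mx add0r [X in is_derive _ _ _ X](_ : _ = 0).
    by apply: is_derive_ext => s; rewrite fE'.
  rewrite mulmxN mulNmx mulmxDr [_ *m (B0 *m u t)]mulmxA vEB mul0mx addr0 !mulmxA.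
  by rewrite addNr mxE.
rewrite !fE' xT mulmx0 x0 ?oppr0 ?lexx// [LHS]mxE (expmx0 Aq) mulmx1 => /esym vv.
apply/rowP => j; rewrite mxE; apply/eqP.
have : \sum_j v 0 j ^+ 2 == 0.
  apply/eqP; rewrite -[RHS]vv mxE; apply: eq_bigr => i _; by rewrite mxE.
rewrite psumr_eq0 => [/allP/(_ j)|i _]; last exact: sqr_ge0.
by rewrite mem_index_enum sqrf_eq0 => /(_ isT).
Qed.

Lemma expmx_row_poly (v : 'rV[R]_n) (j : 'I_m) : exists p : {poly R},
  forall s, (v *m expmx (- s *: A) *m B0) 0 j = p.[s].
Proof.
exists (\sum_(k < q) ((-1) ^+ k / k`!%:R * (v *m A ^+ k *m B0) 0 j) *: 'X^k) => s.
rewrite (expmx_nilpotent Aq) mulmx_sumr mulmx_suml summxE horner_sum.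
apply: eq_bigr => k _; rewrite -scalemxAr -scalemxAl mxE hornerZ hornerXn [(- s) ^+ k]exprNn.
move: (_ 0 j) ((k`!%:R)^-1) (s ^+ k) ((-1) ^+ k) => a b c d; ring.
Qed.

Lemma poly_eq0_oo (p : {poly R}) (a b : R) : a < b ->
  (forall s, a < s < b -> p.[s] = 0) -> p = 0.
Proof.
move=> ab pab; apply/eqP; apply: contraT => p0.
(* The points g 0, ..., g (size p - 1) are distinct roots in ]a, b[, one more than the degree of p
   allows. *)
pose g (i : nat) := a + (b - a) / i.+2%:R.
have gab i : a < g i < b.
  rewrite /g ltrDl divr_gt0 ?subr_gt0//= -ltrBrDl ltr_pdivrMr//.
  by rewrite ltr_pMr ?subr_gt0// ltr1n.
have := @max_poly_roots _ p [seq g i | i <- iota 0 (size p)] p0.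
rewrite size_map size_iota ltnn; apply.
  by apply/allP => _ /mapP[i _ ->]; rewrite rootE pab ?gab.
rewrite map_inj_uniq ?iota_uniq// => i j /addrI/mulfI.
rewrite subr_eq0 gt_eqF// => /(_ isT)/invr_inj/eqP.
by rewrite eqr_nat => /eqP[].
Qed.

(* If v Wc = 0 then v exp(-As) B0 vanishes where S > 0, hence everywhere, being
   polynomial in s. *)
Lemma Wc_unit : Wc A B0 h S \in unitmx.
Proof.
suff inj (v : 'rV[R]_n) : v *m Wc A B0 h S = 0 -> v = 0.
  rewrite -row_free_unit -kermx_eq0; apply/eqP/row_matrixP => i.
  by rewrite row0; apply: inj; rewrite -row_mul mulmx_ker row0.
move=> vW.
have [_ _ S0 [hs hs23 Shs] _] := S_adm.
have hh : 0 < h by [].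
have cG x : 0 < x -> mx_cont (fun s => expmx (- s *: A) *m B0 *m (S s *: B0^T)
    *m expmx (- s *: A^T)) x.
  by move=> x0; apply: gram_cont => //; exact: expmxN_cont Aq x.
have [F [dF FW]] := mx_antiderivative h0 cG.
pose c s := v *m expmx (- s *: A) *m B0.
(* The quadratic form of an antiderivative of the Gramian integrand: its derivative is S |c|^2 >= 0,
   and v Wc = 0 makes its end values agree, so it is constant on [2h, 3h]. *)
pose G t := (v *m F t *m v^T) 0 0.
have dG t : h < t -> is_derive t 1 G (S t * \sum_j c t 0 j ^+ 2).
  move=> ht; have d := mx_deriveM (mx_deriveM (mx_derive_cst v t) (dF t ht))
    (mx_derive_cst v^T t) 0 0.
  apply: is_derive_eq d _; rewrite mulmx0 addr0 mul0mx add0r.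
  rewrite -scalemxAr -scalemxAl -scalemxAr -scalemxAl mxE; congr (_ * _).
  rewrite !mulmxA -/(c t) -[c t *m B0^T *m _ *m _]mulmxA.
  rewrite -[c t *m B0^T *m _]mulmxA.
  have -> : B0^T *m (expmx (- t *: A^T) *m v^T) = (c t)^T.
    by rewrite /c !trmx_mul (trmx_expmx _ Aq).
  rewrite mxE; apply: eq_bigr => j _.
  by rewrite expr2; congr (_ * _); rewrite [LHS]mxE.
have G32 : G (3 * h) = G (2 * h).
  apply/eqP; rewrite -subr_eq0; apply/eqP.
  rewrite /G; have -> : (v *m F (3 * h) *m v^T) 0 0 - (v *m F (2 * h) *m v^T) 0 0 =
     (v *m (F (3 * h) - F (2 * h)) *m v^T) 0 0.
    by rewrite mulmxBr mulmxBl !mxE.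
  rewrite -FW; [|lra|lra].
  by rewrite -[mxintegral _ _ _]/(Wc A B0 h S) vW mul0mx mxE.
have mono a b : 2 * h <= a -> a <= b -> b <= 3 * h -> G a <= G b.
  move=> ha ab hb; apply: (@ndecr_off_finite _ _ _ set0 a b _ ab) => //.
    move=> t /andP[at' _]; apply: is_derive_continuous (dG t _); lra.
  move=> t /andP[at' tb] _; split; first by apply: dG; lra.
  rewrite mulr_ge0 ?sumr_ge0//; first by apply: S0; lra.
  by move=> i _; exact: sqr_ge0.
have Gcst t : 2 * h <= t <= 3 * h -> G t = G (2 * h).
  move=> /andP[t2 t3]; apply/eqP; rewrite eq_le -{1}G32.
  by rewrite !mono//; lra.
have c0 t : 2 * h < t < 3 * h -> 0 < S t -> c t = 0.
  move=> /andP[t2 t3] St.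
  have dG0 : is_derive t 1 G 0.
    have d0 := is_derive_cst (G (2 * h)) t (1 : R).
    apply: near_eq_is_derive d0.
    near=> s; rewrite /cst Gcst//; apply/andP; split; apply: ltW.
      by near: s; exact: lt_nbhsr.
    by near: s; exact: lt_nbhsl.
  have ht : h < t by lra.
  have [_ e1] := dG t ht; have [_ e2] := dG0; move: e1; rewrite e2 => /esym/eqP.
  rewrite mulf_eq0 gt_eqF//= psumr_eq0 => [/allP H|i _]; last exact: sqr_ge0.
  apply/rowP => j; rewrite [RHS]mxE; apply/eqP; rewrite -sqrf_eq0.
  by have := H j; rewrite mem_index_enum; apply.
have /andP[hs2 hs3] := hs23.
have hs0 : 0 < hs by lra.
have [e e0 eS] : exists2 e, 0 < e & forall t, `|hs - t| < e -> 0 < S t.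
  have /cvgrPdist_lt/(_ _ Shs) := weight_cont hs0.
  move=> [e /= e0 H]; exists e => // t /H /=.
  by rewrite ltr_norml => /andP[_]; rewrite ltrBlDr ltrDl.
apply: controllable_detects => s; apply/rowP => j; rewrite [RHS]mxE.
have [p pE] := expmx_row_poly v j; rewrite pE.
(* Between hs and b the weight stays positive and the time stays in the control phase, so the
   polynomial vanishes on a whole interval. *)
pose b := Num.min (hs + e) (3 * h).
have hsb : hs < b by rewrite lt_min hs3 ltrDl e0.
rewrite (@poly_eq0_oo p hs b hsb) ?horner0// => t /andP[hst tb].
move: tb; rewrite lt_min => /andP[t1 t3].
rewrite -pE -/(c t) c0 ?mxE//; first by rewrite t3 andbT; lra.
by apply: eS; rewrite ltr0_norm ?subr_lt0//; lra.
Unshelve. all: by end_near. Qed.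

(** With B0 = 0 even the all-ones row would pass the test of [controllable_detects]. The lemma
    serves the positivity of [c_Theta]. *)
Lemma controllable_neq0 : (0 < n)%N -> B0 != 0.
Proof.
move=> n0; apply: contraT; rewrite negbK => /eqP B00.
have := @controllable_detects (const_mx 1).
have H s : const_mx 1 *m expmx (- s *: A) *m B0 = 0 :> 'rV_m by rewrite B00 mulmx0.
by move=> /(_ H)/rowP/(_ (Ordinal n0)); rewrite !mxE => /eqP; rewrite oner_eq0.
Qed.

End Gramian.

Section IntegralRules.
Context {R : realType}.

Lemma mxintegral_FTC p n (M F : R -> 'M[R]_(p, n)) (c a b : R) :
  c < a -> a <= b -> (forall x, c < x -> mx_cont M x) ->
  (forall x, a <= x <= b -> mx_derive F x (M x)) ->
  mxintegral a b M = F b - F a.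
Proof.
move=> ca ab cM dF.
have cc' : c < (c + a) / 2 by lra.
have c'a : (c + a) / 2 < a by lra.
have [G [dG GM]] := mx_antiderivative cc' cM.
rewrite GM//; last exact: ltW.
have dGF x : a <= x <= b -> mx_derive (fun s => G s - F s) x 0.
  move=> xab; rewrite -(subrr (M x)); apply: mx_deriveB; last exact: dF.
  by apply: dG; case/andP: xab => ax _; exact: lt_le_trans ax.
have : G b - F b = G a - F a.
  apply: (@cst_off_finite _ _ _ (fun s => G s - F s) set0 a b) => // t tab.
    exact: mx_derive_cont (dGF t tab).
  by move=> _; apply: dGF; case/andP: tab => at' tb; rewrite !ltW.
move=> e; apply/eqP.
by rewrite subr_eq -addrA [- F a + _]addrC -e addrC subrK.
Qed.

Lemma mxintegralD p n (M N : R -> 'M[R]_(p, n)) (c a b : R) :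
  c < a -> a <= b -> (forall x, c < x -> mx_cont M x) ->
  (forall x, c < x -> mx_cont N x) ->
  mxintegral a b (fun s => M s + N s) = mxintegral a b M + mxintegral a b N.
Proof.
move=> ca ab cM cN.
have cc' : c < (c + a) / 2 by lra.
have c'a : (c + a) / 2 < a by lra.
have [F [dF ->]] := mx_antiderivative cc' cM => //; last exact: ltW.
have [G [dG ->]] := mx_antiderivative cc' cN => //; last exact: ltW.
rewrite (@mxintegral_FTC _ _ _ (fun s => F s + G s) c a b)//.
- by rewrite opprD addrACA.
- by move=> x cx; apply: mx_contD; [exact: cM|exact: cN].
- move=> x /andP[ax _]; have c'x := lt_le_trans c'a ax.
  by apply: mx_deriveD; [exact: dF|exact: dG].
Qed.

Lemma mxintegralMl p n k (C : 'M[R]_(k, p)) (M : R -> 'M[R]_(p, n)) (c a b : R) :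
  c < a -> a <= b -> (forall x, c < x -> mx_cont M x) ->
  mxintegral a b (fun s => C *m M s) = C *m mxintegral a b M.
Proof.
move=> ca ab cM.
have cc' : c < (c + a) / 2 by lra.
have c'a : (c + a) / 2 < a by lra.
have [F [dF ->]] := mx_antiderivative cc' cM => //; last exact: ltW.
rewrite (@mxintegral_FTC _ _ _ (fun s => C *m F s) c a b)//.
- by rewrite mulmxBr.
- by move=> x cx; apply: mx_contM; [exact: mx_cont_cst|exact: cM].
- move=> x /andP[ax _]; have c'x := lt_le_trans c'a ax.
  apply: mx_derive_eq (mx_deriveM (mx_derive_cst C x) (dF x c'x)) _.
  by rewrite mul0mx add0r.
Qed.

Lemma mxintegral_eq p n (M N : R -> 'M[R]_(p, n)) (a b : R) :
  (forall t, a <= t <= b -> M t = N t) -> mxintegral a b M = mxintegral a b N.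
Proof.
move=> MN; apply/matrixP => i j; rewrite !mxE; apply: integral_on_eq => t tab.
by rewrite MN.
Qed.

(** Substitution r -> c - r, obtained from a constant sum of antiderivatives. It moves c out of the
    integrand, so that the inner integral of [alpha1] can be differentiated in c. *)
Lemma integral_on_opnorm_rev n (A : 'M[R]_n) q (c : R) : A ^+ q = 0 -> 0 <= c ->
  integral_on 0 c (fun r => opnorm (expmx ((c - r) *: A))) =
  integral_on 0 c (fun r => opnorm (expmx (r *: A))).
Proof.
move=> Aq c0.
have l21 : (-2 : R) < -1 by lra.
have c1 (x : R) : -2 < x -> {for x, continuous (fun r : R => opnorm (expmx ((c - r) *: A)))}.
  by move=> _; apply: continuous_opnorm; exact: expmx_rev_cont Aq c x.
have c2 (x : R) : -2 < x -> {for x, continuous (fun r : R => opnorm (expmx (r *: A)))}.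
  by move=> _; apply: continuous_opnorm; exact: expmx_cont Aq x.
have [F [dF FE]] := antiderivative l21 c1.
have [G [dG GE]] := antiderivative l21 c2.
have l10 : (-1 : R) <= 0 by lra.
apply: etrans (FE _ _ l10 c0) _; apply: etrans (esym (GE _ _ l10 c0)).
have d x : 0 <= x <= c -> is_derive x 1 (fun r => F r + G (c - r)) 0.
  move=> /andP[x0 xc].
  have dF' : is_derive x 1 F (opnorm (expmx ((c - x) *: A))) by apply: dF; lra.
  have dG' : is_derive x 1 (fun r => G (c - r)) (- opnorm (expmx ((c - x) *: A))).
    have dGx : is_derive (-1 * x + c) 1 G (opnorm (expmx ((c - x) *: A))).
      have -> : -1 * x + c = c - x by lra.
      by apply: dG; lra.
    have d := is_derive_comp_affine dGx; rewrite mulN1r in d.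
    by apply: is_derive_ext d => r; congr G; lra.
  by apply: is_derive_eq (is_deriveD dF' dG') _; rewrite subrr.
have : F c + G (c - c) = F 0 + G (c - 0).
  apply: (@cst_scalar_within _ (fun r => F r + G (c - r)) set0) => //.
    by apply: within_continuous => t /d; exact: is_derive_continuous.
  by move=> t /andP[t0 tc] _; apply: d; rewrite !ltW.
by rewrite subrr subr0; lra.
Qed.

Lemma expRM_cont (a x : R) : {for x, continuous (fun s => expR (a * s))}.
Proof.
apply: (@continuous_comp _ _ _ (fun s => a * s) expR).
  exact: mulrl_continuous.
exact: continuous_expR.
Qed.

Lemma continuous_bounded (f : R -> R) (a b : R) :
  (forall x, a <= x <= b -> {for x, continuous f}) ->
  exists2 C, 0 <= C & forall x, a <= x <= b -> f x <= C.
Proof.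
move=> cf; have [ab|ba] := leP a b; last first.
  by exists 0 => // x /andP[ax xb]; have := le_lt_trans (le_trans ax xb) ba; rewrite ltxx.
have [c _ fc] := EVT_max ab (within_continuous cf).
exists (Num.max 0 (f c)); first by rewrite le_max lexx.
by move=> x xab; rewrite le_max fc ?orbT// in_itv.
Qed.

End IntegralRules.

(** * Algebra and bounds of the matrices of one period *)

Section Period.
Context {R : realType} {n m : nat}.
Variables (A : 'M[R]_n) (B0 : 'M[R]_(n, m)) (h : R) (S : R -> R) (q : nat).
Hypotheses (Aq : A ^+ q = 0) (h0 : 0 < h) (S_adm : admissible_weight h S).

Local Notation E s := (expmx (s *: A)).
Local Notation W := (Wc A B0 h S).
Local Notation eA := (expR (3 * opnorm A * h)).

(** The integrand of [Wc] with the left factor B0 replaced by C: the choice C = dB occurs in [Theta]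
    and [Fmx], C = B0 + dB in the true closed loop. *)
Definition gram (C : 'M[R]_(n, m)) (r : R) : 'M[R]_n :=
  E (- r) *m C *m (S r *: B0^T) *m expmx (- r *: A^T).

Lemma gram_c C r : 0 < r -> mx_cont (gram C) r.
Proof. by move=> r0; apply: (gram_cont Aq S_adm) => //; exact: expmxN_cont Aq r. Qed.

(** The matrix whose norm is integrated in [alpha1] and [alpha2]; up to sign, it is the effect of a
    measurement on the derivative of exp(-As) x. *)
Definition feedback_mx (dB : 'M[R]_(n, m)) (s : R) : 'M[R]_n :=
  E (- s) *m (B0 + dB) *m (S s *: B0^T) *m expmx (- s *: A^T) *m invmx W
  *m E (- (s - h)).

(* Maps the state at the start of a period to the state s later, in the control
   phase and without perturbations. *)
Definition transition (tau0 : R) (dB : 'M[R]_(n, m)) (s : R) : 'M[R]_n :=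
  E s *m Delta A B0 h S tau0 s + Theta A B0 h S tau0 dB s.

Lemma ThetaE tau0 dB s : 2 * h <= s -> Theta A B0 h S tau0 dB s =
  - (E s *m mxintegral (2 * h) s (gram dB) *m invmx W *m E (- tau0)).
Proof.
have hp := h0; move=> hs; have h2 : 0 < 2 * h by lra.
have e : mxintegral (2 * h) s (fun r =>
      E (s - r) *m dB *m (S r *: B0^T) *m expmx (- r *: A^T)) =
    E s *m mxintegral (2 * h) s (gram dB).
  apply: etrans (mxintegralMl (E s) h2 hs (@gram_c dB)).
  apply: mxintegral_eq => r _.
  by rewrite /gram !mulmxA -(expmxD Aq).
exact: (congr1 (fun M => - (M *m invmx W *m E (- tau0))) e).
Qed.

(** The nominal part [Delta] and the mismatch part [Theta] merge, because the Gramian integral is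
    linear in C = B0 + dB. *)
Lemma transitionE tau0 dB s : 2 * h <= s -> transition tau0 dB s =
  E s *m (1%:M - mxintegral (2 * h) s (gram (B0 + dB)) *m invmx W *m E (- tau0)).
Proof.
have hp := h0; move=> hs; have h2 : 0 < 2 * h by lra.
have e : mxintegral (2 * h) s (gram (B0 + dB)) =
    mxintegral (2 * h) s (gram B0) + mxintegral (2 * h) s (gram dB).
  apply: etrans (mxintegralD h2 hs (@gram_c B0) (@gram_c dB)).
  by apply: mxintegral_eq => r _; rewrite /gram mulmxDr !mulmxDl.
rewrite /transition ThetaE// e.
have -> : Delta A B0 h S tau0 s =
  1%:M - mxintegral (2 * h) s (gram B0) *m invmx W *m E (- tau0) by [].
move: (mxintegral _ _ (gram B0)) (mxintegral _ _ (gram dB)) (E s) (E _) => G1 G2 E1 E2.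
by rewrite !mulmxBr mulmx1 !mulmxDl mulmxDr opprD addrA !mulmxA.
Qed.

(** At s = 3h the integral in [Delta] is the full Gramian and cancels against its inverse; this is
    where invertibility identifies [Fmx] with the period map. *)
Lemma FmxE tau0 dB : W \in unitmx ->
  Fmx A B0 h S tau0 dB = transition tau0 dB (3 * h).
Proof.
move=> Wu; have h23 : 2 * h <= 3 * h by have := h0; lra.
rewrite /transition ThetaE//.
have -> : Delta A B0 h S tau0 (3 * h) = 1%:M - W *m invmx W *m E (- tau0) by [].
by rewrite mulmxV// mul1mx.
Qed.

Lemma opnorm_expmx_le_eA s : 0 <= s <= 3 * h -> opnorm (E s) <= eA.
Proof.
move=> /andP[s0 s3]; apply: le_trans (opnorm_expmx Aq s0) _.
rewrite ler_expR mulrAC mulrC.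
by rewrite [_ * h * _]mulrC -[X in X <= _]mulrC ler_wpM2l ?opnorm_ge0.
Qed.

Lemma opnorm_expmxN s : 0 <= s -> opnorm (E (- s)) <= expR (opnorm A * s).
Proof.
move=> s0; have Aq' : (- A) ^+ q = 0 by rewrite -scaleN1r exprZmx Aq scaler0.
have := opnorm_expmx Aq' s0.
by rewrite opnormN scalerN -scaleNr.
Qed.

Lemma feedback_mx_cont dB s : 0 < s -> mx_cont (feedback_mx dB) s.
Proof.
move=> s0; apply: mx_contM.
  by apply: mx_contM; [exact: gram_c|exact: mx_cont_cst].
have -> : (fun r => E (- (r - h))) = (fun r => E (h - r)).
  by apply/funext => r; rewrite opprB.
exact: (expmx_rev_cont Aq).
Qed.

(** Compactness of [2h, 3h] and [-3h, 3h]. The norm of dB is pulled out of that of [gram], which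
    makes the bound uniform over the ball of radius b. *)
Lemma uniform_norm_bounds (b : R) : 0 <= b -> exists C : R, [/\ 0 <= C,
    forall dB s, opnorm dB <= b -> 2 * h <= s <= 3 * h ->
      opnorm (gram dB s) <= C,
    forall r, - (3 * h) <= r <= 3 * h -> opnorm (E r) <= C
  & opnorm (invmx W) <= C].
Proof.
move=> b0.
have [C1 C10 C1P] : exists2 C, 0 <= C & forall r, 2 * h <= r <= 3 * h ->
    opnorm (E (- r)) * opnorm ((S r *: B0^T) *m expmx (- r *: A^T)) <= C.
  have hp := h0; apply: continuous_bounded => r /andP[r2 _]; have r0 : 0 < r by lra.
  apply: continuousM; apply: continuous_opnorm; first exact: expmxN_cont Aq r.
  apply: mx_contM; last exact: expmxN_cont (trmx_nilpotent Aq) r.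
  by apply: mx_contZ; [exact: (weight_cont S_adm)|exact: mx_cont_cst].
have [C2 C20 C2P] : exists2 C, 0 <= C & forall r, - (3 * h) <= r <= 3 * h ->
    opnorm (E r) <= C.
  by apply: continuous_bounded => r _; apply: continuous_opnorm; exact: expmx_cont Aq r.
exists (b * C1 + C2 + opnorm (invmx W)); split.
- by rewrite !addr_ge0 ?mulr_ge0 ?opnorm_ge0.
- move=> dB s dBb s23.
  apply: (@le_trans _ _ (b * C1)); last first.
    by rewrite -addrA lerDl addr_ge0 ?opnorm_ge0.
  rewrite /gram -mulmxA; apply: le_trans (opnormM _ _) _.
  apply: (@le_trans _ _ ((opnorm (E (- s)) * opnorm dB) *
      opnorm ((S s *: B0^T) *m expmx (- s *: A^T)))).
    by rewrite ler_wpM2r ?opnorm_ge0 ?opnormM.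
  rewrite [opnorm (E _) * _]mulrC -mulrA; apply: ler_pM => //.
  - exact: opnorm_ge0.
  - by rewrite mulr_ge0 ?opnorm_ge0.
  - exact: C1P.
- move=> r r3; apply: le_trans (C2P r r3) _.
  by rewrite addrAC lerDr addr_ge0 ?mulr_ge0 ?opnorm_ge0.
- by rewrite lerDr addr_ge0 ?mulr_ge0.
Qed.

End Period.

(** * One period of the closed loop *)

Section PeriodEstimate.
Context {R : realType} {n m : nat}.
Variables (A : 'M[R]_n) (B0 : 'M[R]_(n, m)) (h : R) (S : R -> R) (q : nat).
Hypotheses (Aq : A ^+ q = 0) (h0 : 0 < h) (S_adm : admissible_weight h S).
Variables (tau0 : R) (dB : 'M[R]_(n, m)).
Hypotheses (tau0_ge0 : 0 <= tau0) (tau0_le : tau0 <= h).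

Local Notation E s := (expmx (s *: A)).
Local Notation W := (Wc A B0 h S).
Local Notation eA := (expR (3 * opnorm A * h)).
Local Notation iA := (integral_on 0 (3 * h) (fun s => expR (opnorm A * s))).
Local Notation fmx := (feedback_mx A B0 h S dB).

(** Bounds the deviation from the free motion after time c under a perturbation of norm at most 1;
    it is the inner integral of [alpha1]. *)
Definition free_gain (c : R) : R :=
  integral_on 0 c (fun r => opnorm (E (c - r))).

Lemma free_gain_antiderivative : exists J : R -> R,
  (forall c, - (3 * h) < c -> is_derive c 1 J (opnorm (E c))) /\
  (forall c, 0 <= c -> free_gain c = J c - J 0).
Proof.
have hp := h0.
have l : - (4 * h) < - (3 * h) by lra.
have c1 (x : R) : - (4 * h) < x -> {for x, continuous (fun r : R => opnorm (E r))}.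
  by move=> _; apply: continuous_opnorm; exact: (expmx_cont Aq).
have [J [dJ JE]] := antiderivative l c1; exists J; split=> // c c0.
have l0 : - (3 * h) <= 0 by lra.
by apply: etrans (integral_on_opnorm_rev Aq c0) _; exact: JE.
Qed.

Lemma integral_on_exp_antiderivative : exists J : R -> R,
  (forall c, - h < c -> is_derive c 1 J (expR (opnorm A * c))) /\
  iA = J (3 * h) - J 0.
Proof.
have hp := h0.
have l : - (2 * h) < - h by lra.
have c1 (x : R) : - (2 * h) < x -> {for x, continuous (fun s => expR (opnorm A * s))}.
  by move=> _; exact: expRM_cont.
have [J [dJ JE]] := antiderivative l c1; exists J; split=> //.
by apply: JE; lra.
Qed.

Lemma alpha2_antiderivative : exists J : R -> R,
  (forall c, h < c -> is_derive c 1 J (opnorm (fmx c))) /\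
  alpha2 A B0 h S dB = J (3 * h) - J (2 * h).
Proof.
have hp := h0.
have c1 (x : R) : 0 < x -> {for x, continuous (fun s => opnorm (fmx s))}.
  by move=> x0; apply: continuous_opnorm; exact: (feedback_mx_cont Aq).
have [J [dJ JE]] := antiderivative hp c1; exists J; split=> //.
by apply: JE; lra.
Qed.

(** The integrand is rewritten with the antiderivative of |exp(cA)|. That form is continuous also
    where s - h - tau0 < 0, as [antiderivative] requires, and agrees with [free_gain] for s >= 2h.
    Hence the derivative is stated to the right of 2h and continuity at 2h is added. *)
Lemma alpha1_antiderivative : exists J : R -> R,
  (forall c, 2 * h < c -> is_derive c 1 J (opnorm (fmx c) * free_gain (c - h - tau0)))
  /\ {for 2 * h, continuous J} /\
  alpha1 A B0 h S tau0 dB = J (3 * h) - J (2 * h) + iA.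
Proof.
have hp := h0; have t1 := tau0_ge0; have t2 := tau0_le.
have [J [dJ JE]] := free_gain_antiderivative.
have c1 (x : R) : 0 < x ->
    {for x, continuous (fun s => opnorm (fmx s) * (J (s - h - tau0) - J 0))}.
  move=> x0; apply: continuousM.
    by apply: continuous_opnorm; exact: (feedback_mx_cont Aq).
  apply: continuousB; last exact: cst_continuous.
  have d : is_derive (1 * x + (- h - tau0)) 1 J (opnorm (E (1 * x + (- h - tau0)))).
    by apply: dJ; lra.
  have := is_derive_continuous (is_derive_comp_affine d).
  by apply: continuous_ext => s; rewrite mul1r addrA.
have [G [dG GE]] := antiderivative hp c1; exists G.
have JEs s : 2 * h <= s -> J (s - h - tau0) - J 0 = free_gain (s - h - tau0).
  by move=> hs; rewrite JE//; lra.
split; [|split].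
- move=> c hc; rewrite -JEs; last lra.
  by apply: dG; lra.
- by apply: is_derive_continuous (dG _ _); lra.
- rewrite -GE; [|lra|lra]; congr (_ + _).
  by apply: integral_on_eq => s /andP[s2 s3]; rewrite JEs.
Qed.

Let K0 s : 'M[R]_(m, n) := feedback_gain A B0 h S 0 s.

Lemma feedback_gain0 s : K0 s =
  B0^T *m expmx (- s *: A^T) *m invmx W *m E (- (s - h)).
Proof. by rewrite /K0 /feedback_gain mulr0 mul0r subr0. Qed.

(** One period in local time, followed up to s = sb: X is the state, p collects f and w1, and w is
    the noise of the delayed measurement. A variable sb covers times inside a period as well as its
    end. *)
Variables (X p w : R -> 'cV[R]_n) (sb P w_ : R) (Ex : set R).
Hypotheses (sb_le : sb <= 3 * h) (Ex_fin : finite_set Ex).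
Hypothesis X_cont : forall s, 0 <= s <= sb -> mx_cont X s.
Hypothesis X_free : forall s, 0 < s < sb -> s < 2 * h -> ~ Ex s ->
  mx_derive X s (A *m X s + p s).
Hypothesis X_controlled : forall s, 0 < s < sb -> 2 * h < s -> ~ Ex s ->
  mx_derive X s (A *m X s - S s *: ((B0 + dB) *m (K0 s *m (X (s - h - tau0) + w s)))
                 + p s).
Hypothesis p_le : forall s, 0 < s < sb -> enorm (p s) <= P.
Hypothesis w_le : forall s, 2 * h < s < sb -> enorm (w s) <= w_.

(** As r goes from 0 to c, exp((c - r)A) X(r) goes from exp(cA) X(0) to X(c) and is driven by p
    alone; the comparison function is - P J(c - r). *)
Lemma free_estimate c : 0 <= c -> c <= 2 * h -> c <= sb ->
  enorm (X c - E c *m X 0) <= P * free_gain c.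
Proof.
move=> c_ge0 c2 csb; have hp := h0.
have [J [dJ JE]] := free_gain_antiderivative.
have dphi s : 0 < s < c -> ~ Ex s ->
    mx_derive (fun r => E (c - r) *m X r) s (E (c - s) *m p s).
  move=> /andP[s0 sc] sE.
  have dX : mx_derive X s (A *m X s + p s).
    by apply: X_free => //; [rewrite s0; lra|lra].
  apply: mx_derive_eq (mx_deriveM (expmx_rev_derive Aq c s) dX) _.
  by rewrite mulNmx mulmxDr mulmxA addrA addNr add0r.
have dbeta s : 0 <= s <= c ->
    is_derive s 1 (fun r => - P * J (c - r)) (P * opnorm (E (c - s))).
  move=> /andP[s0 sc].
  have d : is_derive (-1 * s + c) 1 J (opnorm (E (-1 * s + c))) by apply: dJ; lra.
  have d2 := is_deriveZ (- P) (is_derive_comp_affine d).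
  have d3 : is_derive s 1 (fun r => - P * J (c - r))
      (- P *: (-1 * opnorm (E (-1 * s + c)))).
    by apply: is_derive_ext d2 => r; rewrite /= [-1 * r + c]addrC mulN1r.
  apply: is_derive_eq d3 _.
  by rewrite [-1 * s + c]addrC !mulN1r /GRing.scale/= mulrNN.
have := @mean_value_ineq R n (fun r => E (c - r) *m X r) (fun s => E (c - s) *m p s)
  (fun r => - P * J (c - r)) (fun s => P * opnorm (E (c - s))) Ex 0 c Ex_fin c_ge0.
rewrite subrr (expmx0 Aq) mul1mx subr0 JE//.
have -> : P * (J c - J 0) = - P * J 0 - - P * J c by ring.
apply.
- move=> t tc; apply: mx_contM; first exact: (expmx_rev_cont Aq).
  by apply: X_cont; move: tc; lra.
- by move=> t tc; exact: is_derive_continuous (dbeta t tc).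
- move=> t tc tE; split; first exact: dphi.
    by apply: dbeta; move: tc; lra.
  apply: le_trans (le_opnorm _ _) _; rewrite mulrC ler_wpM2r ?opnorm_ge0//.
  by apply: p_le; move: tc; lra.
Qed.

Lemma mul_exp_integral_le (J : R -> R) : 0 <= P ->
  (forall c, - h < c -> is_derive c 1 J (expR (opnorm A * c))) ->
  iA = J (3 * h) - J 0 -> 0 <= sb -> P * (J sb - J 0) <= P * iA.
Proof.
move=> P0 dJ ->  sb0; rewrite ler_wpM2l// lerB//; have hp := h0; have sp := sb_le.
apply: (@ndecr_off_finite _ J (fun c => expR (opnorm A * c)) set0) => //.
  by move=> t t3; apply: is_derive_continuous (dJ t _); lra.
by move=> t t3 _; split; [apply: dJ; lra|exact: expR_ge0].
Qed.

(* The mean value inequality is applied to z = exp(-At) x, in the coordinates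
   of which the free motion is at rest. *)
Lemma rest_estimate (c : R) (J : R -> R) :
  (forall c, - h < c -> is_derive c 1 J (expR (opnorm A * c))) ->
  0 <= c -> c <= 2 * h -> c <= sb ->
  enorm (E (- c) *m X c - X 0) <= P * (J c - J 0).
Proof.
move=> dJ c_ge0 c2 csb; have hp := h0.
have dphi s : 0 < s < c -> ~ Ex s ->
    mx_derive (fun r => E (- r) *m X r) s (E (- s) *m p s).
  move=> /andP[s0 sc] sE.
  have dX : mx_derive X s (A *m X s + p s).
    by apply: X_free => //; [rewrite s0; lra|lra].
  apply: mx_derive_eq (mx_deriveM (expmxN_derive Aq s) dX) _.
  by rewrite mulNmx mulmxDr mulmxA addrA addNr add0r.
have dbeta s : 0 <= s <= c ->
    is_derive s 1 (fun r => P * J r) (P * expR (opnorm A * s)).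
  move=> /andP[s0 sc].
  have d : is_derive s 1 J (expR (opnorm A * s)) by apply: dJ; lra.
  exact: (is_deriveZ P d).
have := @mean_value_ineq R n (fun r => E (- r) *m X r) (fun s => E (- s) *m p s)
  (fun r => P * J r) (fun s => P * expR (opnorm A * s)) Ex 0 c Ex_fin c_ge0.
rewrite oppr0 (expmx0 Aq) mul1mx -mulrBr; apply.
- move=> t tc; apply: mx_contM; first exact: (expmxN_cont Aq).
  by apply: X_cont; move: tc; lra.
- by move=> t tc; exact: is_derive_continuous (dbeta t tc).
- move=> t tc tE; split; first exact: dphi.
    by apply: dbeta; move: tc; lra.
  apply: le_trans (le_opnorm _ _) _; rewrite mulrC.
  apply: ler_pM; rewrite ?opnorm_ge0 ?enorm_ge0//.
    by apply: p_le; move: tc; lra.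
  by apply: (opnorm_expmxN Aq); move: tc; lra.
Qed.

Hypotheses (P_ge0 : 0 <= P) (w_ge0 : 0 <= w_).

Let B := B0 + dB.

Lemma feedback_mxE s : fmx s = E (- s) *m B *m (S s *: K0 s).
Proof.
rewrite feedback_gain0 /feedback_mx -/B.
by rewrite !scalemxAl !mulmxA.
Qed.

(** The exponents - (s - h) and s - h - tau0 add up to - tau0: applied to the free motion, the
    feedback produces exactly the integrand of [transitionE]. *)
Lemma feedback_mx_free s :
  fmx s *m E (s - h - tau0) = gram A B0 S B s *m invmx W *m E (- tau0).
Proof.
rewrite /feedback_mx -/B -/(gram A B0 S B s) -mulmxA -(expmxD Aq).
by have -> : - (s - h) + (s - h - tau0) = - tau0 by ring.
Qed.

(** In exp(-As) X the response to the free motion is - (G - G(2h)) u. Adding it back leaves a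
    function driven only by p and by the error of the delayed measurement, which [free_estimate]
    bounds because r - h - tau0 lies in [0, 2h]. *)
Lemma controlled_estimate : 2 * h <= sb ->
  enorm (X sb - transition A B0 h S tau0 dB sb *m X 0)
    <= eA * (alpha1 A B0 h S tau0 dB * P + alpha2 A B0 h S dB * w_).
Proof.
move=> sb2; have hp := h0; have sp := sb_le; have t1 := tau0_ge0; have t2 := tau0_le.
have h23 : 2 * h <= 3 * h by lra.
have [JA [dJA JAE]] := integral_on_exp_antiderivative.
have [J1 [dJ1 [cJ1 J1E]]] := alpha1_antiderivative.
have [J2 [dJ2 J2E]] := alpha2_antiderivative.
have [G [dG GE]] := mx_antiderivative h0 (gram_c (B0 := B0) (C := B) Aq S_adm).
have -> : X sb - transition A B0 h S tau0 dB sb *m X 0 =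
    E sb *m (E (- sb) *m X sb
      + (G sb - G (2 * h)) *m (invmx W *m E (- tau0) *m X 0) - X 0).
  rewrite (transitionE B0 Aq h0 S_adm tau0 dB sb2) -/B -(GE (2 * h) sb); [|lra|lra].
  move: (mxintegral _ _ _) => G1.
  rewrite [RHS]mulmxBr [in RHS]mulmxDr [in RHS]mulmxA (expmxVr Aq) mul1mx.
  by rewrite mulmxBr mulmx1 mulmxBl !mulmxA opprB addrA.
apply: le_trans (le_opnorm _ _) _; apply: ler_pM; rewrite ?opnorm_ge0 ?enorm_ge0//.
  by apply: (opnorm_expmx_le_eA Aq); lra.
set u := invmx W *m E (- tau0) *m X 0.
pose phi r := E (- r) *m X r + (G r - G (2 * h)) *m u.
have -> : E (- sb) *m X sb + (G sb - G (2 * h)) *m u - X 0 =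
    (phi sb - phi (2 * h)) + (E (- (2 * h)) *m X (2 * h) - X 0).
  by rewrite /phi subrr mul0mx addr0 addrA subrK.
(* One antiderivative each for p, for the error that p causes in the delayed state, and for the
   noise; extended to 3h they account for iA, the remainder of alpha1, and alpha2. *)
pose beta r := P * JA r + (P * J1 r + w_ * J2 r).
pose dbeta r := P * expR (opnorm A * r)
  + (P * (opnorm (fmx r) * free_gain (r - h - tau0)) + w_ * opnorm (fmx r)).
pose dphi r := E (- r) *m p r
  - fmx r *m ((X (r - h - tau0) - E (r - h - tau0) *m X 0) + w r).
have dphiE r : 2 * h < r < sb -> ~ Ex r -> mx_derive phi r (dphi r).
  move=> /andP[r2 rsb] rE.
  have dX : mx_derive X r (A *m X r
      - S r *: (B *m (K0 r *m (X (r - h - tau0) + w r))) + p r).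
    by apply: X_controlled => //; rewrite rsb andbT; lra.
  have dGr : mx_derive (fun s => G s - G (2 * h)) r (gram A B0 S B r).
    have d : mx_derive G r (gram A B0 S B r) by apply: dG; lra.
    apply: mx_derive_eq (mx_deriveB d (mx_derive_cst (G (2 * h)) r)) _.
    by rewrite subr0.
  have dd := mx_deriveD (mx_deriveM (expmxN_derive Aq r) dX)
    (mx_deriveM dGr (mx_derive_cst u r)).
  apply: mx_derive_eq dd _; rewrite mulmx0 addr0 /dphi.
  have -> : gram A B0 S B r *m u = fmx r *m (E (r - h - tau0) *m X 0).
    by rewrite [RHS]mulmxA feedback_mx_free /u !mulmxA.
  have e : E (- r) *m (S r *: (B *m (K0 r *m (X (r - h - tau0) + w r)))) =
      fmx r *m (X (r - h - tau0) + w r).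
    by rewrite feedback_mxE -!scalemxAr -!scalemxAl !mulmxA.
  have e1 : E (- r) *m (A *m X r) = E (- r) *m A *m X r by rewrite mulmxA.
  have e2 : fmx r *m ((X (r - h - tau0) - E (r - h - tau0) *m X 0) + w r) =
      fmx r *m (X (r - h - tau0) + w r) - fmx r *m (E (r - h - tau0) *m X 0).
    by rewrite -mulmxBr [in RHS]addrAC.
  rewrite e2 mulNmx [X in - _ + X]mulmxDr mulmxBr e e1.
  have gen (a b c d : 'cV[R]_n) : - a + (a - b + c) + d = c - (b - d).
    by rewrite opprB !addrA addNr add0r [RHS]addrC addrA.
  exact: gen.
have dbetaE r : 2 * h < r -> is_derive r 1 beta (dbeta r).
  move=> r2.
  have d0 : is_derive r 1 JA (expR (opnorm A * r)) by apply: dJA; lra.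
  have d1 := dJ1 r r2.
  have d2 : is_derive r 1 J2 (opnorm (fmx r)) by apply: dJ2; lra.
  exact: (is_deriveD (is_deriveZ P d0) (is_deriveD (is_deriveZ P d1) (is_deriveZ w_ d2))).
have cbeta r : 2 * h <= r -> {for r, continuous beta}.
  rewrite le_eqVlt => /predU1P[<-|r2]; last exact: is_derive_continuous (dbetaE r r2).
  apply: continuousD.
    apply: continuousM; first exact: cst_continuous.
    by apply: is_derive_continuous (dJA _ _); lra.
  apply: continuousD; apply: continuousM; try exact: cst_continuous; first exact: cJ1.
  by apply: is_derive_continuous (dJ2 _ _); lra.
have step2 : enorm (phi sb - phi (2 * h)) <= beta sb - beta (2 * h).
  apply: (@mean_value_ineq R n phi dphi beta dbeta Ex (2 * h) sb Ex_fin sb2).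
  - move=> t /andP[ht ts]; apply: mx_contD.
      apply: mx_contM; first exact: (expmxN_cont Aq).
      by apply: X_cont; lra.
    apply: mx_contM; last exact: mx_cont_cst.
    apply: mx_contD; last exact: mx_cont_cst.
    by apply: mx_derive_cont (dG t _); lra.
  - by move=> t /andP[ht ts]; exact: cbeta.
  - move=> t /andP[ht ts] tE; split; first by apply: dphiE => //; rewrite ht.
      exact: dbetaE.
    rewrite /dphi /dbeta; apply: le_trans (enormD _ _) _; apply: lerD.
      apply: le_trans (le_opnorm _ _) _; rewrite mulrC.
      apply: ler_pM; rewrite ?opnorm_ge0 ?enorm_ge0//; first by apply: p_le; lra.
      by apply: (opnorm_expmxN Aq); lra.
    rewrite enormN; apply: le_trans (le_opnorm _ _) _.
    rewrite [X in _ <= X](_ : _ = opnorm (fmx t) *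
      (P * free_gain (t - h - tau0) + w_)); last by ring.
    rewrite ler_wpM2l ?opnorm_ge0//; apply: le_trans (enormD _ _) _.
    apply: lerD; first by apply: free_estimate; lra.
    by apply: w_le; rewrite ht.
have step1 : enorm (E (- (2 * h)) *m X (2 * h) - X 0) <= P * (JA (2 * h) - JA 0).
  by apply: rest_estimate => //; lra.
apply: le_trans (enormD _ _) _; apply: le_trans (lerD step2 step1) _.
(* The integrands are nonnegative, so the increments up to sb may be extended to 3h, where they
   become the constants. *)
have m1 : J1 sb <= J1 (3 * h).
  apply: (@ndecr_off_finite _ J1 (fun c => opnorm (fmx c) * free_gain (c - h - tau0))
      set0) => //.
    move=> t /andP[ht _]; have : 2 * h <= t by lra.
    rewrite le_eqVlt => /predU1P[<-//|r2]; exact: is_derive_continuous (dJ1 t r2).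
  move=> t /andP[ht t3] _; split; first by apply: dJ1; lra.
  by rewrite mulr_ge0 ?opnorm_ge0// integral_on_ge0// => x _; exact: opnorm_ge0.
have m2 : J2 sb <= J2 (3 * h).
  apply: (@ndecr_off_finite _ J2 (fun c => opnorm (fmx c)) set0) => //.
    by move=> t /andP[ht _]; apply: is_derive_continuous (dJ2 t _); lra.
  by move=> t /andP[ht t3] _; split; [apply: dJ2; lra|exact: opnorm_ge0].
have m0 : P * (JA sb - JA 0) <= P * iA by apply: mul_exp_integral_le => //; lra.
have m1' := ler_wpM2l P_ge0 m1; have m2' := ler_wpM2l w_ge0 m2.
rewrite J1E J2E /beta.
move: m0 m1' m2'; move: (iA) => I0.
set a1 := P * J1 sb; set a2 := w_ * J2 sb; lra.
Qed.

Lemma alpha1_ge_iA : iA <= alpha1 A B0 h S tau0 dB.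
Proof.
rewrite /alpha1 lerDr; apply: integral_on_ge0 => x _; rewrite mulr_ge0 ?opnorm_ge0//.
by apply: integral_on_ge0 => y _; exact: opnorm_ge0.
Qed.

Lemma alpha2_ge0 : 0 <= alpha2 A B0 h S dB.
Proof. by apply: integral_on_ge0 => x _; exact: opnorm_ge0. Qed.

(** The bound is weakened to that of the control phase, so that later arguments treat both phases
    alike. *)
Lemma uncontrolled_estimate : 0 <= sb -> sb <= 2 * h ->
  enorm (X sb - E sb *m X 0)
    <= eA * (alpha1 A B0 h S tau0 dB * P + alpha2 A B0 h S dB * w_).
Proof.
move=> sb0 sb2; have hp := h0.
have [JA [dJA JAE]] := integral_on_exp_antiderivative.
have -> : X sb - E sb *m X 0 = E sb *m (E (- sb) *m X sb - X 0).
  by rewrite mulmxBr mulmxA (expmxVr Aq) mul1mx.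
apply: le_trans (le_opnorm _ _) _; apply: ler_pM; rewrite ?opnorm_ge0 ?enorm_ge0//.
  by apply: (opnorm_expmx_le_eA Aq); lra.
have r1 : enorm (E (- sb) *m X sb - X 0) <= P * (JA sb - JA 0).
  exact: rest_estimate.
apply: (le_trans r1); apply: le_trans (mul_exp_integral_le P_ge0 dJA JAE sb0) _.
rewrite mulrC; apply: (@le_trans _ _ (alpha1 A B0 h S tau0 dB * P)).
  by rewrite ler_wpM2r// alpha1_ge_iA.
by rewrite lerDl mulr_ge0// alpha2_ge0.
Qed.

End PeriodEstimate.

(** * Finiteness and uniformity of the constants *)

Section ConstantBounds.
Context {R : realType} {n m : nat}.
Variables (A : 'M[R]_n) (B0 : 'M[R]_(n, m)) (h : R) (S : R -> R) (q : nat).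
Hypotheses (Aq : A ^+ q = 0) (h0 : 0 < h) (S_adm : admissible_weight h S).

Local Notation E s := (expmx (s *: A)).
Local Notation W := (Wc A B0 h S).
Local Notation eA := (expR (3 * opnorm A * h)).
Local Notation iA := (integral_on 0 (3 * h) (fun s => expR (opnorm A * s))).

Lemma gram_integral_le (D : 'M[R]_(n, m)) (C s : R) : 0 <= C ->
  (forall r, 2 * h <= r <= 3 * h -> opnorm (gram A B0 S D r) <= C) ->
  2 * h <= s <= 3 * h ->
  opnorm (mxintegral (2 * h) s (gram A B0 S D)) <= C * h.
Proof.
move=> C0 HC /andP[s2 s3]; have hp := h0.
have h2 : 0 < 2 * h by lra.
have cC (x : R) : 0 < x -> {for x, continuous (fun=> C)} by move=> _; exact: cst_continuous.
apply: le_trans (opnorm_mxintegral_le h2 s2 (gram_c (B0 := B0) (C := D) Aq S_adm) cC _) _.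
  by move=> x /andP[x2 x3]; apply: HC; lra.
by rewrite integral_on_cst// ler_wpM2l//; lra.
Qed.

Lemma opnormM_le p k l (M : 'M[R]_(p, k)) (N : 'M[R]_(k, l)) (a b : R) :
  opnorm M <= a -> opnorm N <= b -> opnorm (M *m N) <= a * b.
Proof.
by move=> Ma Nb; apply: le_trans (opnormM _ _) _; apply: ler_pM; rewrite ?opnorm_ge0.
Qed.

(** Makes the supremum in [eta] finite and later, with b = 1 / c_Theta, supplies the uniform bounds
    that [rhobar] is built on. *)
Lemma uniform_constant_bounds (b : R) : 0 <= b -> exists C : R, forall tau0 dB,
  0 <= tau0 <= h -> opnorm dB <= b ->
  (forall s, 2 * h <= s <= 3 * h ->
    eA + eA * opnorm (Delta A B0 h S tau0 s)
      + opnorm (Theta A B0 h S tau0 dB s) <= C) /\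
  alpha1 A B0 h S tau0 dB <= C.
Proof.
move=> b0; have hp := h0.
(* The radius |B0| + b covers B0, dB and B0 + dB at once. *)
have b'0 : 0 <= opnorm B0 + b by rewrite addr_ge0 ?opnorm_ge0.
have [C [C0 gC EC WC]] := uniform_norm_bounds B0 Aq h0 S_adm b'0.
(* The sum of a bound for the expression in [eta] and one for alpha1; the factors h and 3 * h bound
   lengths of integration intervals. *)
exists (eA + eA * (1 + C * h * C * C) + C * (C * h) * C * C
        + (C * C * C * (C * (3 * h)) * h + iA)).
move=> tau0 dB /andP[t0 th] dBb.
have iA0 : 0 <= iA by apply: integral_on_ge0 => x _; exact: expR_ge0.
have eA0 : 0 <= eA by exact: expR_ge0.
have Et : opnorm (E (- tau0)) <= C by apply: EC; lra.
have B0b : opnorm B0 <= opnorm B0 + b by rewrite lerDl.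
have dBb' : opnorm dB <= opnorm B0 + b by rewrite (le_trans dBb)// lerDr opnorm_ge0.
have Bb : opnorm (B0 + dB) <= opnorm B0 + b.
  by rewrite (le_trans (opnormD _ _))// lerD2l.
have pos1 : 0 <= C * C * C * (C * (3 * h)) * h by rewrite !mulr_ge0// ltW.
have pos2 : 0 <= eA * (1 + C * h * C * C) by rewrite mulr_ge0// addr_ge0// !mulr_ge0// ltW.
have pos3 : 0 <= C * (C * h) * C * C by rewrite !mulr_ge0// ltW.
split=> [s s23|].
- have /andP[s2 s3] := s23.
  have D1 : opnorm (Delta A B0 h S tau0 s) <= 1 + C * h * C * C.
    have -> : Delta A B0 h S tau0 s =
      1%:M - mxintegral (2 * h) s (gram A B0 S B0) *m invmx W *m E (- tau0) by [].
    apply: le_trans (opnormB _ _) _; apply: lerD; first exact: opnorm1_le1.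
    apply: opnormM_le; last exact: Et.
    apply: opnormM_le; last exact: WC.
    by apply: gram_integral_le => // r r23; exact: gC.
  have T1 : opnorm (Theta A B0 h S tau0 dB s) <= C * (C * h) * C * C.
    rewrite (ThetaE B0 Aq h0 S_adm tau0 dB s2) opnormN.
    apply: opnormM_le; last exact: Et.
    apply: opnormM_le; last exact: WC.
    apply: opnormM_le; first by apply: EC; lra.
    by apply: gram_integral_le => // r r23; exact: gC.
  have D1' := ler_wpM2l eA0 D1.
  move: D1' T1 pos1 pos2 pos3 iA0.
  set a := eA * opnorm _; set a1 := C * h * C * C; set a2 := _ * _ * C * C.
  set a3 := C * C * C * _ * _; lra.
- have [J [dJ [cJ ->]]] := alpha1_antiderivative B0 Aq h0 S_adm dB t0 th.
  have bd c : 2 * h < c -> c < 3 * h ->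
      opnorm (feedback_mx A B0 h S dB c) * free_gain A (c - h - tau0) <=
      C * C * C * (C * (3 * h)).
    move=> c2 c3; apply: ler_pM; rewrite ?opnorm_ge0//.
    + by apply: integral_on_ge0 => x _; exact: opnorm_ge0.
    + apply: opnormM_le; last by apply: EC; lra.
      apply: opnormM_le; last exact: WC.
      by apply: gC; [exact: Bb|lra].
    + rewrite /free_gain.
      have c1 (x : R) : -1 < x -> {for x, continuous (fun r : R =>
          opnorm (expmx ((c - h - tau0 - r) *: A)))}.
        by move=> _; apply: continuous_opnorm; exact: (expmx_rev_cont Aq).
      have c2' (x : R) : -1 < x -> {for x, continuous (fun=> C)}.
        by move=> _; exact: cst_continuous.
      apply: le_trans (integral_on_le _ _ c1 c2' _) _; [lra|lra| |].
        by move=> x xc; apply: EC; lra.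
      by rewrite integral_on_cst ?ler_wpM2l//; lra.
  (* K r - J r is nondecreasing, which bounds the increment of J over [2h, 3h] by K h. *)
  have : C * C * C * (C * (3 * h)) * (2 * h) - J (2 * h) <=
         C * C * C * (C * (3 * h)) * (3 * h) - J (3 * h).
    set K := C * C * C * _.
    apply: (@ndecr_off_finite _ (fun r => K * r - J r) (fun r => K -
      opnorm (feedback_mx A B0 h S dB r) * free_gain A (r - h - tau0)) set0); [by []|lra| |].
      move=> t /andP[t2 t3]; apply: continuousB; first exact: mulrl_continuous.
      move: t2; rewrite le_eqVlt => /predU1P[<-//|t2].
      exact: is_derive_continuous (dJ t t2).
    move=> t /andP[t2 t3] _; split; last by rewrite subr_ge0 bd.
    have d1 := is_deriveZ K (is_derive_id t (1 : R)); have d2 := dJ t t2.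
    by apply: is_derive_eq (is_deriveB d1 d2) _; rewrite /GRing.scale/= mulr1.
  move: pos1 pos2 pos3; set K := C * C * C * _; set a2 := eA * _.
  set a3 := _ * _ * C * C; lra.
Qed.

(** A real [sup] bounds its set only if the set is bounded above, which [uniform_constant_bounds]
    provides with b = |dB|. *)
Lemma le_eta tau0 dB s : 0 <= tau0 <= h -> 2 * h <= s <= 3 * h ->
  eA + eA * opnorm (Delta A B0 h S tau0 s) + opnorm (Theta A B0 h S tau0 dB s)
    <= Defs.eta A B0 h S tau0 dB.
Proof.
move=> t0 s23; have [C HC] := uniform_constant_bounds (opnorm_ge0 dB).
apply: sup_ubound; last by exists s => //=; rewrite in_itv.
exists C => _ [r /= r23 <-]; rewrite in_itv/= in r23.
by case: (HC tau0 dB t0 (lexx _)) => + _; apply.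
Qed.

(** The first summand lets [eta] cover the free phase too, so that it bounds the growth of the state
    throughout a period. *)
Lemma eA_le_eta tau0 dB : 0 <= tau0 <= h -> eA <= Defs.eta A B0 h S tau0 dB.
Proof.
move=> t0; have hp := h0; have s23 : 2 * h <= 2 * h <= 3 * h by lra.
apply: le_trans (le_eta dB t0 s23); rewrite -addrA lerDl.
by rewrite addr_ge0 ?mulr_ge0 ?opnorm_ge0 ?expR_ge0.
Qed.

Lemma opnorm_transition_le tau0 dB s : 0 <= tau0 <= h -> 2 * h <= s <= 3 * h ->
  opnorm (transition A B0 h S tau0 dB s) <= Defs.eta A B0 h S tau0 dB.
Proof.
move=> t0 s23; apply: le_trans (le_eta dB t0 s23); have /andP[s2 s3] := s23.
have hp := h0; have l0 : 0 <= s by lra.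
apply: le_trans (opnormD _ _) _; apply: lerD => //.
apply: le_trans (opnormM _ _) _.
apply: (@le_trans _ _ (eA * opnorm (Delta A B0 h S tau0 s))).
  by rewrite ler_wpM2r ?opnorm_ge0// (opnorm_expmx_le_eA Aq)// l0.
by rewrite lerDr expR_ge0.
Qed.

End ConstantBounds.

Section PowerSums.
Context {R : realType} {n : nat}.
Variables (F : 'M[R]_n) (q : nat).
Hypotheses (q0 : (0 < q)%N) (Fq : opnorm (F ^+ q) < 1).

(** Extended to l q terms and grouped in blocks of q, the partial sums T satisfy T_next <= D + r T
    with r = |F^q|; the bound is the fixed point D / (1 - r). *)
Lemma power_sum_le l : \sum_(0 <= i < l) opnorm (F ^+ i) <=
  (\sum_(0 <= j < q) opnorm (F ^+ j)) / (1 - opnorm (F ^+ q)).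
Proof.
set D := \sum_(0 <= j < q) _; set r := opnorm (F ^+ q).
have r1 : 0 < 1 - r by rewrite subr_gt0.
apply: (@le_trans _ _ (\sum_(0 <= i < l * q) opnorm (F ^+ i))).
  rewrite [X in _ <= X](@big_cat_nat _ _ _ l)//=; last by rewrite leq_pmulr.
  by rewrite lerDl sumr_ge0// => i _; exact: opnorm_ge0.
elim: l => [|l IH].
  rewrite mul0n big_nil; apply: divr_ge0; last exact: ltW.
  by apply: sumr_ge0 => i _; exact: opnorm_ge0.
rewrite mulSn (@big_cat_nat _ _ _ q)//= ?leq_addr//.
have -> : \sum_(q <= i < q + l * q) opnorm (F ^+ i) =
    \sum_(0 <= i < l * q) opnorm (F ^+ (i + q)).
  by rewrite -{1}[q]add0n big_addn [(q + _)%N]addnC addnK.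
apply: (@le_trans _ _ (D + r * (\sum_(0 <= i < l * q) opnorm (F ^+ i)))).
  rewrite lerD2l mulr_sumr; apply: ler_sum => i _.
  by rewrite exprD mulrC; exact: opnormM.
apply: (@le_trans _ _ (D + r * (D / (1 - r)))).
  by rewrite lerD2l ler_wpM2l ?opnorm_ge0.
by rewrite le_eqVlt; apply/orP; left; apply/eqP; field; rewrite gt_eqF.
Qed.

Lemma power_sum_sup l : \sum_(0 <= i < l) opnorm (F ^+ i) <=
  sup (range (fun l : nat => \sum_(0 <= i < l) opnorm (F ^+ i))).
Proof.
apply: sup_ubound; last by exists l.
by eexists => _ [k _ <-]; exact: power_sum_le.
Qed.

Lemma power_sumM_sup c l : 0 <= c -> \sum_(0 <= i < l) opnorm (F ^+ i) * c <=
  sup (range (fun l : nat => \sum_(0 <= i < l) opnorm (F ^+ i) * c)).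
Proof.
move=> c0; apply: sup_ubound; last by exists l.
eexists => _ [k _ <-]; rewrite -mulr_suml; apply: ler_wpM2r => //.
exact: power_sum_le.
Qed.

End PowerSums.

(** If the partial sums are unbounded, the real [sup] is 0, so the sign is right in every case. *)
Lemma sup_power_sum_ge0 {R : realType} n (F : 'M[R]_n) (c : R) : 0 <= c ->
  0 <= sup (range (fun l : nat => \sum_(0 <= i < l) opnorm (F ^+ i) * c)).
Proof.
move=> c0; have [Hs|/sup_out->//] :=
  pselect (has_sup (range (fun l : nat => \sum_(0 <= i < l) opnorm (F ^+ i) * c))).
apply: sup_ubound; first by case: Hs.
by exists 0%N => //; rewrite big_nil.
Qed.

(** * From one period to the delay inequality *)

Section Trajectories.
Context {R : realType}.

Definition trajectory n (G : (R -> 'cV[R]_n) -> R -> 'cV[R]_n)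
    (x : R -> 'cV[R]_n) : Prop :=
  (forall t, 0 <= t -> mx_cont x t) /\
  forall T : R, exists2 E : set R, finite_set E &
    forall t, 0 < t < T -> ~ E t -> mx_derive x t (G x t).

(** Since r > 0, time 0 is interior to the domain of the solution, which gives continuity there from
    both sides. *)
Lemma solution_trajectory n (r : R) (G : (R -> 'cV[R]_n) -> R -> 'cV[R]_n) phi x :
  0 < r -> is_solution r G phi x -> trajectory G x.
Proof.
move=> r0 [cx _ dx]; split=> [t t0|T].
  apply/mx_contP.
  have cx' : {within `]- r, +oo[, continuous x}.
    by apply: continuous_subspaceW cx; apply: subset_itv; rewrite bnd_simp.
  rewrite continuous_open_subspace in cx'; last exact: itv_open_ends_open.
  by apply: cx'; rewrite inE/= in_itv/= andbT; lra.
have [E fE HE] := dx T; exists E => // t tT Et.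
by apply/mx_deriveP; exact: HE.
Qed.

End Trajectories.

Section ClosedLoopTrajectory.
Context {R : realType} {n m : nat}.
Variables (A : 'M[R]_n) (B0 : 'M[R]_(n, m)) (h : R) (S : R -> R) (q : nat).
Hypotheses (Aq : A ^+ q = 0) (h0 : 0 < h) (S_adm : admissible_weight h S).

Local Notation E s := (expmx (s *: A)).
Local Notation eA := (expR (3 * opnorm A * h)).
Local Notation iA := (integral_on 0 (3 * h) (fun s => expR (opnorm A * s))).

Lemma period_eq (l : nat) (t : R) :
  3 * l%:R * h <= t < 3 * l.+1%:R * h -> period h t = l%:R.
Proof.
move=> /andP[lt tl]; have hp := h0.
rewrite /period (@floor_def _ _ l%:Z) ?pmulrn//.
have h3 : 0 < 3 * h by lra.
apply/andP; split; first by rewrite ler_pdivlMr// -pmulrn; lra.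
have -> : (l%:Z + 1)%:~R = l.+1%:R :> R by rewrite -[RHS]natr1 intrD -pmulrn.
by rewrite ltr_pdivrMr//; lra.
Qed.

Lemma weight_periodic (l : nat) t : 0 <= t -> S (3 * l%:R * h + t) = S t.
Proof.
move=> t0; have hp := h0; have [_ Sper _ _ _] := S_adm.
elim: l => [|l IH]; first by rewrite mulr0 mul0r add0r.
rewrite -[RHS]IH -[RHS]Sper; last by rewrite addr_ge0// !mulr_ge0// ltW.
by rewrite -[l.+1%:R]natr1; congr (S _); ring.
Qed.

Variables (tau0 : R) (dB : 'M[R]_(n, m)).
Hypotheses (tau0_ge0 : 0 <= tau0) (tau0_le : tau0 <= h).

Local Notation a1 := (alpha1 A B0 h S tau0 dB).
Local Notation a2 := (alpha2 A B0 h S dB).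
Local Notation eta' := (Defs.eta A B0 h S tau0 dB).
Local Notation F := (Fmx A B0 h S tau0 dB).

Lemma feedback_gain_shift (l s : R) :
  feedback_gain A B0 h S l (3 * l * h + s) = feedback_gain A B0 h S 0 s.
Proof.
rewrite /feedback_gain; have -> : 3 * l * h + s - 3 * l * h = s by ring.
by have -> : s - 3 * 0 * h = s by ring.
Qed.

Lemma closed_loop_free (f : R -> 'cV[R]_n -> 'cV[R]_n) w1 w2 x (l : nat) s :
  0 < s <= 2 * h ->
  closed_loop A B0 h S tau0 dB f w1 w2 x (3 * l%:R * h + s) =
  A *m x (3 * l%:R * h + s)
  + (f (3 * l%:R * h + s) (x (3 * l%:R * h + s)) + w1 (3 * l%:R * h + s)).
Proof.
move=> /andP[s0 s2]; have hp := h0.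
rewrite /closed_loop /control /gate (@period_eq l); last first.
  by rewrite -[l.+1%:R]natr1; apply/andP; split; lra.
have -> : ((3 * l%:R + 2) * h < 3 * l%:R * h + s) = false.
  by apply/negbTE; rewrite -leNgt; lra.
by rewrite mulr0 scale0r oppr0 mulmx0 addr0 addrA.
Qed.

Lemma closed_loop_controlled (f : R -> 'cV[R]_n -> 'cV[R]_n) w1 w2 x (l : nat) s :
  2 * h < s < 3 * h ->
  closed_loop A B0 h S tau0 dB f w1 w2 x (3 * l%:R * h + s) =
  A *m x (3 * l%:R * h + s)
  - S s *: ((B0 + dB) *m (feedback_gain A B0 h S 0 s *m
      (x (3 * l%:R * h + (s - h - tau0)) + w2 (3 * l%:R * h + s - h))))
  + (f (3 * l%:R * h + s) (x (3 * l%:R * h + s)) + w1 (3 * l%:R * h + s)).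
Proof.
move=> /andP[s2 s3]; have hp := h0.
rewrite /closed_loop /control /gate /K /output (@period_eq l); last first.
  by rewrite -[l.+1%:R]natr1; apply/andP; split; lra.
have -> : ((3 * l%:R + 2) * h < 3 * l%:R * h + s) by lra.
have s0 : 0 <= s by lra.
rewrite mulr1 weight_periodic// feedback_gain_shift mulmxN -scalemxAr -[LHS]addrA.
by have -> : 3 * l%:R * h + s - h - tau0 = 3 * l%:R * h + (s - h - tau0) by ring.
Qed.

Variables (f : R -> 'cV[R]_n -> 'cV[R]_n) (w1 w2 x : R -> 'cV[R]_n).
Hypothesis x_traj : trajectory (closed_loop A B0 h S tau0 dB f w1 w2) x.

(** Time is shifted to the start of the l-th period; periodicity of S and of the feedback gain
    reduces the equation to that of period 0. *)
Lemma period_estimate (l : nat) (s P w_ : R) : 0 <= s <= 3 * h ->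
  0 <= P -> 0 <= w_ ->
  (forall r, 0 < r < s -> enorm (f (3 * l%:R * h + r) (x (3 * l%:R * h + r))
    + w1 (3 * l%:R * h + r)) <= P) ->
  (forall r, 2 * h < r < s -> enorm (w2 (3 * l%:R * h + r - h)) <= w_) ->
  (s <= 2 * h ->
     enorm (x (3 * l%:R * h + s) - E s *m x (3 * l%:R * h))
       <= eA * (a1 * P + a2 * w_)) /\
  (2 * h <= s ->
     enorm (x (3 * l%:R * h + s)
            - transition A B0 h S tau0 dB s *m x (3 * l%:R * h))
       <= eA * (a1 * P + a2 * w_)).
Proof.
move=> /andP[s0 s3] P0 w_0 HP Hw; have [cx dx] := x_traj; have hp := h0.
set t0 := 3 * l%:R * h.
have t00 : 0 <= t0 by rewrite !mulr_ge0// ltW.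
have [Ex fEx dxE] := dx (t0 + s).
pose X r := x (t0 + r).
have X0 : X 0 = x t0 by rewrite /X addr0.
pose Ex' := (fun r => r - t0) @` Ex.
have fEx' : finite_set Ex' by exact: finite_image.
have cX r : 0 <= r <= s -> mx_cont X r.
  move=> /andP[r0 _].
  have cx0 : mx_cont x (t0 + r) by apply: cx; rewrite addr_ge0.
  move=> i j; apply: (@continuous_comp _ _ _ (fun r => t0 + r) (fun u => x u i j)).
    by apply: continuousD; [exact: cst_continuous|move=> ?].
  exact: cx0.
have dX r : 0 < r < s -> ~ Ex' r ->
    mx_derive X r (closed_loop A B0 h S tau0 dB f w1 w2 x (t0 + r)).
  move=> /andP[r0 rs] rE.
  have d : mx_derive x (1 * r + t0) (closed_loop A B0 h S tau0 dB f w1 w2 x (t0 + r)).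
    rewrite mul1r [r + t0]addrC; apply: dxE; first by apply/andP; split; lra.
    by move=> tE; apply: rE; exists (t0 + r) => //; rewrite addrC addKr.
  have := mx_derive_comp_affine d; rewrite scale1r.
  have -> // : (fun s => x (1 * s + t0)) = X.
  by apply/funext => u; rewrite mul1r addrC.
have free r : 0 < r < s -> r < 2 * h -> ~ Ex' r ->
    mx_derive X r (A *m X r + (f (t0 + r) (x (t0 + r)) + w1 (t0 + r))).
  move=> rs r2 rE; have := dX r rs rE; rewrite /t0 closed_loop_free//.
  by case/andP: rs => -> _; rewrite ltW.
split=> [s2|s2]; rewrite -X0.
  by apply: (uncontrolled_estimate B0 S Aq h0 tau0 dB s3 fEx' cX free).
apply: (controlled_estimate (p := fun r => f (t0 + r) (x (t0 + r)) + w1 (t0 + r))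
  (w := fun r => w2 (t0 + r - h)) Aq h0 S_adm tau0_ge0 tau0_le s3 fEx' cX free) => //.
move=> r rs r2 rE; have := dX r rs rE; rewrite /t0 closed_loop_controlled//.
by rewrite r2/=; case/andP: rs => _; lra.
Qed.

Hypothesis W_unit : Wc A B0 h S \in unitmx.

Let tau0_range : 0 <= tau0 <= h. Proof. by rewrite tau0_ge0. Qed.

Lemma period_state_estimate (l : nat) (s P w_ : R) : 0 <= s <= 3 * h ->
  0 <= P -> 0 <= w_ ->
  (forall r, 0 < r < s -> enorm (f (3 * l%:R * h + r) (x (3 * l%:R * h + r))
    + w1 (3 * l%:R * h + r)) <= P) ->
  (forall r, 2 * h < r < s -> enorm (w2 (3 * l%:R * h + r - h)) <= w_) ->
  enorm (x (3 * l%:R * h + s)) <= eta' * enorm (x (3 * l%:R * h))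
    + eA * (a1 * P + a2 * w_).
Proof.
move=> s03 P0 w_0 HP Hw; have [c1 c2] := period_estimate s03 P0 w_0 HP Hw.
have /andP[s0 s3] := s03.
have [s2|/ltW s2] := leP s (2 * h).
- rewrite -[x _ in X in enorm X <= _](subrK (E s *m x (3 * l%:R * h))).
  rewrite addrC; apply: le_trans (enormD _ _) _; apply: lerD; last exact: c1.
  apply: le_trans (le_opnorm _ _) _; rewrite ler_wpM2r ?enorm_ge0//.
  apply: le_trans (eA_le_eta B0 Aq h0 S_adm dB tau0_range).
  by apply: (opnorm_expmx_le_eA Aq); rewrite s0.
- rewrite -[x _ in X in enorm X <= _](subrK (transition A B0 h S tau0 dB s *m x (3 * l%:R * h))).
  rewrite addrC; apply: le_trans (enormD _ _) _; apply: lerD; last exact: c2.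
  apply: le_trans (le_opnorm _ _) _; rewrite ler_wpM2r ?enorm_ge0//.
  by apply: (opnorm_transition_le B0 Aq h0 S_adm dB tau0_range); rewrite s2.
Qed.

Lemma period_map_estimate (l : nat) (P w_ : R) : 0 <= P -> 0 <= w_ ->
  (forall r, 0 < r < 3 * h -> enorm (f (3 * l%:R * h + r) (x (3 * l%:R * h + r))
    + w1 (3 * l%:R * h + r)) <= P) ->
  (forall r, 2 * h < r < 3 * h -> enorm (w2 (3 * l%:R * h + r - h)) <= w_) ->
  enorm (x (3 * l.+1%:R * h) - F *m x (3 * l%:R * h)) <= eA * (a1 * P + a2 * w_).
Proof.
move=> P0 w_0 HP Hw; have hp := h0.
have s03 : 0 <= 3 * h <= 3 * h by lra.
have [_ c2] := period_estimate s03 P0 w_0 HP Hw.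
rewrite (FmxE Aq h0 S_adm tau0 dB W_unit).
have -> : 3 * l.+1%:R * h = 3 * l%:R * h + 3 * h by rewrite -[l.+1%:R]natr1; ring.
by apply: c2; lra.
Qed.

(** A discrete variation of constants: the first of l + 1 periods is split off, and its error is
    carried through the other l by F^l. *)
Lemma iterate_estimate (l k : nat) (P w_ : R) : 0 <= P -> 0 <= w_ ->
  (forall r, 3 * k%:R * h < r < 3 * (k + l)%:R * h ->
    enorm (f r (x r) + w1 r) <= P) ->
  (forall r, 3 * k%:R * h < r < 3 * (k + l)%:R * h -> enorm (w2 r) <= w_) ->
  enorm (x (3 * (k + l)%:R * h) - F ^+ l *m x (3 * k%:R * h)) <=
    (\sum_(0 <= i < l) opnorm (F ^+ i)) * (eA * (a1 * P + a2 * w_)).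
Proof.
move=> P0 w_0; have hp := h0.
elim: l k => [|l IH] k HP Hw.
  by rewrite addn0 expr0 mul1mx subrr enorm0 big_nil mul0r.
have kl : k%:R + 1 <= (k + l.+1)%:R :> R.
  by rewrite addnS -[(k + l).+1%:R]natr1 lerD2r ler_nat leq_addr.
have klh : 3 * k%:R * h + 3 * h <= 3 * (k + l.+1)%:R * h.
  have -> : 3 * k%:R * h + 3 * h = 3 * (k%:R + 1) * h by ring.
  by rewrite (ler_wpM2r (ltW h0))// ler_wpM2l.
rewrite big_nat_recr//= [X in _ <= X]mulrDl -addSnnS.
have -> : x (3 * (k.+1 + l)%:R * h) - F ^+ l.+1 *m x (3 * k%:R * h) =
  (x (3 * (k.+1 + l)%:R * h) - F ^+ l *m x (3 * k.+1%:R * h)) +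
  F ^+ l *m (x (3 * k.+1%:R * h) - F *m x (3 * k%:R * h)).
  by rewrite mulmxBr mulmxA -[_ *m F]exprSr addrA subrK.
have k1 : 3 * k%:R * h <= 3 * k.+1%:R * h.
  by rewrite (ler_wpM2r (ltW h0))// ler_wpM2l// ler_nat.
apply: le_trans (enormD _ _) _; apply: lerD.
  by apply: IH => r; rewrite addSnnS => /andP[r1 r2]; [apply: HP|apply: Hw];
    rewrite r2 andbT; lra.
apply: le_trans (le_opnorm _ _) _; rewrite ler_wpM2l ?opnorm_ge0//.
apply: period_map_estimate => // r /andP[r0 r3]; first by apply: HP; lra.
by apply: Hw; lra.
Qed.

Lemma window_estimate (f0 : R) (k : nat) (t Xb W1 W2 : R) :
  0 <= f0 -> (forall t v, 0 <= t -> enorm (f t v) <= f0 * enorm v) ->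
  (0 < q)%N -> opnorm (F ^+ q) < 1 ->
  3 * (k + q)%:R * h <= t <= 3 * (k + q).+1%:R * h ->
  (forall s, 3 * k%:R * h <= s <= t ->
    [/\ enorm (x s) <= Xb, enorm (w1 s) <= W1 & enorm (w2 s) <= W2]) ->
  enorm (x t) <= rho A B0 h S tau0 dB f0 q * Xb
                 + delta A B0 h S tau0 dB * (W1 + W2).
Proof.
move=> f00 fle q0 Fq /andP[kt tk] HB; have hp := h0.
have k0 : 0 <= 3 * k%:R * h by rewrite !mulr_ge0// ltW.
have kq : 3 * k%:R * h <= 3 * (k + q)%:R * h.
  by rewrite (ler_wpM2r (ltW h0))// ler_wpM2l// ler_nat leq_addr.
have kk : 3 * k%:R * h <= 3 * k%:R * h <= t by rewrite lexx; lra.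
have [Xk W1k W2k] := HB _ kk.
have Xb0 : 0 <= Xb := le_trans (enorm_ge0 _) Xk.
have W10 : 0 <= W1 := le_trans (enorm_ge0 _) W1k.
have W20 : 0 <= W2 := le_trans (enorm_ge0 _) W2k.
(* On the window f counts as a perturbation, bounded through the bound Xb on x. *)
pose P := f0 * Xb + W1.
have P0 : 0 <= P by rewrite addr_ge0// mulr_ge0.
have HP r : 3 * k%:R * h <= r <= t -> enorm (f r (x r) + w1 r) <= P.
  move=> rt; have [xr w1r _] := HB r rt.
  apply: le_trans (enormD _ _) _; apply: lerD => //.
  apply: le_trans (fle _ _ _) _; first by move: rt; lra.
  by rewrite ler_wpM2l.
set N := eA * (a1 * P + a2 * W2).
have a10 : 0 <= a1.
  apply: le_trans (alpha1_ge_iA _ _ _ _ _ _).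
  by apply: integral_on_ge0 => s _; exact: expR_ge0.
have a20 : 0 <= a2 by exact: alpha2_ge0.
have N0 : 0 <= N by rewrite mulr_ge0 ?expR_ge0// addr_ge0// mulr_ge0.
have it : enorm (x (3 * (k + q)%:R * h) - F ^+ q *m x (3 * k%:R * h)) <=
    (\sum_(0 <= i < q) opnorm (F ^+ i)) * N.
  apply: iterate_estimate => // r /andP[r1 r2]; first by apply: HP; lra.
  by have [|_ _] := HB r; first by lra.
have st : enorm (x t) <= eta' * enorm (x (3 * (k + q)%:R * h)) + N.
  have -> : t = 3 * (k + q)%:R * h + (t - 3 * (k + q)%:R * h) by rewrite addrC subrK.
  have tk' : 3 * (k + q).+1%:R * h = 3 * (k + q)%:R * h + 3 * h by rewrite -[(k + q).+1%:R]natr1; ring.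
  apply: period_state_estimate => //.
  - by apply/andP; split; lra.
  - by move=> r /andP[r1 r2]; apply: HP; lra.
  - by move=> r /andP[r1 r2]; have [|_ _] := HB (3 * (k + q)%:R * h + r - h); first by lra.
have eta0 : 0 <= eta'.
  exact: le_trans (expR_ge0 _) (eA_le_eta B0 Aq h0 S_adm dB tau0_range).
have xq : enorm (x (3 * (k + q)%:R * h)) <=
    (\sum_(0 <= i < q) opnorm (F ^+ i)) * N + opnorm (F ^+ q) * Xb.
  rewrite -[x _ in X in enorm X <= _](subrK (F ^+ q *m x (3 * k%:R * h))).
  apply: le_trans (enormD _ _) _; apply: lerD => //.
  by apply: le_trans (le_opnorm _ _) _; rewrite ler_wpM2l ?opnorm_ge0.
(* [rho1] has the factor exp(3|A|h) inside its supremum and [delta] outside, hence two bounds on the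
   same sum. *)
have s1 := power_sum_sup q0 Fq q.
have s2 := power_sumM_sup q0 Fq q (expR_ge0 (3 * opnorm A * h)).
rewrite -mulr_suml in s2.
have iA0 : 0 <= iA by apply: integral_on_ge0 => s _; exact: expR_ge0.
rewrite /rho /rho0 /rho1 /delta.
apply: (le_trans st); apply: le_trans (lerD (ler_wpM2l eta0 xq) (lexx N)) _.
move: s1 s2; set Sg := \sum_(0 <= i < q) _; set u1 := sup _; set u2 := sup _ => s1 s2.
have Sg0 : 0 <= Sg by apply: sumr_ge0 => i _; exact: opnorm_ge0.
have ea0 : 0 <= eA by exact: expR_ge0.
rewrite /N /P.
move: (eA) ea0 (iA) iA0 (a1) a10 (a2) a20 (eta') eta0 (opnorm (F ^+ q)) s2
  => e e0 i i0 b1 b10 b2 b20 et et0 r s2.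
(* The products are compared one by one: those with f0 Xb go to rho1, those with W1 and W2 to delta,
   by b1 W1 + b2 W2 <= (b1 + b2) (W1 + W2). *)
have e1 : et * (Sg * (e * (b1 * (f0 * Xb)))) <= b1 * et * u2 * (f0 * Xb).
  have -> : et * (Sg * (e * (b1 * (f0 * Xb)))) = (b1 * et * (f0 * Xb)) * (Sg * e) by ring.
  have -> : b1 * et * u2 * (f0 * Xb) = (b1 * et * (f0 * Xb)) * u2 by ring.
  by rewrite ler_wpM2l// !mulr_ge0.
have e2 : et * (Sg * (e * (b1 * W1 + b2 * W2))) <=
    et * u1 * e * (b1 + b2) * (W1 + W2).
  have : et * (Sg * (e * (b1 * W1 + b2 * W2))) <= et * (u1 * (e * (b1 * W1 + b2 * W2))).
    by rewrite ler_wpM2l// ler_wpM2r// mulr_ge0// addr_ge0// mulr_ge0.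
  move=> /le_trans; apply.
  have -> : et * u1 * e * (b1 + b2) * (W1 + W2) =
     et * (u1 * (e * ((b1 + b2) * (W1 + W2)))) by ring.
  rewrite ler_wpM2l// ler_wpM2l//; first exact: le_trans s1.
  rewrite ler_wpM2l//.
  have := mulr_ge0 b10 W20; have := mulr_ge0 b20 W10; lra.
have e3 : e * (b1 * W1 + b2 * W2) <= e * (b1 + b2) * (W1 + W2).
  rewrite -mulrA ler_wpM2l//.
  have := mulr_ge0 b10 W20; have := mulr_ge0 b20 W10; lra.
have e4 : 0 <= e * i * (W1 + W2) by rewrite !mulr_ge0// addr_ge0.
have e5 : 0 <= e * i * (f0 * Xb) by rewrite !mulr_ge0.
have -> : et * (Sg * (e * (b1 * (f0 * Xb + W1) + b2 * W2)) + r * Xb) +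
    e * (b1 * (f0 * Xb + W1) + b2 * W2) =
  et * (Sg * (e * (b1 * (f0 * Xb)))) + et * (Sg * (e * (b1 * W1 + b2 * W2)))
  + et * r * Xb + e * b1 * (f0 * Xb) + e * (b1 * W1 + b2 * W2) by ring.
have -> : (et * r + (b1 * et * u2 + e * i + e * b1) * f0) * Xb +
    (et * u1 * e * (b1 + b2) + e * i + e * (b1 + b2)) * (W1 + W2) =
  b1 * et * u2 * (f0 * Xb) + et * u1 * e * (b1 + b2) * (W1 + W2) + et * r * Xb
  + e * b1 * (f0 * Xb) + e * (b1 + b2) * (W1 + W2)
  + (e * i * (f0 * Xb) + e * i * (W1 + W2)) by ring.
move: e1 e2 e3 e4 e5.
set z1 := et * (Sg * _); set z2 := b1 * et * u2 * _; set z3 := et * (Sg * _).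
set z4 := _ * _ * _ * _ * _; set z5 := e * _; set z6 := e * _ * _.
set z7 := e * i * _; set z8 := e * i * _; lra.
Qed.

End ClosedLoopTrajectory.

(** * Decay of the trajectories *)

Section Halanay.
Context {R : realType}.

(* The maximizers of (V - d / (1 - rho)) exp(lam (t - T)), exp(lam T) = 1 / rho,
   recede by at least T at each use of the delay inequality, so that one of them
   lies in [0, T[. *)
Lemma halanay (V : R -> R) (T rho d M t1 : R) :
  0 < T -> 0 <= rho -> rho < 1 -> 0 <= d ->
  (forall t, 0 <= t -> 0 <= V t) ->
  (forall t, 0 <= t -> {for t, continuous V}) ->
  (forall t Xb, T <= t -> t <= t1 -> (forall s, t - T <= s <= t -> V s <= Xb) ->
    V t <= rho * Xb + d) ->
  (forall t, 0 <= t <= T -> V t <= M) -> T <= t1 ->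
  V t1 <= M * (if rho == 0 then 0 else expR (ln rho * (t1 - T) / T)) + d / (1 - rho).
Proof.
move=> T0 rho0 rho1 d0 V0 cV HV VM Tt1.
have M0 : 0 <= M by apply: le_trans (V0 0 _) (VM 0 _); lra.
(* By continuity the supremum over the window is attained, so V t is bounded through a single value
   in the window. *)
have HV' t : T <= t -> t <= t1 -> exists r, t - T <= r <= t /\ V t <= rho * V r + d.
  move=> Tt tt1; have tT : t - T <= t by lra.
  have [|r rt rmax] := @EVT_max R V (t - T) t tT.
    by apply: within_continuous => s /andP[s1 s2]; apply: cV; lra.
  rewrite in_itv/= in rt; exists r; split=> //.
  by apply: HV => // s st; apply: rmax; rewrite in_itv.
(* For rho = 0 one use of the inequality at t1 suffices; the exponential weight below presupposes
   rho > 0. *)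
case: eqVneq => [rhoE|rhoN].
  have [r [_]] := HV' t1 Tt1 (lexx _).
  by rewrite rhoE mul0r add0r mulr0 add0r subr0 divr1.
have rho_gt0 : 0 < rho by rewrite lt_def rhoN.
(* The fixed point of v = rho v + d; subtracting it makes the inequality homogeneous. *)
set c := d / (1 - rho).
have c0 : 0 <= c by rewrite divr_ge0//; lra.
have dE : d = c * (1 - rho) by rewrite /c mulfVK//; lra.
(* The weight grows by the factor 1 / rho over a time T and equals 1 at T, so it is at most 1 before
   T. *)
pose e s := expR (- ln rho * (s - T) / T).
have e_gt0 s : 0 < e s by exact: expR_gt0.
have lnr : ln rho < 0 by apply: ln_lt0; rewrite rho_gt0.
have ce s : {for s, continuous e}.
  apply: (@continuous_comp _ _ _ (fun s => - ln rho * (s - T) / T) expR).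
    apply: continuousM; last exact: cst_continuous.
    apply: continuousM; first exact: cst_continuous.
    by apply: continuousB; [move=> ?|exact: cst_continuous].
  exact: continuous_expR.
pose psi s := (V s - c) * e s.
have t10 : 0 <= t1 by lra.
have [|s0 s0t s0max] := @EVT_max R psi 0 t1 t10.
  apply: within_continuous => s /andP[s1 s2]; apply: continuousM; last exact: ce.
  by apply: continuousB; [exact: cV|exact: cst_continuous].
have ratio r s : rho * e s = e r * (rho * expR (- ln rho * (s - r) / T)).
  rewrite mulrCA /e -expRD; congr (_ * expR _); field; lra.
have early s : 0 <= s -> s < T -> psi s <= M.
  move=> s_ge0 sT; have [Vc|Vc] := leP (V s) c.
    apply: le_trans M0; rewrite /psi mulr_le0_ge0 ?subr_le0//; exact: ltW.
  have e1 : e s <= 1.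
    rewrite -expR0 ler_expR -mulrA; apply: mulr_ge0_le0; first lra.
    by rewrite pmulr_lle0 ?invr_gt0//; lra.
  apply: (@le_trans _ _ (V s - c)); first by rewrite /psi ler_piMr//; lra.
  by apply: le_trans (VM s _); lra.
(* A maximizer s <= N T is traced back; each step lowers N by one, and a maximizer below T is
   bounded by M. *)
have desc (N : nat) : forall s, 0 <= s <= t1 -> s <= N%:R * T ->
    (forall r, 0 <= r <= t1 -> psi r <= psi s) -> psi s <= M.
  elim: N => [|N IH] s st sN smax; have /andP[s_ge0 st1] := st;
    have [sT|Ts] := ltP s T; try exact: early.
  - by exfalso; move: sN; rewrite mul0r; lra.
  - have [r [/andP[r1 r2] Vs]] := HV' s Ts st1.
    have psi_le : psi s <= rho * (V r - c) * e s.
      by rewrite /psi (ler_wpM2r (ltW (e_gt0 s)))//; move: Vs; rewrite [in X in X -> _]dE; lra.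
    have [Vc|Vc] := leP (V r) c.
      apply: le_trans M0; apply: le_trans psi_le _.
      rewrite mulr_le0_ge0//; last exact: ltW.
      by rewrite pmulr_rle0// subr_le0.
    have psir : 0 < psi r by rewrite /psi mulr_gt0// subr_gt0.
    have psir_le : psi r <= psi s by apply: smax; apply/andP; split; lra.
    set kap := rho * expR (- ln rho * (s - r) / T).
    have psi_kap : psi s <= kap * psi r.
      apply: le_trans psi_le _; rewrite mulrAC [rho * e s](ratio r) -/kap /psi.
      by rewrite le_eqVlt; apply/orP; left; apply/eqP; ring.
    (* From psi r <= psi s <= kap psi r follows kap >= 1, while kap = rho^(1 - (s - r) / T) is below
       1 for r > s - T. Hence r = s - T and kap = 1, and r is a maximizer again. *)
    have kap1 : 1 <= kap.
      rewrite leNgt; apply/negP => kap1.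
      have : kap * psi r < psi r by rewrite gtr_pMl.
      lra.
    have rT : r <= s - T.
      rewrite leNgt; apply/negP => rT.
      suff : kap < 1 by lra.
      rewrite /kap -{1}[rho]lnK ?posrE// -expRD -expR0 ltr_expR.
      have -> : ln rho + - ln rho * (s - r) / T = - ln rho * ((s - r) / T - 1) by field; lra.
      rewrite pmulr_rlt0 ?oppr_gt0// subr_lt0 ltr_pdivrMr//; lra.
    have kap_le1 : kap <= 1.
      rewrite /kap -{1}[rho]lnK ?posrE// -expRD -expR0 ler_expR.
      have -> : ln rho + - ln rho * (s - r) / T = - ln rho * ((s - r) / T - 1) by field; lra.
      rewrite pmulr_rle0 ?oppr_gt0// subr_le0 ler_pdivrMr//; lra.
    have psi_eq : psi s <= psi r by apply: le_trans psi_kap _; rewrite ler_piMl// ltW.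
    apply: (le_trans psi_eq); apply: IH; first by apply/andP; split; lra.
      move: sN; rewrite -[N.+1%:R]natr1 mulrDl mul1r; lra.
    by move=> r' r't; exact: le_trans (smax r' r't) psi_eq.
rewrite in_itv/= in s0t.
have psi_t1 : psi t1 <= M.
  apply: le_trans (s0max t1 _) _; first by rewrite in_itv/= t10 lexx.
  apply: (desc (Num.truncn (s0 / T)).+1 s0 s0t).
    have s0T : 0 <= s0 / T by rewrite divr_ge0 ?(ltW T0)//; case/andP: s0t.
    have /andP[_] := truncn_itv s0T.
    by rewrite ltr_pdivrMr// => /ltW.
  by move=> r rt; apply: s0max; rewrite in_itv.
have := psi_t1; rewrite /psi -ler_pdivlMr// => H.
rewrite -lerBlDr; apply: le_trans H _.
rewrite le_eqVlt; apply/orP; left; apply/eqP; congr (_ * _).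
by rewrite /e -expRN; congr expR; ring.
Qed.

End Halanay.

Section NormOn.
Context {R : realType}.

Lemma le_norm_on n (x : R -> 'cV[R]_n) (a b C s : R) :
  (forall t, a <= t <= b -> enorm (x t) <= C) -> a <= s <= b ->
  enorm (x s) <= norm_on x a b.
Proof.
move=> xC sab; apply: sup_ubound; last by exists s => //=; rewrite in_itv.
by exists C => _ [t /= tab <-]; apply: xC; rewrite in_itv/= in tab.
Qed.

Lemma norm_on_le n (x : R -> 'cV[R]_n) (a b C : R) : a <= b ->
  (forall t, a <= t <= b -> enorm (x t) <= C) -> norm_on x a b <= C.
Proof.
move=> ab xC; apply: ge_sup; first by exists (enorm (x a)), a => //=; rewrite in_itv/= lexx.
by move=> _ [t /= tab <-]; apply: xC; rewrite in_itv/= in tab.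
Qed.

Lemma disturbance_bounded n (d : R -> 'cV[R]_n) (a b : R) : disturbance d ->
  0 <= a -> exists C, forall t, a <= t <= b -> enorm (d t) <= C.
Proof.
move=> [_ /(_ b)[C HC]] a0; exists C => t /andP[at' tb].
by apply: HC; rewrite tb andbT; lra.
Qed.

Lemma le_norm_on_disturbance n (d : R -> 'cV[R]_n) (a b s : R) : disturbance d ->
  0 <= a -> a <= s <= b -> enorm (d s) <= norm_on d a b.
Proof.
move=> dd a0; have [C HC] := disturbance_bounded b dd a0.
exact: le_norm_on HC.
Qed.

Lemma norm_on_ge0 n (x : R -> 'cV[R]_n) (a b : R) : 0 <= norm_on x a b.
Proof.
rewrite /norm_on.
have [Hs|/sup_out->//] := pselect (has_sup [set enorm (x t) | t in `[a, b]]).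
have [[y [t tab _]] _] := Hs; apply: le_trans (enorm_ge0 (x t)) _.
by apply: sup_ubound; [case: Hs|exists t].
Qed.

Lemma continuous_enorm n (x : R -> 'cV[R]_n) t :
  mx_cont x t -> {for t, continuous (fun s => enorm (x s))}.
Proof.
move=> cx; apply: (@continuous_comp _ _ _ (fun s => \sum_i x s i 0 ^+ 2) Num.sqrt).
  apply: continuous_sum => i.
  apply: (@continuous_ext _ (fun s => x s i 0 * x s i 0)) => [s|]; first by rewrite expr2.
  by apply: continuousM; exact: cx.
exact: sqrt_continuous.
Qed.

End NormOn.

Section DecayEstimate.
Context {R : realType} {n m : nat}.
Variables (A : 'M[R]_n) (B0 : 'M[R]_(n, m)) (h : R) (S : R -> R) (q : nat).
Hypotheses (Aq : A ^+ q = 0) (q0 : (0 < q)%N) (h0 : 0 < h).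
Hypotheses (S_adm : admissible_weight h S) (W_unit : Wc A B0 h S \in unitmx).
Variables (tau0 : R) (dB : 'M[R]_(n, m)) (f0 : R).
Hypotheses (tau0_ge0 : 0 <= tau0) (tau0_le : tau0 <= h) (f0_ge0 : 0 <= f0).

Local Notation iA := (integral_on 0 (3 * h) (fun s => expR (opnorm A * s))).
Local Notation a1 := (alpha1 A B0 h S tau0 dB).
Local Notation eta' := (Defs.eta A B0 h S tau0 dB).
Local Notation F := (Fmx A B0 h S tau0 dB).
Local Notation rho' := (rho A B0 h S tau0 dB f0 q).
Local Notation delta' := (delta A B0 h S tau0 dB).
Local Notation T := (3 * q.+1%:R * h).

Lemma iA_ge0 : 0 <= iA.
Proof. by apply: integral_on_ge0 => s _; exact: expR_ge0. Qed.

Lemma iA_gt0 : 0 < iA.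
Proof.
have hp := h0.
have c1 (x : R) : -1 < x -> {for x, continuous (fun=> 1 : R)}.
  by move=> _; exact: cst_continuous.
have c2 (x : R) : -1 < x -> {for x, continuous (fun s => expR (opnorm A * s))}.
  by move=> _; exact: expRM_cont.
apply: (@lt_le_trans _ _ (integral_on 0 (3 * h) (fun=> 1 : R))).
  by rewrite integral_on_cst; lra.
apply: (integral_on_le _ _ c1 c2); [lra|lra|].
by move=> x /andP[x0 _]; rewrite -expR0 ler_expR mulr_ge0 ?opnorm_ge0.
Qed.

Lemma alpha1_ge0 : 0 <= a1.
Proof. exact: le_trans iA_ge0 (alpha1_ge_iA _ _ _ _ _ _). Qed.

Lemma eta_ge1 : 1 <= eta'.
Proof.
have t0 : 0 <= tau0 <= h by rewrite tau0_ge0.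
apply: le_trans (eA_le_eta B0 Aq h0 S_adm dB t0).
by rewrite -expR0 ler_expR !mulr_ge0 ?opnorm_ge0// ltW.
Qed.

Lemma eta_ge0 : 0 <= eta'. Proof. exact: le_trans ler01 eta_ge1. Qed.

Lemma rho1_ge0 : 0 <= rho1 A B0 h S tau0 dB.
Proof.
rewrite /rho1 !addr_ge0//.
- apply: mulr_ge0; last exact: sup_power_sum_ge0 (expR_ge0 _).
  by apply: mulr_ge0; [exact: alpha1_ge0|exact: eta_ge0].
- by apply: mulr_ge0; [exact: expR_ge0|exact: iA_ge0].
- by apply: mulr_ge0; [exact: expR_ge0|exact: alpha1_ge0].
Qed.

(** As eta >= 1, the assumption rho(q) < 1 yields |F^q| < 1, which keeps the suprema over l
    finite. *)
Lemma opnorm_le_rho : opnorm (F ^+ q) <= rho'.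
Proof.
rewrite /rho /rho0; apply: (@le_trans _ _ (eta' * opnorm (F ^+ q))).
  by rewrite ler_peMl ?opnorm_ge0 ?eta_ge1.
by rewrite lerDl mulr_ge0// rho1_ge0.
Qed.

Lemma rho_ge0 : 0 <= rho'. Proof. exact: le_trans (opnorm_ge0 _) opnorm_le_rho. Qed.

(** Strict positivity comes from the summand eA * iA; it makes the linear gains strictly increasing,
    hence of class K. *)
Lemma delta_gt0 : 0 < delta'.
Proof.
rewrite /delta; apply: ltr_wpDr.
  by rewrite mulr_ge0 ?expR_ge0// addr_ge0 ?alpha1_ge0 ?alpha2_ge0.
apply: ltr_wpDl; last by rewrite mulr_gt0 ?expR_gt0 ?iA_gt0.
apply: mulr_ge0; last by apply: addr_ge0; [exact: alpha1_ge0|exact: alpha2_ge0].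
apply: mulr_ge0; last exact: expR_ge0.
apply: mulr_ge0; first exact: eta_ge0.
have := @sup_power_sum_ge0 R n F 1 ler01.
rewrite (_ : (fun l : nat => _) = (fun l : nat => \sum_(0 <= i < l) opnorm (F ^+ i)))//.
by apply/funext => l; apply: eq_bigr => i _; rewrite mulr1.
Qed.

Lemma T_gt0 : 0 < T. Proof. by rewrite !mulr_gt0. Qed.

(** With t in period j, take k = j - q: from t < 3(j + 1)h follows t - 3(q + 1)h < 3kh, so the
    window of length T contains the q periods before the current one. *)
Lemma window_index t : T <= t -> exists k : nat,
  3 * (k + q)%:R * h <= t <= 3 * (k + q).+1%:R * h /\ t - T <= 3 * k%:R * h.
Proof.
move=> Tt; have h3 : 0 < 3 * h by rewrite mulr_gt0.
have t0 : 0 <= t / (3 * h).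
  by rewrite divr_ge0 ?(ltW h3)//; apply: le_trans Tt; rewrite ltW ?T_gt0.
have /andP[] := truncn_itv t0; set j := Num.truncn _.
rewrite ler_pdivlMr// ltr_pdivrMr// => jt tj.
have qj : (q <= j)%N.
  have : q.+1%:R * (3 * h) < j.+1%:R * (3 * h).
    by apply: le_lt_trans tj; apply: le_trans Tt; rewrite [X in _ <= X]mulrAC [X in _ <= X]mulrC.
  by rewrite ltr_pM2r// ltr_nat ltnS => /ltnW.
exists (j - q)%N; rewrite subnK//.
have e (x : R) : 3 * x * h = x * (3 * h) by ring.
rewrite !e jt (ltW tj); split=> //.
rewrite natrB// mulrBl -[q.+1%:R]natr1 mulrDl.
move: tj; rewrite -[j.+1%:R]natr1 mulrDl; lra.
Qed.

Variables (f : R -> 'cV[R]_n -> 'cV[R]_n) (w1 w2 x : R -> 'cV[R]_n).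
Hypothesis f_le : forall t v, 0 <= t -> enorm (f t v) <= f0 * enorm v.
Hypothesis x_traj : trajectory (closed_loop A B0 h S tau0 dB f w1 w2) x.
Hypotheses (w1_dist : disturbance w1) (w2_dist : disturbance w2).

Lemma delayed_bound t Xb W1 W2 : rho' < 1 -> T <= t ->
  (forall s, t - T <= s <= t ->
    [/\ enorm (x s) <= Xb, enorm (w1 s) <= W1 & enorm (w2 s) <= W2]) ->
  enorm (x t) <= rho' * Xb + delta' * (W1 + W2).
Proof.
move=> r1 Tt HB; have [k [kt kT]] := window_index Tt.
apply: (window_estimate Aq h0 S_adm tau0_ge0 tau0_le x_traj W_unit f0_ge0 f_le q0 _ kt).
  exact: le_lt_trans opnorm_le_rho r1.
by move=> s /andP[ks st]; apply: HB; rewrite st andbT; exact: le_trans kT ks.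
Qed.

Lemma trajectory_bounded a b : 0 <= a ->
  exists C, forall t, a <= t <= b -> enorm (x t) <= C.
Proof.
move=> a0.
have [|C _ HC] := @continuous_bounded R (fun t => enorm (x t)) a b; last by exists C.
move=> t /andP[at' _]; apply: continuous_enorm; apply: x_traj.1; exact: le_trans at'.
Qed.

Lemma windowed_estimate t : rho' < 1 -> T <= t ->
  enorm (x t) <= rho' * norm_on x (t - T) t
    + delta' * (norm_on w1 (t - T) t + norm_on w2 (t - T) t).
Proof.
move=> r1 Tt; apply: delayed_bound => // s st.
have tT : 0 <= t - T by rewrite subr_ge0.
have [C HC] := trajectory_bounded t tT.
split; last by apply: le_norm_on_disturbance.
  exact: le_norm_on HC st.
by apply: le_norm_on_disturbance.
Qed.

(** The disturbance norms are taken up to the final time t, so that one constant d serves the delay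
    inequality on all of [T, t]; [halanay] is used with t1 = t. *)
Lemma decay_estimate t : rho' < 1 -> T <= t ->
  enorm (x t) <= norm_on x 0 T *
      (if rho' == 0 then 0 else expR (ln rho' * (t - T) / T))
    + delta' * (norm_on w1 0 t + norm_on w2 0 t) / (1 - rho') ^+ 2.
Proof.
move=> r1 Tt; have r0 := rho_ge0.
set d := delta' * _.
have d0 : 0 <= d by rewrite mulr_ge0 ?(ltW delta_gt0)// addr_ge0 ?norm_on_ge0.
have Tp := T_gt0.
have [C HC] := trajectory_bounded T (lexx 0).
apply: le_trans (@halanay R (fun s => enorm (x s)) T rho' d (norm_on x 0 T) t
  Tp r0 r1 d0 _ _ _ _ Tt) _.
- by move=> s _; exact: enorm_ge0.
- by move=> s s0; apply: continuous_enorm; exact: x_traj.1.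
- move=> s Xb Ts st HX; apply: delayed_bound => // u /andP[u1 u2].
  by split; [apply: HX; rewrite u1|apply: le_norm_on_disturbance|
    apply: le_norm_on_disturbance] => //; apply/andP; split; lra.
- by move=> s st; exact: le_norm_on HC st.
(* [halanay] gives the factor 1 / (1 - rho), and the square is weaker as 0 <= rho < 1. *)
- rewrite lerD2l; apply: ler_wpM2l => //.
  have p1 : 0 < 1 - rho' by rewrite subr_gt0.
  rewrite lef_pV2 ?posrE ?exprn_gt0// expr2 ler_piMl ?(ltW p1)//.
  by rewrite gerBl.
Qed.

End DecayEstimate.

(** * Upper bound on the contraction factor *)

Section IntegralRulesScalar.
Context {R : realType}.

Lemma integral_onZl (k : R) (g : R -> R) (c a b : R) : c < a -> a <= b ->
  (forall x, c < x -> {for x, continuous g}) ->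
  integral_on a b (fun s => k * g s) = k * integral_on a b g.
Proof.
move=> ca ab cg.
have cc' : c < (c + a) / 2 by lra.
have c'a : (c + a) / 2 <= a by lra.
have ckg x : c < x -> {for x, continuous (fun s => k * g s)}.
  by move=> cx; apply: continuousM; [exact: cst_continuous|exact: cg].
have [G [dG GE]] := antiderivative cc' cg.
have [H [dH HE]] := antiderivative cc' ckg.
rewrite (GE _ _ c'a ab) (HE _ _ c'a ab).
have d x : a <= x <= b -> is_derive x 1 (fun s => H s - k * G s) 0.
  move=> /andP[ax _]; have c'x : (c + a) / 2 < x by lra.
  have dHx := dH x c'x; have dGx := is_deriveZ k (dG x c'x).
  by apply: is_derive_eq (is_deriveB dHx dGx) _; rewrite subrr.
have : H b - k * G b = H a - k * G a.
  apply: (@cst_scalar_within _ (fun s => H s - k * G s) set0) => //.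
    by apply: within_continuous => x /d; exact: is_derive_continuous.
  by move=> x /andP[ax xb] _; apply: d; rewrite !ltW.
by rewrite mulrBr; lra.
Qed.

(** Otherwise the monotone antiderivative would be constant on [a, b], with derivative 0 at s. *)
Lemma integral_on_gt0 (f : R -> R) (c a b s : R) : c < a -> a < s < b ->
  (forall x, c < x -> {for x, continuous f}) ->
  (forall x, a <= x <= b -> 0 <= f x) -> 0 < f s -> 0 < integral_on a b f.
Proof.
move=> ca /andP[as_ sb] cf f0 fs.
have cc' : c < (c + a) / 2 by lra.
have c'a : (c + a) / 2 <= a by lra.
have ab : a <= b by lra.
have [G [dG GE]] := antiderivative cc' cf.
have mono u v : a <= u -> u <= v -> v <= b -> G u <= G v.
  move=> au uv vb; apply: (@ndecr_off_finite _ G f set0 u v _ uv) => //.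
    by move=> t /andP[ut _]; apply: is_derive_continuous (dG t _); lra.
  by move=> t /andP[ut tv] _; split; [apply: dG; lra|apply: f0; lra].
rewrite (GE _ _ c'a ab) subr_gt0 lt_def mono ?lexx// andbT; apply/negP => /eqP Gba.
have dG0 : is_derive s 1 G 0.
  apply: (near_eq_is_derive _ (is_derive_cst (G a) s (1 : R))).
  near=> t; rewrite /cst; apply/eqP.
  have at' : a < t by near: t; exact: lt_nbhsr.
  have tb : t < b by near: t; exact: lt_nbhsl.
  have u1 : G a <= G t by apply: mono; lra.
  have u2 : G t <= G a by rewrite -Gba; apply: mono; lra.
  by rewrite eq_le u1.
have c's : (c + a) / 2 < s by lra.
have [_ e1] := dG s c's; have [_ e2] := dG0.
by move: fs; rewrite -e1 e2 ltxx.
Unshelve. all: by end_near. Qed.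

Lemma mxintegralMr p n k (C : 'M[R]_(n, k)) (M : R -> 'M[R]_(p, n)) (c a b : R) :
  c < a -> a <= b -> (forall x, c < x -> mx_cont M x) ->
  mxintegral a b (fun s => M s *m C) = mxintegral a b M *m C.
Proof.
move=> ca ab cM.
have cc' : c < (c + a) / 2 by lra.
have c'a : (c + a) / 2 < a by lra.
have [F [dF FE]] := mx_antiderivative cc' cM.
rewrite (FE _ _ (ltW c'a) ab) mulmxBl.
apply: (@mxintegral_FTC _ _ _ _ (fun s => F s *m C) c a b) => //.
- by move=> x cx; apply: mx_contM; [exact: cM|exact: mx_cont_cst].
- move=> x /andP[ax _]; have c'x := lt_le_trans c'a ax.
  apply: mx_derive_eq (mx_deriveM (dF x c'x) (mx_derive_cst C x)) _.
  by rewrite mulmx0 addr0.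
Qed.

(** With P = M + D, induction on P^(k+1) - M^(k+1) = P (P^k - M^k) + D M^k; for k = 0 the factor k
    makes the truncated exponent harmless. *)
Lemma opnorm_exprB_le n (M D : 'M[R]_n) (a : R) k :
  opnorm M <= a -> opnorm (M + D) <= a ->
  opnorm ((M + D) ^+ k - M ^+ k) <= k%:R * a ^+ k.-1 * opnorm D.
Proof.
move=> Ma MDa; have a0 : 0 <= a := le_trans (opnorm_ge0 _) Ma.
elim: k => [|k IH]; first by rewrite !expr0 subrr opnorm0 !mul0r.
have -> : (M + D) ^+ k.+1 - M ^+ k.+1 =
    (M + D) *m ((M + D) ^+ k - M ^+ k) + D *m M ^+ k.
  rewrite mulmxBr -[_ *m (M + D) ^+ k]exprS mulmxDl -[M *m M ^+ k]exprS opprD.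
  by rewrite addrA subrK.
apply: le_trans (opnormD _ _) _.
have e1 : opnorm ((M + D) *m ((M + D) ^+ k - M ^+ k)) <=
    a * (k%:R * a ^+ k.-1 * opnorm D).
  apply: le_trans (opnormM _ _) _.
  by apply: ler_pM => //; exact: opnorm_ge0.
have e2 : opnorm (D *m M ^+ k) <= a ^+ k * opnorm D.
  rewrite mulrC; apply: le_trans (opnormM _ _) _; rewrite ler_wpM2l ?opnorm_ge0//.
  by apply: le_trans (opnormX _ _) _; rewrite lerXn2r ?nnegrE ?opnorm_ge0.
apply: le_trans (lerD e1 e2) _.
have -> : a * (k%:R * a ^+ k.-1 * opnorm D) = k%:R * a ^+ k * opnorm D.
  case: k {IH e1 e2} => [|k]; first by rewrite !mul0r mulr0.
  by rewrite exprS /=; ring.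
by rewrite /= -[k.+1%:R]natr1 [(k%:R + 1) * _]mulrDl mul1r mulrDl.
Qed.

End IntegralRulesScalar.

Section UpperBoundTheory.
Context {R : realType} {n m : nat}.
Variables (A : 'M[R]_n) (B0 : 'M[R]_(n, m)) (h : R) (S : R -> R) (q : nat).
Hypotheses (Aq : A ^+ q = 0) (q0 : (0 < q)%N) (n0 : (0 < n)%N) (h0 : 0 < h).
Hypotheses (S_adm : admissible_weight h S) (AB0 : controllable A B0).
Variable tauM : R.
Hypotheses (tauM_gt0 : 0 < tauM) (tauM_le : tauM <= h).

Local Notation E s := (expmx (s *: A)).
Local Notation W := (Wc A B0 h S).
Local Notation cT := (c_Theta A B0 h S tauM).
Local Notation M := (Mbound A h tauM).

(** Y is what remains of the exponential polynomial, without its constant term, after A is factored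
    out; it commutes with A as a polynomial in A. *)
Lemma expmx_sub1 (s : R) : exists Y : 'M[R]_n,
  A *m Y = Y *m A /\ E s = 1%:M + A *m Y.
Proof.
case: q q0 Aq => [//|q' _ Aq'].
exists (\sum_(k < q') (s ^+ k.+1 / (k.+1)`!%:R) *: A ^+ k); split.
  rewrite mulmx_suml mulmx_sumr; apply: eq_bigr => k _.
  by rewrite -scalemxAl -scalemxAr -[A *m _]exprS -[_ *m A]exprSr.
rewrite (expmx_nilpotent Aq') big_ord_recl !expr0 divr1 scale1r; congr (_ + _).
rewrite mulmx_sumr; apply: eq_bigr => k _.
by rewrite -scalemxAr -[A *m _]exprS.
Qed.

Lemma nominal_map_nilpotent (s t : R) : (E s *m (1%:M - E t)) ^+ q = 0.
Proof.
have [Y [AY EY]] := expmx_sub1 t.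
have -> : E s *m (1%:M - E t) = A *m (- (E s *m Y)).
  rewrite EY opprD addrA subrr add0r mulmxN mulmxA (expmx_comm Aq) -mulmxA.
  by rewrite mulmxN.
have c : GRing.comm A (- (E s *m Y)).
  rewrite /GRing.comm -[LHS]/(A *m _) -[RHS]/(_ *m A) mulmxN mulNmx; congr (- _).
  by rewrite mulmxA -(expmx_comm Aq) -!mulmxA AY.
by rewrite -[A *m _]/(A * _) exprMn_comm// Aq mul0r.
Qed.

Lemma nominal_le_Mbound tau0 : 0 <= tau0 <= tauM ->
  opnorm (E (3 * h) *m (1%:M - E (- tau0))) <= M - 1.
Proof.
move=> t0; rewrite /Mbound [X in _ <= X]addrC addKr; have hp := h0; have tM := tauM_le.
have [C [C0 _ EC _]] := uniform_norm_bounds B0 Aq h0 S_adm (lexx 0).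
apply: sup_ubound; last by exists tau0 => //=; rewrite in_itv.
exists (C * (1 + C)) => _ [t /= tt <-]; rewrite in_itv/= in tt; have /andP[t1 t2] := tt.
apply: opnormM_le; first by apply: EC; lra.
apply: le_trans (opnormB _ _) _; apply: lerD; first exact: opnorm1_le1.
by apply: EC; lra.
Qed.

Lemma Mbound_ge1 : 1 <= M.
Proof.
rewrite -subr_ge0; have t0 : 0 <= (0 : R) <= tauM by apply/andP; split; [exact: lexx|exact: ltW].
exact: le_trans (opnorm_ge0 _) (nominal_le_Mbound t0).
Qed.

Definition ctheta_kernel (th tau0 s : R) : R :=
  opnorm (E (th - s)) * S s * opnorm (feedback_gain A B0 h S 0 s)
  * opnorm (E (s - h - tau0)).

Lemma feedback_gain_cont s : mx_cont (feedback_gain A B0 h S 0) s.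
Proof.
have -> : feedback_gain A B0 h S 0 = fun s =>
    B0^T *m expmx (- s *: A^T) *m invmx W *m E (h - s).
  by apply/funext => r; rewrite feedback_gain0 opprB.
apply: mx_contM; last exact: (expmx_rev_cont Aq).
apply: mx_contM; last exact: mx_cont_cst.
by apply: mx_contM; [exact: mx_cont_cst|exact: (expmxN_cont (trmx_nilpotent Aq))].
Qed.

Lemma ctheta_kernel_cont th tau0 s : 0 < s -> {for s, continuous (ctheta_kernel th tau0)}.
Proof.
move=> s0; apply: continuousM.
  apply: continuousM; last by apply: continuous_opnorm; exact: feedback_gain_cont.
  apply: continuousM; last exact: (weight_cont S_adm).
  by apply: continuous_opnorm; exact: (expmx_rev_cont Aq).
apply: continuous_opnorm.
have d := @mx_derive_comp_affine R n n (fun r => E r) 1 (- h - tau0) s _ (expmx_derive Aq _).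
have := mx_derive_cont d.
have -> // : (fun s => E (1 * s + (- h - tau0))) = (fun s => E (s - h - tau0)).
by apply/funext => r; rewrite mul1r addrA.
Qed.

Lemma ctheta_kernel_ge0 th tau0 s : 2 * h <= s <= 3 * h -> 0 <= ctheta_kernel th tau0 s.
Proof.
move=> s23; have [_ _ S0 _ _] := S_adm.
by rewrite !mulr_ge0 ?opnorm_ge0// S0.
Qed.

Lemma le_c_Theta th tau0 : 2 * h <= th <= 3 * h -> 0 <= tau0 <= tauM ->
  integral_on (2 * h) th (ctheta_kernel th tau0) <= cT.
Proof.
move=> th23 t0; have hp := h0; have tM := tauM_le; have h2 : 0 < 2 * h by lra.
have [C [C0 _ EC _]] := uniform_norm_bounds B0 Aq h0 S_adm (lexx 0).
have [D D0 DP] : exists2 D, 0 <= D & forall r, 2 * h <= r <= 3 * h ->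
    S r * opnorm (feedback_gain A B0 h S 0 r) <= D.
  apply: continuous_bounded => r /andP[r2 _]; have r0 : 0 < r by lra.
  apply: continuousM; first exact: (weight_cont S_adm).
  by apply: continuous_opnorm; exact: feedback_gain_cont.
apply: sup_ubound; last by exists (th, tau0) => //=; rewrite !in_itv.
exists (C * D * C * h) => _ [[z1 z2] /= [z23 zM] <-].
rewrite !in_itv/= in z23 zM; have /andP[z2' z3'] := z23; have /andP[y1 y2] := zM.
rewrite -[X in X <= _]/(integral_on (2 * h) z1 (ctheta_kernel z1 z2)).
have c1 (x : R) : 0 < x -> {for x, continuous (ctheta_kernel z1 z2)} by exact: ctheta_kernel_cont.
have c2 (x : R) : 0 < x -> {for x, continuous (fun=> C * D * C)}.
  by move=> _; exact: cst_continuous.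
apply: le_trans (integral_on_le h2 z2' c1 c2 _) _.
  move=> s /andP[s1 s2]; have s3 : s <= 3 * h by lra.
  apply: ler_pM; rewrite ?opnorm_ge0//.
  - by rewrite -mulrA !mulr_ge0 ?opnorm_ge0//; have [_ _ S0 _ _] := S_adm; apply: S0; lra.
  - rewrite -mulrA; apply: ler_pM; rewrite ?opnorm_ge0//.
    + by rewrite mulr_ge0 ?opnorm_ge0//; have [_ _ S0 _ _] := S_adm; apply: S0; lra.
    + by apply: EC; lra.
    + by apply: DP; lra.
  - by apply: EC; lra.
rewrite integral_on_cst//; apply: ler_wpM2l; last lra.
by rewrite !mulr_ge0.
Qed.

Lemma opnorm_expmx_gt0 s : 0 < opnorm (E s).
Proof.
rewrite lt_def opnorm_ge0 andbT; apply/negP => /eqP/opnorm_eq0 E0.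
have := expmxVl Aq s; rewrite E0 mulmx0 => /matrixP/(_ (Ordinal n0) (Ordinal n0)).
by rewrite !mxE eqxx => /esym/eqP; rewrite oner_eq0.
Qed.

(** B0^T is recovered from the gain by multiplication with invertible matrices, and B0 is nonzero by
    controllability. *)
Lemma feedback_gain_gt0 s : 0 < opnorm (feedback_gain A B0 h S 0 s).
Proof.
rewrite lt_def opnorm_ge0 andbT; apply/negP => /eqP/opnorm_eq0.
rewrite feedback_gain0 => K0.
have Wu := Wc_unit Aq AB0 h0 S_adm.
have B00 : B0^T = 0.
  have : B0^T *m expmx (- s *: A^T) *m invmx W *m E (- (s - h))
      *m (E (s - h) *m W *m expmx (s *: A^T)) = 0 by rewrite K0 mul0mx.
  rewrite !mulmxA -[_ *m E (- (s - h)) *m _]mulmxA (expmxVl Aq) mulmx1.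
  rewrite -[_ *m invmx W *m _]mulmxA mulVmx// mulmx1.
  by rewrite -mulmxA (expmxVl (trmx_nilpotent Aq)) mulmx1.
have /eqP := controllable_neq0 Aq AB0 n0.
by apply; rewrite -[B0]trmxK B00 trmx0.
Qed.

(** The kernel is positive wherever S is. Positivity gives the quotients by c_Theta their
    meaning. *)
Lemma c_Theta_gt0 : 0 < cT.
Proof.
have hp := h0; have h2 : 0 < 2 * h by lra.
have z1 : 2 * h <= 3 * h <= 3 * h by lra.
have z2 : 0 <= (0 : R) <= tauM by apply/andP; split; [exact: lexx|exact: ltW].
apply: lt_le_trans (le_c_Theta z1 z2).
have [_ _ S0 [s s23 Ss] _] := S_adm.
apply: (integral_on_gt0 h2 s23).
- by move=> x; exact: ctheta_kernel_cont.
- by move=> x x23; exact: ctheta_kernel_ge0.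
- by rewrite !mulr_gt0 ?opnorm_expmx_gt0 ?feedback_gain_gt0.
Qed.

Lemma opnorm_Theta_le tau0 dB : 0 <= tau0 <= tauM ->
  opnorm (Theta A B0 h S tau0 dB (3 * h)) <= opnorm dB * cT.
Proof.
move=> t0; have hp := h0; have h2 : 0 < 2 * h by lra.
have h23 : 2 * h <= 3 * h by lra.
have z1 : 2 * h <= 3 * h <= 3 * h by rewrite h23/=.
rewrite (ThetaE B0 Aq h0 S_adm tau0 dB h23) opnormN -mulmxA.
have cg (x : R) : 0 < x -> mx_cont (gram A B0 S dB) x by exact: (gram_c Aq S_adm).
have cg' (x : R) : 0 < x -> mx_cont (fun s => E (3 * h) *m gram A B0 S dB s) x.
  by move=> x0; apply: mx_contM; [exact: mx_cont_cst|exact: cg].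
rewrite -(mxintegralMl (E (3 * h)) h2 h23 cg).
rewrite -(mxintegralMr (invmx W *m E (- tau0)) h2 h23 cg').
have cM (x : R) : 0 < x ->
    mx_cont (fun s => E (3 * h) *m gram A B0 S dB s *m (invmx W *m E (- tau0))) x.
  by move=> x0; apply: mx_contM; [exact: cg'|exact: mx_cont_cst].
have ck (x : R) : 0 < x -> {for x, continuous (fun s => opnorm dB * ctheta_kernel (3 * h) tau0 s)}.
  by move=> x0; apply: continuousM; [exact: cst_continuous|exact: ctheta_kernel_cont].
apply: le_trans (opnorm_mxintegral_le h2 h23 cM ck _) _; last first.
  have ck' (x : R) : 0 < x -> {for x, continuous (ctheta_kernel (3 * h) tau0)}.
    exact: ctheta_kernel_cont.
  rewrite (integral_onZl (opnorm dB) h2 h23 ck').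
  by rewrite ler_wpM2l ?opnorm_ge0// le_c_Theta.
move=> s s23.
(* The exponentials are regrouped so that dB stands between exp((3h - s)A) and the gain, which
   exposes the kernel of [c_Theta]. *)
have -> : E (3 * h) *m gram A B0 S dB s *m (invmx W *m E (- tau0)) =
    S s *: (E (3 * h - s) *m (dB *m (feedback_gain A B0 h S 0 s *m E (s - h - tau0)))).
  have -> : E (- tau0) = E (- (s - h)) *m E (s - h - tau0).
    by rewrite -(expmxD Aq); have -> : - (s - h) + (s - h - tau0) = - tau0 by ring.
  have -> : E (3 * h - s) = E (3 * h) *m E (- s) by rewrite -(expmxD Aq).
  by rewrite feedback_gain0 /gram !mulmxA -scalemxAr -!scalemxAl.
have [_ _ S0 _ _] := S_adm.
apply: le_trans (opnormZ_le _ _) _; rewrite ger0_norm ?S0//.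
rewrite /ctheta_kernel; set e1 := opnorm (E (3 * h - s)); set k := opnorm (feedback_gain _ _ _ _ _ _).
set e2 := opnorm (E (s - h - tau0)).
have -> : opnorm dB * (e1 * S s * k * e2) = S s * (e1 * (opnorm dB * (k * e2))) by ring.
rewrite ler_wpM2l ?S0//; apply: opnormM_le => //; apply: opnormM_le => //.
exact: opnormM.
Qed.

Lemma Fmx_Theta tau0 dB : Fmx A B0 h S tau0 dB =
  E (3 * h) *m (1%:M - E (- tau0)) + Theta A B0 h S tau0 dB (3 * h).
Proof.
have hp := h0; have h23 : 2 * h <= 3 * h by lra.
by rewrite (ThetaE B0 Aq h0 S_adm tau0 dB h23).
Qed.

End UpperBoundTheory.

Section RhoBar.
Context {R : realType} {n m : nat}.
Variables (A : 'M[R]_n) (B0 : 'M[R]_(n, m)) (h : R) (S : R -> R) (q : nat).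
Hypotheses (Aq : A ^+ q = 0) (q0 : (0 < q)%N) (n0 : (0 < n)%N) (h0 : 0 < h).
Hypotheses (S_adm : admissible_weight h S) (AB0 : controllable A B0).
Variable tauM : R.
Hypotheses (tauM_gt0 : 0 < tauM) (tauM_le : tauM <= h).

Local Notation E s := (expmx (s *: A)).
Local Notation eA := (expR (3 * opnorm A * h)).
Local Notation iA := (integral_on 0 (3 * h) (fun s => expR (opnorm A * s))).
Local Notation cT := (c_Theta A B0 h S tauM).
Local Notation M := (Mbound A h tauM).

Lemma uniform_bounds_exist :
  exists etab alpha1b, uniform_bounds A B0 h S tauM etab alpha1b.
Proof.
have c0 : 0 <= 1 / cT by rewrite divr_ge0// ltW// (c_Theta_gt0 Aq).
have [C HC] := uniform_constant_bounds B0 Aq h0 S_adm c0.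
exists C, C => tau0 dB /andP[t1 t2] dBc.
have t0 : 0 <= tau0 <= h by rewrite t1 (le_trans t2).
have [He Ha] := HC tau0 dB t0 dBc; split=> //.
have hp := h0; have l : 2 * h <= 3 * h by lra.
apply: ge_sup; first by eexists; exists (2 * h) => //=; rewrite in_itv/= lexx.
by move=> _ [s /= s23 <-]; apply: He; rewrite in_itv/= in s23.
Qed.

Lemma rho_le_rhobar etab alpha1b eps f0 tau0 dB :
  uniform_bounds A B0 h S tauM etab alpha1b -> 0 <= eps ->
  eps < 1 / (2 * q%:R * M ^+ q.-1 * cT) -> 0 <= f0 -> 0 <= tau0 <= tauM ->
  opnorm dB <= eps ->
  rho A B0 h S tau0 dB f0 q <= rhobar A B0 h S tauM q etab alpha1b eps f0.
Proof.
move=> UB eps0 eps_lt f00 t0M dBe.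
have cT0 : 0 < cT by exact: (c_Theta_gt0 Aq).
have M1 : 1 <= M by exact: (Mbound_ge1 B0 Aq h0 S_adm tauM_gt0).
have M0 : 0 <= M by exact: le_trans M1.
have q1 : 1 <= q%:R :> R by rewrite ler1n.
have Mq1 : 1 <= M ^+ q.-1 by rewrite exprn_ege1.
have /andP[t0 t1] := t0M.
have t0h : tau0 <= h by exact: le_trans tauM_le.
set r := opnorm (Fmx A B0 h S tau0 dB ^+ q).
(* The smallness of eps in the form in which it is used: the bound on |F^q| obtained below stays
   under 1/2. *)
have epsb : q%:R * M ^+ q.-1 * (eps * cT) < 1 / 2.
  move: eps_lt; rewrite ltr_pdivlMr; last by rewrite !mulr_gt0//; lra.
  have -> : eps * (2 * q%:R * M ^+ q.-1 * cT) = 2 * (q%:R * M ^+ q.-1 * (eps * cT)) by ring.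
  lra.
have epscT : eps * cT <= q%:R * M ^+ q.-1 * (eps * cT).
  by rewrite ler_peMl ?mulr_ge0 ?(ltW cT0)// mulr_ege1.
have dBc : opnorm dB <= 1 / cT.
  by rewrite ler_pdivlMr// (@le_trans _ _ (eps * cT)) ?ler_wpM2r ?(ltW cT0)//; lra.
have [etaB alphaB] := UB tau0 dB t0M dBc.
have Th : opnorm (Theta A B0 h S tau0 dB (3 * h)) <= eps * cT.
  apply: le_trans (opnorm_Theta_le B0 Aq h0 S_adm tauM_le dB t0M) _.
  by rewrite ler_wpM2r// ltW.
have N_le := nominal_le_Mbound B0 Aq h0 S_adm tauM_le t0M.
(* The nominal part is at most M - 1 and |Theta| <= eps c_Theta < 1/2. *)
have F_le : opnorm (Fmx A B0 h S tau0 dB) <= M.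
  by rewrite (Fmx_Theta B0 Aq h0 S_adm); apply: le_trans (opnormD _ _) _; lra.
(* The nominal part has vanishing q-th power, so |F^q| is the norm of a difference of q-th
   powers. *)
have r_le : r <= q%:R * M ^+ q.-1 * (eps * cT).
  rewrite /r (Fmx_Theta B0 Aq h0 S_adm).
  set Nm := E (3 * h) *m _; set D := Theta _ _ _ _ _ _ _.
  have NmM : opnorm Nm <= M by lra.
  have NDM : opnorm (Nm + D) <= M by apply: le_trans (opnormD _ _) _; lra.
  have := opnorm_exprB_le q NmM NDM.
  rewrite (nominal_map_nilpotent Aq q0) subr0 => /le_trans; apply.
  by rewrite ler_wpM2l// mulr_ge0// exprn_ge0.
have r0 : 0 <= r by exact: opnorm_ge0.
have r12 : r < 1 / 2 by lra.
have r1 : r < 1 by lra.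
have e0 : 0 <= eA by exact: expR_ge0.
have i0 : 0 <= iA by exact: iA_ge0.
have et0 : 0 <= Defs.eta A B0 h S tau0 dB by exact: (eta_ge0 B0 Aq h0 S_adm dB t0 t0h).
have a0 : 0 <= alpha1 A B0 h S tau0 dB by exact: alpha1_ge0.
have etb0 : 0 <= etab by exact: le_trans etaB.
have ab0 : 0 <= alpha1b by exact: le_trans alphaB.
set Sg := \sum_(0 <= j < q) M ^+ j.
have Sg0 : 0 <= Sg by apply: sumr_ge0 => j _; exact: exprn_ge0.
(* The factor 2 in [rhobar] is the bound on 1 / (1 - |F^q|) for |F^q| < 1/2. *)
have sup_le : sup (range (fun l : nat =>
    \sum_(0 <= i < l) opnorm (Fmx A B0 h S tau0 dB ^+ i) * eA)) <= 2 * Sg * eA.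
  apply: ge_sup; first by eexists; exists 0%N.
  move=> _ [l _ <-]; rewrite -mulr_suml ler_wpM2r//.
  apply: le_trans (power_sum_le q0 r1 l) _.
  have D_le : \sum_(0 <= j < q) opnorm (Fmx A B0 h S tau0 dB ^+ j) <= Sg.
    apply: ler_sum => j _; apply: le_trans (opnormX _ _) _.
    by rewrite lerXn2r ?nnegrE ?opnorm_ge0.
  rewrite -/r ler_pdivrMr; last lra.
  apply: (le_trans D_le); have := mulr_ge0 Sg0 r0; have := mulr_ge0 Sg0 (ltW (_ : 0 < 1 / 2 - r)).
  rewrite subr_gt0 => /(_ r12); lra.
rewrite /rho /rhobar; apply: lerD.
  rewrite /rho0 -/r -!mulrA; apply: ler_pM => //.
  apply: (le_trans r_le); rewrite -!mulrA ler_wpM2l//.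
  rewrite [eps * cT]mulrC ler_wpM2r ?mulr_ge0 ?(ltW cT0)//.
  (* M^(q-1) <= M^(2q-2), as M >= 1 and q >= 1. *)
  by apply: ler_weXn2l => //; rewrite mul2n -addnn leq_subRL; case: (q) q0 => // k _;
     rewrite ?addnS ?addSn /= ?leq_addl ?leq_addr.
rewrite ler_wpM2r// /rho1.
have p1 : alpha1 A B0 h S tau0 dB * Defs.eta A B0 h S tau0 dB <= alpha1b * etab.
  by apply: ler_pM.
have p2 := ler_pM (mulr_ge0 a0 et0) (sup_power_sum_ge0 (Fmx A B0 h S tau0 dB) e0) p1 sup_le.
apply: le_trans (lerD (lerD p2 (lexx _)) (ler_wpM2l e0 alphaB)) _.
rewrite -/Sg; move: (iA) => i.
by rewrite le_eqVlt; apply/orP; left; apply/eqP; ring.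
Qed.

Lemma rhobar_cvg0 etab alpha1b :
  (fun b : R * R => rhobar A B0 h S tauM q etab alpha1b b.1 b.2)
    @ bounds_to_0 --> (0 : R).
Proof.
rewrite /rhobar; set c1 := _ * cT; set c2 := eA * _.
have c1c : c1 * b.1 + c2 * b.2 @[b --> ((0, 0) : R * R)] --> (0 : R).
  have fst0 : b.1 @[b --> ((0, 0) : R * R)] --> (0 : R) by exact: cvg_fst.
  have snd0 : b.2 @[b --> ((0, 0) : R * R)] --> (0 : R) by exact: cvg_snd.
  have f1 : c1 * b.1 @[b --> ((0, 0) : R * R)] --> c1 * 0 by exact: cvgMl_tmp.
  have f2 : c2 * b.2 @[b --> ((0, 0) : R * R)] --> c2 * 0 by exact: cvgMl_tmp.
  have e : c1 * 0 + c2 * 0 = 0 :> R by rewrite !mulr0 addr0.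
  have c : c1 * b.1 + c2 * b.2 @[b --> ((0, 0) : R * R)] --> c1 * 0 + c2 * 0.
    exact: cvgD.
  by rewrite e in c.
apply: cvg_trans c1c; apply: cvg_app.
exact: cvg_within.
Qed.

Lemma near_rho_lt (kappa : R) : 0 < kappa ->
  \forall b \near bounds_to_0, forall tau0 dB, 0 <= tau0 <= tauM ->
    opnorm dB <= b.1 -> rho A B0 h S tau0 dB b.2 q < kappa.
Proof.
move=> k0; have [etab [alpha1b UB]] := uniform_bounds_exist.
have cT0 : 0 < cT by exact: (c_Theta_gt0 Aq).
have M0 : 0 < M.
  exact: lt_le_trans ltr01 (Mbound_ge1 B0 Aq h0 S_adm tauM_gt0 tauM_le).
set e1 := 1 / (2 * q%:R * M ^+ q.-1 * cT).
have e10 : 0 < e1 by rewrite divr_gt0// !mulr_gt0 ?exprn_gt0// ltr0n.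
have F1 : \forall b \near bounds_to_0, b.1 < e1.
  have : (fun b : R * R => b.1) @ bounds_to_0 --> (0 : R).
    have fst0 : b.1 @[b --> ((0, 0) : R * R)] --> (0 : R) by exact: cvg_fst.
    by apply: cvg_trans fst0; apply: cvg_app; exact: cvg_within.
  by move=> H; have := H _ (lt_nbhsl e10).
have F2 : \forall b \near bounds_to_0,
    rhobar A B0 h S tauM q etab alpha1b b.1 b.2 < kappa.
  have H := @rhobar_cvg0 etab alpha1b.
  by have := H _ (lt_nbhsl k0).
have F3 : \forall b \near bounds_to_0, 0 <= b.1 /\ 0 <= b.2 :> R by exact: withinT.
apply: filterS3 F1 F2 F3 => b b1 b2 [b3 b4] tau0 dB t0 dBb.
by apply: le_lt_trans b2; exact: rho_le_rhobar.
Qed.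

(** The rate exceeds a as soon as rho < exp(- 3 a (q + 1) h), and rho = 0 counts as an infinite
    rate. *)
Lemma near_rate (a : R) :
  \forall b \near bounds_to_0, forall tau0 dB, 0 <= tau0 <= tauM ->
    opnorm dB <= b.1 ->
    (a%:E < conv_rate h q (rho A B0 h S tau0 dB b.2 q))%E.
Proof.
set k := expR (- (a * (3 * q.+1%:R * h))).
have F3 : \forall b \near bounds_to_0, 0 <= b.1 /\ 0 <= b.2 :> R by exact: withinT.
apply: filterS2 (near_rho_lt (expR_gt0 (- (a * (3 * q.+1%:R * h))))) F3.
move=> b H [b1 b2] tau0 dB t0 dBb; have rk := H tau0 dB t0 dBb.
have /andP[t1 t2] := t0; have t3 : tau0 <= h by exact: le_trans tauM_le.
rewrite /conv_rate; case: eqVneq => [_|rN]; first by rewrite ltry.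
have r0 : 0 < rho A B0 h S tau0 dB b.2 q.
  by rewrite lt_def rN (rho_ge0 B0 Aq h0 S_adm dB t1 t3 b2).
rewrite lte_fin ltr_pdivlMr; last by rewrite !mulr_gt0.
rewrite ltrNr -[X in _ < X]expRK ltr_ln ?posrE ?expR_gt0//.
Qed.

End RhoBar.

(** * Well-posedness of the closed loop for f = 0 *)

Section Uniqueness.
Context {R : realType} {n m : nat}.
Variables (A : 'M[R]_n) (B0 : 'M[R]_(n, m)) (h : R) (S : R -> R) (q : nat).
Hypotheses (Aq : A ^+ q = 0) (h0 : 0 < h) (S_adm : admissible_weight h S).
Variables (tau0 : R) (dB : 'M[R]_(n, m)).
Hypotheses (tau0_ge0 : 0 <= tau0) (tau0_le : tau0 <= h).
Variable (f : R -> 'cV[R]_n -> 'cV[R]_n).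
Hypothesis f_eq0 : forall t v, 0 <= t -> f t v = 0.

Lemma closed_loopB w1 w2 x y t : 0 <= t ->
  closed_loop A B0 h S tau0 dB f w1 w2 y t - closed_loop A B0 h S tau0 dB f w1 w2 x t
  = closed_loop A B0 h S tau0 dB (fun _ _ => 0) (fun=> 0) (fun=> 0)
      (fun s => y s - x s) t.
Proof.
move=> t0; rewrite /closed_loop !f_eq0// !addr0 /control /output.
rewrite opprD addrACA subrr addr0 opprD addrACA -mulmxBr -mulmxBr; congr (_ + _ *m _).
rewrite opprK addrC -scalerBr -mulmxBr -scalerN -mulmxN; congr (_ *: (_ *m _)).
by rewrite opprD addrACA subrr !addr0 opprB.
Qed.

(** For f = 0 the difference of two solutions is a trajectory of the undisturbed loop; the period
    estimate with P = w_ = 0 then propagates the value 0 through each period. *)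
Lemma closed_loop_unique w1 w2 x0 x y :
  is_solution (h + tau0) (closed_loop A B0 h S tau0 dB f w1 w2) x0 x ->
  is_solution (h + tau0) (closed_loop A B0 h S tau0 dB f w1 w2) x0 y ->
  forall t, - (h + tau0) <= t -> y t = x t.
Proof.
move=> solx soly t rt; have hp := h0; have tp := tau0_ge0.
have r0 : 0 < h + tau0 by lra.
have [cx dx] := solution_trajectory r0 solx.
have [cy dy] := solution_trajectory r0 soly.
have [_ x0E _] := solx; have [_ y0E _] := soly.
have [t_le0|/ltW t0] := leP t 0; first by rewrite x0E ?y0E// rt.
pose z s := y s - x s.
have ztraj : trajectory (closed_loop A B0 h S tau0 dB (fun _ _ => 0) (fun=> 0) (fun=> 0)) z.
  split=> [s s0|T].
    by apply: mx_contD; [exact: cy|apply: mx_contN; exact: cx].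
  have [E1 fE1 HE1] := dx T; have [E2 fE2 HE2] := dy T.
  exists (E1 `|` E2); first by rewrite finite_setU.
  move=> s sT sE; have /andP[/ltW s0 _] := sT.
  rewrite -(closed_loopB w1 w2 x y s0).
  by apply: mx_deriveB; [apply: HE2 => // sE2; apply: sE; right|
    apply: HE1 => // sE1; apply: sE; left].
have step (l : nat) s : z (3 * l%:R * h) = 0 -> 0 <= s <= 3 * h -> z (3 * l%:R * h + s) = 0.
  move=> zl s03.
  have p1 (r : R) : 0 < r < s -> enorm (0 + 0 : 'cV[R]_n) <= 0.
    by rewrite addr0 enorm0.
  have p2 (r : R) : 2 * h < r < s -> enorm (0 : 'cV[R]_n) <= 0.
    by rewrite enorm0.
  have [c1 c2] := period_estimate (l := l) Aq h0 S_adm tau0_ge0 tau0_le ztraj s03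
    (lexx 0) (lexx 0) p1 p2.
  rewrite !zl !mulmx0 !subr0 !mulr0 addr0 mulr0 in c1 c2.
  by apply: enorm_le0; have [/c1|/ltW/c2] := leP s (2 * h).
have zl0 (l : nat) : z (3 * l%:R * h) = 0.
  elim: l => [|l IH].
    by rewrite mulr0 mul0r /z x0E ?y0E ?subrr//; lra.
  have -> : 3 * l.+1%:R * h = 3 * l%:R * h + 3 * h by rewrite -[l.+1%:R]natr1; ring.
  by apply: step => //; lra.
have h3 : 0 < 3 * h by lra.
have t0' : 0 <= t / (3 * h) by rewrite divr_ge0// ltW.
have /andP[] := truncn_itv t0'; set l := Num.truncn _.
rewrite ler_pdivlMr// ltr_pdivrMr// -[l.+1%:R]natr1 => lt tl.
have : z (3 * l%:R * h + (t - 3 * l%:R * h)) = 0.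
  by apply: step => //; move: lt tl; lra.
by rewrite addrC subrK => /eqP; rewrite subr_eq0 => /eqP.
Qed.

End Uniqueness.

Section VectorAntiderivative.
Context {R : realType}.

Lemma continuous_near_eq (f g : R -> R) (t : R) : (\near t, f t = g t) ->
  {for t, continuous f} -> {for t, continuous g}.
Proof.
move=> fg cf; rewrite /prop_for /continuous_at -(nbhs_singleton fg).
by apply: cvg_trans cf; exact: near_eq_cvg.
Qed.

Lemma mx_cont_near_eq p n (M N : R -> 'M[R]_(p, n)) (t : R) :
  (\near t, M t = N t) -> mx_cont M t -> mx_cont N t.
Proof.
move=> MN cM i j; apply: continuous_near_eq (cM i j).
by apply: filterS MN => s ->.
Qed.

(** Integration starts at -1, so that V is continuous at 0 from both sides; as v vanishes up to 0,
    V(0) = 0 nevertheless. *)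
Lemma vector_antiderivative n (v : R -> 'cV[R]_n) :
  (forall t, t <= 0 -> v t = 0) ->
  (forall u, exists2 E : set R, finite_set E &
     forall t, 0 < t < u -> ~ E t -> mx_cont v t) ->
  (forall u, exists C, forall t, 0 < t <= u -> enorm (v t) <= C) ->
  exists V : R -> 'cV[R]_n,
    [/\ V 0 = 0, forall t, -1 < t -> mx_cont V t,
        forall t, 0 < t -> mx_cont v t -> mx_derive V t (v t)
      & forall a b, 0 <= a -> a <= b -> V b - V a = mxintegral a b v].
Proof.
move=> v0 vE vC.
have H (i : 'I_n) := @piecewise_antiderivative R (fun t => v t i 0) (-1).
(* The possible jump at 0 is the only exception that the cut-off adds. *)
have P1 (i : 'I_n) u : finite_set [set t | -1 < t < u /\ ~ {for t, continuous (fun t => v t i 0)}].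
  have [E fE HE] := vE u.
  apply: (@sub_finite_set _ _ (E `|` [set 0])); last by rewrite finite_setU.
  move=> t /= [/andP[t1 tu] ct]; have [tE|tE] := pselect (E t); first by left.
  right; apply: contrapT => /eqP t0; apply: ct.
  have [t_lt0|t_gt0|/eqP] := ltgtP t 0; last by rewrite (negbTE t0).
    apply: (@continuous_near_eq (fun=> 0)); last exact: cst_continuous.
    near=> s; rewrite v0 ?mxE//; apply: ltW; near: s; exact: lt_nbhsl.
  by apply: HE => //; rewrite t_gt0.
have P2 (i : 'I_n) u : exists C, forall t, -1 <= t <= u -> `|v t i 0| <= C.
  have [C HC] := vC u; exists (Num.max 0 C) => t /andP[_ tu].
  have [t0|t0] := leP t 0; first by rewrite v0// mxE normr0 le_max lexx.
  rewrite le_max; apply/orP; right; apply: le_trans (coord_le_enorm _ _) _.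
  by apply: HC; rewrite t0.
have {}H i := H i (P1 i) (P2 i).
exists (fun t => \col_i integral_on (-1) t (fun s => v s i 0)).
have l1 : (-1 : R) <= 0 by lra.
split.
- apply/colP => i; rewrite !mxE (@integral_on_eq _ _ (fun=> 0)).
    by rewrite integral_on_cst// mul0r.
  by move=> t /andP[_ t0]; rewrite v0 ?mxE.
- move=> t t1 i j; case: (H i) => + _ _ => /(_ t t1).
  by apply: continuous_ext => s; rewrite mxE.
- move=> t t0 ct i j; rewrite ord1; case: (H i) => _ + _ => /(_ t).
  have t1 : -1 < t by lra.
  move=> /(_ t1 (ct i 0)) d.
  by apply: is_derive_ext d => s; rewrite mxE.
- move=> a b a0 ab; apply/matrixP => i j.
  have a1 : -1 <= a by lra.
  case: (H i) => _ _ /(_ a b a1 ab).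
by rewrite ord1 !mxE => ->.
Unshelve. all: by end_near. Qed.

End VectorAntiderivative.

Section GatePhases.
Context {R : realType}.
Variable h : R.
Hypothesis h0 : 0 < h.

Lemma gate_off (l : nat) (t : R) :
  3 * l%:R * h <= t -> t <= (3 * l%:R + 2) * h -> gate h t = 0.
Proof.
move=> lt tl; have hp := h0; rewrite /gate (@period_eq _ _ h0 l); last first.
  by rewrite -[l.+1%:R]natr1; apply/andP; split; lra.
by rewrite ifF//; apply/negbTE; rewrite -leNgt.
Qed.

Lemma gate_on (l : nat) (t : R) :
  (3 * l%:R + 2) * h < t -> t < 3 * l.+1%:R * h -> gate h t = 1.
Proof.
move=> lt tl; have hp := h0; rewrite /gate (@period_eq _ _ h0 l) ?lt//.
by rewrite tl andbT; lra.
Qed.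

Definition period_index (t : R) : nat := Num.truncn (t / (3 * h)).

Lemma period_indexP t : 0 <= t ->
  3 * (period_index t)%:R * h <= t < 3 * (period_index t).+1%:R * h.
Proof.
move=> t0; have h3 : 0 < 3 * h by rewrite mulr_gt0.
have t0' : 0 <= t / (3 * h) by rewrite divr_ge0// ltW.
have /andP[] := truncn_itv t0'; rewrite -/(period_index t).
rewrite ler_pdivlMr// ltr_pdivrMr// => lt tl.
have e (a : R) : 3 * a * h = a * (3 * h) by ring.
by rewrite !e lt.
Qed.

Lemma period_index_eq (l : nat) t :
  3 * l%:R * h <= t -> t < 3 * l.+1%:R * h -> period_index t = l.
Proof.
move=> lt tl; have hp := h0; have h3 : 0 < 3 * h by rewrite mulr_gt0.
have t0 : 0 <= t by apply: le_trans lt; rewrite !mulr_ge0// ltW.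
apply: truncn_def; rewrite ler_pdivlMr// ltr_pdivrMr//.
by apply/andP; split; lra.
Qed.

End GatePhases.

Section Shift.
Context {R : realType}.

Lemma mx_cont_shift p n (M : R -> 'M[R]_(p, n)) (a t : R) :
  mx_cont M (t - a) -> mx_cont (fun s => M (s - a)) t.
Proof.
move=> cM i j; apply: (@continuous_comp _ _ _ (fun s => s - a) (fun u => M u i j)).
  by apply: continuousB; [move=> ?|exact: cst_continuous].
exact: cM.
Qed.

End Shift.

(** * Existence of solutions by recursion over the periods *)

Section Existence.
Context {R : realType} {n m : nat}.
Variables (A : 'M[R]_n) (B0 : 'M[R]_(n, m)) (h : R) (S : R -> R) (q : nat).
Hypotheses (Aq : A ^+ q = 0) (h0 : 0 < h) (S_adm : admissible_weight h S).
Variables (tau0 : R) (dB : 'M[R]_(n, m)).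
Hypotheses (tau0_ge0 : 0 <= tau0) (tau0_le : tau0 <= h).

Local Notation E s := (expmx (s *: A)).

Section DelayedInput.
Variables (V : R -> 'cV[R]_n) (w2 : R -> 'cV[R]_n).

(* The control on the l-th period, written with the value z of exp(-At) x at the
   start of that period: the delayed measurement is taken in the free phase, where
   exp(-At) x moves with V only. *)
Definition period_input (l : nat) (z : 'cV[R]_n) (t : R) : 'cV[R]_m :=
  - ((S t * gate h t) *: (feedback_gain A B0 h S l%:R t
      *m (E (t - h - tau0) *m (z + (V (t - h - tau0) - V (3 * l%:R * h)))
          + w2 (t - h)))).

Definition period_forcing (l : nat) (z : 'cV[R]_n) (t : R) : 'cV[R]_n :=
  E (- t) *m ((B0 + dB) *m period_input l z t).

(** The value of exp(-At) x at the start of period l, with V standing for the contribution of w1.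
    The recursion is explicit, since the input of a period depends on the state only through its
    value at the start. *)
Fixpoint period_state (z0 : 'cV[R]_n) (l : nat) : 'cV[R]_n :=
  if l is l'.+1 then
    let z := period_state z0 l' in
    z + (V (3 * l'.+1%:R * h) - V (3 * l'%:R * h))
    + mxintegral (3 * l'%:R * h) (3 * l'.+1%:R * h) (period_forcing l' z)
  else z0.

(** Cut off for t <= 0 to fit [vector_antiderivative]. *)
Definition forcing (z0 : 'cV[R]_n) (t : R) : 'cV[R]_n :=
  if t <= 0 then 0
  else period_forcing (period_index h t) (period_state z0 (period_index h t)) t.

Variable z0 : 'cV[R]_n.

Lemma period_input_off l z t : gate h t = 0 -> period_input l z t = 0.
Proof. by move=> g0; rewrite /period_input g0 mulr0 scale0r oppr0. Qed.

Lemma period_forcing_off l z t : gate h t = 0 -> period_forcing l z t = 0.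
Proof. by move=> g0; rewrite /period_forcing period_input_off// !mulmx0. Qed.

Lemma forcing_off t : gate h t = 0 -> forcing z0 t = 0.
Proof. by move=> g0; rewrite /forcing; case: ifP => // _; exact: period_forcing_off. Qed.

(** The right end point belongs to the next period, but the gate is 0 there, so both sides vanish;
    closed integration intervals are thereby allowed. *)
Lemma forcingE (l : nat) t : 3 * l%:R * h <= t <= 3 * l.+1%:R * h ->
  forcing z0 t = period_forcing l (period_state z0 l) t.
Proof.
move=> /andP[lt tl]; have hp := h0.
have [tl'|tl'] := ltP t (3 * l.+1%:R * h); last first.
  have -> : t = 3 * l.+1%:R * h by apply/eqP; rewrite eq_le tl.
  have g0 : gate h (3 * l.+1%:R * h) = 0 by apply: (@gate_off _ _ h0 l.+1); lra.
  by rewrite forcing_off// period_forcing_off.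
rewrite /forcing (period_index_eq h0 lt tl'); case: ifP => // t0.
have l0 : 0 <= 3 * l%:R * h by rewrite !mulr_ge0// ltW.
by rewrite period_forcing_off//; apply: (@gate_off _ _ h0 l); lra.
Qed.

Hypothesis V_cont : forall t, -1 < t -> mx_cont V t.
Hypothesis w2_dist : disturbance w2.

(** The exceptions are the starts of periods, the starts of control phases and the discontinuities
    of w2 delayed by h. Elsewhere the forcing agrees locally with 0 or with one continuous
    expression. *)
Lemma forcing_cont u : exists2 X : set R, finite_set X &
  forall t, 0 < t < u -> ~ X t -> mx_cont (forcing z0) t.
Proof.
have hp := h0; have t1 := tau0_ge0; have t2 := tau0_le.
pose N := (period_index h u).+1.
pose D := [set s : R | 0 < s < u /\ ~ {for s, continuous w2}].
exists ([set 3 * l%:R * h | l in `I_N] `|` ([set (3 * l%:R + 2) * h | l in `I_N]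
  `|` [set s + h | s in D])).
  rewrite !finite_setU; split; first exact/finite_image/finite_II.
  split; first exact/finite_image/finite_II.
  by apply: finite_image; case: w2_dist => + _; apply.
move=> t /andP[t0 tu] tX.
have /andP[lt tl] := period_indexP h0 (ltW t0); set l := period_index h t in lt tl.
have lN : (l < N)%N.
  rewrite ltnS; apply: le_truncn; rewrite ler_wpM2r ?(ltW tu)// invr_ge0.
  by rewrite mulr_ge0// ltW.
have lt' : 3 * l%:R * h < t.
  rewrite lt_neqAle lt andbT; apply/negP => /eqP e; apply: tX; left.
  by exists l.
have [tl2|lt2|e] := ltgtP t ((3 * l%:R + 2) * h).
- apply: (@mx_cont_near_eq _ _ _ (fun=> 0)); last exact: mx_cont_cst.
  near=> s; rewrite forcing_off//; apply: (@gate_off _ _ h0 l); apply: ltW.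
    by near: s; exact: lt_nbhsr.
  by near: s; exact: lt_nbhsl.
- pose G s := E (- s) *m ((B0 + dB) *m (- (S s *: (feedback_gain A B0 h S l%:R s
    *m (E (s - h - tau0) *m (period_state z0 l + (V (s - h - tau0) - V (3 * l%:R * h)))
          + w2 (s - h)))))).
  apply: (@mx_cont_near_eq _ _ _ G).
    near=> s.
    have sl : s < 3 * l.+1%:R * h by near: s; exact: lt_nbhsl.
    have ls : (3 * l%:R + 2) * h < s by near: s; exact: lt_nbhsr.
    rewrite (@forcingE l); last by apply/andP; split; lra.
    by rewrite /period_forcing /period_input (gate_on h0 ls sl) mulr1.
  have l0 : 0 <= 3 * l%:R * h by rewrite !mulr_ge0// ltW.
  apply: mx_contM; first exact: (expmxN_cont Aq).
  apply: mx_contM; first exact: mx_cont_cst.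
  apply: mx_contN; apply: mx_contZ; first exact: (weight_cont S_adm).
  have sh (M : R -> 'cV[R]_n) : mx_cont M (t - h - tau0) ->
      mx_cont (fun s => M (s - h - tau0)) t.
    by move=> cM; apply: (mx_cont_shift (M := fun s => M (s - tau0))); exact: mx_cont_shift.
  apply: mx_contM.
    have -> : feedback_gain A B0 h S l%:R = fun s =>
        feedback_gain A B0 h S 0 (s - 3 * l%:R * h).
      apply/funext => s; rewrite -(feedback_gain_shift A B0 h S l%:R).
      by rewrite addrC subrK.
    by apply: mx_cont_shift; exact: (feedback_gain_cont (q := q)).
  apply: mx_contD; last first.
    apply: mx_cont_shift; apply/mx_contP; apply: contrapT => cw; apply: tX.
    right; right; exists (t - h); last by rewrite subrK.
    by split=> //; apply/andP; split; lra.
  apply: mx_contM.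
    apply: (mx_cont_shift (M := fun s => E (s - tau0))).
    by apply: (mx_cont_shift (M := fun s => E s)); exact: (expmx_cont Aq).
  apply: mx_contD; first exact: mx_cont_cst.
  apply: mx_contD; last by apply: mx_contN; exact: mx_cont_cst.
  by apply: sh; apply: V_cont; lra.
- by exfalso; apply: tX; right; left; exists l.
Unshelve. all: by end_near. Qed.

Lemma forcing_bounded u : exists C, forall t, 0 < t <= u -> enorm (forcing z0 t) <= C.
Proof.
have hp := h0; have t1 := tau0_ge0; have t2 := tau0_le.
pose N := (period_index h u).+1.
have [C1 C10 C1P] : exists2 C, 0 <= C & forall s, 0 <= s <= u -> opnorm (E (- s)) <= C.
  by apply: continuous_bounded => s _; apply: continuous_opnorm; exact: (expmxN_cont Aq).
(* Control acts only after 2h, so S is bounded away from time 0, where its two-sided continuity is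
   not asserted. *)
have [C2 C20 C2P] : exists2 C, 0 <= C & forall s, h <= s <= u -> `|S s| <= C.
  apply: continuous_bounded => s /andP[hs _].
  apply: (@continuous_comp _ _ _ S Num.norm); last exact: norm_continuous.
  by apply: (weight_cont S_adm); lra.
have [C3 C30 C3P] : exists2 C, 0 <= C & forall s, 0 <= s <= 3 * h ->
    opnorm (feedback_gain A B0 h S 0 s) <= C.
  apply: continuous_bounded => s _; apply: continuous_opnorm.
  exact: (feedback_gain_cont (q := q)).
have [C4 C40 C4P] : exists2 C, 0 <= C & forall s, 0 <= s <= u -> opnorm (E s) <= C.
  by apply: continuous_bounded => s _; apply: continuous_opnorm; exact: (expmx_cont Aq).
have [C5 C50 C5P] : exists2 C, 0 <= C & forall s, 0 <= s <= u -> enorm (V s) <= C.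
  by apply: continuous_bounded => s /andP[s0 _]; apply: continuous_enorm; apply: V_cont; lra.
have [C6 C6P] := w2_dist.2 u.
pose Cz := \sum_(l < N) enorm (period_state z0 l).
exists (C1 * (opnorm (B0 + dB) * (C2 * (C3 * (C4 * (Cz + (C5 + C5)) + Num.max 0 C6))))).
have C60 : 0 <= Num.max 0 C6 by rewrite le_max lexx.
have Cz0 : 0 <= Cz by apply: sumr_ge0 => l _; exact: enorm_ge0.
have p1 : 0 <= C4 * (Cz + (C5 + C5)) + Num.max 0 C6.
  by rewrite addr_ge0// mulr_ge0// !addr_ge0.
have p2 := mulr_ge0 C30 p1; have p3 := mulr_ge0 C20 p2.
have p4 := mulr_ge0 (opnorm_ge0 (B0 + dB)) p3.
move=> t /andP[t0 tu].
have /andP[lt tl] := period_indexP h0 (ltW t0); set l := period_index h t in lt tl.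
have lN : (l < N)%N.
  rewrite ltnS; apply: le_truncn; rewrite ler_wpM2r// invr_ge0.
  by rewrite mulr_ge0// ltW.
have [tl2|lt2] := leP t ((3 * l%:R + 2) * h).
  have g0 := gate_off h0 lt tl2.
  by rewrite forcing_off// enorm0; apply: mulr_ge0.
rewrite (@forcingE l) ?lt ?(ltW tl)// /period_forcing.
have l0 : 0 <= 3 * l%:R * h by rewrite !mulr_ge0// ltW.
apply: le_trans (le_opnorm _ _) _; apply: ler_pM; rewrite ?opnorm_ge0 ?enorm_ge0//.
  by apply: C1P; rewrite tu ltW.
apply: le_trans (le_opnorm _ _) _; rewrite ler_wpM2l ?opnorm_ge0//.
rewrite /period_input enormN (gate_on h0 lt2 tl) mulr1 enormZ.
apply: ler_pM; rewrite ?enorm_ge0//; first by apply: C2P; lra.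
apply: le_trans (le_opnorm _ _) _; apply: ler_pM; rewrite ?opnorm_ge0 ?enorm_ge0//.
  have -> : t = 3 * l%:R * h + (t - 3 * l%:R * h) by rewrite addrC subrK.
  rewrite (feedback_gain_shift A B0 h S l%:R); apply: C3P.
  by move: tl; rewrite -[l.+1%:R]natr1 => tl'; apply/andP; split; lra.
apply: le_trans (enormD _ _) _; apply: lerD; last first.
  by rewrite le_max; apply/orP; right; apply: C6P; lra.
apply: le_trans (le_opnorm _ _) _; apply: ler_pM; rewrite ?opnorm_ge0 ?enorm_ge0//.
  by apply: C4P; lra.
apply: le_trans (enormD _ _) _; apply: lerD.
  rewrite /Cz (bigD1 (Ordinal lN))//= lerDl sumr_ge0// => i _; exact: enorm_ge0.
apply: le_trans (enormD _ _) _; rewrite enormN; apply: lerD; apply: C5P; lra.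
Qed.

End DelayedInput.

Variable (f : R -> 'cV[R]_n -> 'cV[R]_n).
Hypothesis f_eq0 : forall t v, 0 <= t -> f t v = 0.

(** exp(-At) x is sought as phi(0) + V + Q, with V from w1 and Q from the control. [forcing]
    computes the control in advance from the recursion; afterwards it is verified to be the feedback
    of the resulting x. *)
Lemma closed_loop_exists phi w1 w2 : initial_function (h + tau0) phi ->
  disturbance w1 -> disturbance w2 ->
  exists x, is_solution (h + tau0) (closed_loop A B0 h S tau0 dB f w1 w2) phi x.
Proof.
move=> phi_init w1_dist w2_dist; have hp := h0; have t1 := tau0_ge0; have t2 := tau0_le.
pose v t : 'cV[R]_n := if t <= 0 then 0 else E (- t) *m w1 t.
have v_near (t : R) : 0 < t -> \near t, E (- t) *m w1 t = v t.
  by move=> t0; near=> s; rewrite /v leNgt ifF//; apply/negbF; near: s; exact: lt_nbhsr.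
have v_cont (t : R) : 0 < t -> {for t, continuous w1} -> mx_cont v t.
  move=> t0 cw; apply: (mx_cont_near_eq (v_near t t0)).
  by apply: mx_contM; [exact: (expmxN_cont Aq)|exact/mx_contP].
have v_pc u : exists2 X : set R, finite_set X &
    forall t, 0 < t < u -> ~ X t -> mx_cont v t.
  exists [set t : R | 0 < t < u /\ ~ {for t, continuous w1}]; first exact: w1_dist.1.
  move=> t tu tX; apply: v_cont; first by case/andP: tu.
  by apply: contrapT => cw; apply: tX.
have v_bd u : exists C, forall t, 0 < t <= u -> enorm (v t) <= C.
  have [C1 C10 C1P] : exists2 C, 0 <= C & forall s, 0 <= s <= u -> opnorm (E (- s)) <= C.
    by apply: continuous_bounded => s _; apply: continuous_opnorm; exact: (expmxN_cont Aq).
  have [C HC] := w1_dist.2 u; exists (C1 * C) => t /andP[t0 tu].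
  rewrite /v [t <= 0]leNgt t0/=; apply: le_trans (le_opnorm _ _) _.
  by apply: ler_pM; rewrite ?opnorm_ge0 ?enorm_ge0 ?C1P ?HC// ltW.
have v_le0 t : t <= 0 -> v t = 0 by rewrite /v => ->.
have [V [V0 V_cont V_der V_int]] := vector_antiderivative v_le0 v_pc v_bd.
pose c := forcing V w2 (phi 0).
have c_le0 t : t <= 0 -> c t = 0 by rewrite /c /forcing => ->.
have c_pc u := forcing_cont (phi 0) V_cont w2_dist u.
have c_bd u := forcing_bounded (phi 0) V_cont w2_dist u.
have [Q [Q0 Q_cont Q_der Q_int]] := vector_antiderivative c_le0 c_pc c_bd.
pose Z t := phi 0 + V t + Q t.
have l3 (l : nat) : 0 <= 3 * l%:R * h by rewrite !mulr_ge0// ltW.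
have l33 (l : nat) : 3 * l.+1%:R * h = 3 * l%:R * h + 3 * h.
  by rewrite -[l.+1%:R]natr1; ring.
(* Consistency: the states of the recursion are the values of Z at the starts of the periods. *)
have Zl (l : nat) : Z (3 * l%:R * h) = period_state V w2 (phi 0) l.
  elim: l => [|l IH]; first by rewrite mulr0 mul0r /Z V0 Q0 !addr0.
  rewrite /= -IH -(mxintegral_eq (M := c)); last first.
    by move=> t tl; rewrite IH; exact: forcingE.
  rewrite -Q_int//; last by rewrite l33; lra.
  have gen (a b b' d d' : 'cV[R]_n) : a + b' + d' = a + b + d + (b' - b) + (d' - d).
    by apply/colP => i; rewrite !mxE; ring.
  exact: gen.
(* Q rests during the free phase, so Z moves with V only; this is the form in which [period_input]
   reads the delayed state. *)
have Zfree (l : nat) t : 3 * l%:R * h <= t -> t <= (3 * l%:R + 2) * h ->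
    Z t = period_state V w2 (phi 0) l + (V t - V (3 * l%:R * h)).
  move=> lt tl; have : Q t - Q (3 * l%:R * h) = 0.
    rewrite Q_int// (mxintegral_eq (N := fun=> 0)) => [|s /andP[ls st]].
      rewrite (@mxintegral_FTC _ _ _ _ (fun=> 0) (3 * l%:R * h - 1))//; [by rewrite subrr|lra| |].
        by move=> x _; exact: mx_cont_cst.
      by move=> x _; exact: mx_derive_cst.
    by rewrite /c forcing_off// (@gate_off _ _ h0 l)//; lra.
  move/eqP; rewrite subr_eq0 => /eqP QE.
  rewrite -Zl /Z QE.
  have gen (a b d e : 'cV[R]_n) : e + d + a = e + b + a + (d - b).
    by apply/colP => i; rewrite !mxE; ring.
  exact: gen.
pose Y t := E t *m Z t.
have Z_cont t : -1 < t -> mx_cont Z t.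
  move=> t0; apply: mx_contD; last exact: Q_cont.
  by apply: mx_contD; [exact: mx_cont_cst|exact: V_cont].
have Y_cont t : -1 < t -> mx_cont Y t.
  by move=> t0; apply: mx_contM; [exact: (expmx_cont Aq)|exact: Z_cont].
have Y0 : Y 0 = phi 0 by rewrite /Y (expmx0 Aq) mul1mx /Z V0 Q0 !addr0.
pose x t := if t <= 0 then phi t else Y t.
have xphi t : t <= 0 -> x t = phi t by move=> t0; rewrite /x t0.
have xY t : 0 <= t -> x t = Y t.
  rewrite /x le_eqVlt => /predU1P[<-|t0]; first by rewrite lexx Y0.
  by rewrite [t <= 0]leNgt t0.
(* When the gate is on, t - h - tau0 lies in the free phase of the period of t, where [Zfree]
   applies. *)
have controlE t : 0 < t -> c t = E (- t) *m ((B0 + dB) *m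
    control A B0 h S (output tau0 x w2) t).
  move=> t0; have /andP[lt tl] := period_indexP h0 (ltW t0).
  set l := period_index h t in lt tl.
  have tl' : 3 * l%:R * h <= t <= 3 * l.+1%:R * h by rewrite lt ltW.
  rewrite /c (forcingE V w2 (phi 0) tl') /period_forcing; congr (_ *m (_ *m _)).
  have [tl2|lt2] := leP t ((3 * l%:R + 2) * h).
    have g0 := gate_off h0 lt tl2.
    by rewrite period_input_off// /control g0 mulr0 scale0r oppr0.
  rewrite /period_input /control /K /output (@period_eq _ _ h0 l) ?lt//.
  have lp := l3 l; rewrite l33 in tl; rewrite xY; last lra.
  by rewrite /Y -(Zfree l) //; lra.
exists x; split.
(* Continuity is checked on two closed pieces, as phi is continuous only within its own interval. *)
- have -> : `[- (h + tau0), +oo[%classic = `[- (h + tau0), 0] `|` `[0, +oo[ :> set R.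
    apply/seteqP; split=> t /=; rewrite !in_itv/= ?andbT.
      by move=> rt; have [t0|/ltW t0] := leP t 0; [left|right]; rewrite ?rt ?t0.
    by case=> [/andP[]//|t0]; lra.
  apply: withinU_continuous.
  + exact: interval_closed.
  + exact: interval_closed.
  + apply: (subspace_eq_continuous _ phi_init) => t.
    by rewrite inE/= in_itv/= => /andP[_ t0]; apply/esym/xphi.
  + apply: (@subspace_eq_continuous _ _ _ Y).
      by move=> t; rewrite inE/= in_itv/= andbT => t0; apply/esym/xY.
    apply: continuous_in_subspaceT => t; rewrite inE/= in_itv/= andbT => t0.
    by apply/mx_contP; apply: Y_cont; lra.
- by move=> t /andP[_ t0]; rewrite /x t0.
- move=> T; have [X1 fX1 HX1] := v_pc T; have [X2 fX2 HX2] := c_pc T.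
  exists (X1 `|` X2); first by rewrite finite_setU.
  move=> t tT tX; have /andP[t0 _] := tT.
  have dV : mx_derive V t (v t) by apply: V_der => //; apply: HX1 => // ?; apply: tX; left.
  have dQ : mx_derive Q t (c t) by apply: Q_der => //; apply: HX2 => // ?; apply: tX; right.
  have dZ : mx_derive Z t (v t + c t).
    apply: mx_derive_eq (mx_deriveD (mx_deriveD (mx_derive_cst (phi 0) t) dV) dQ) _.
    by rewrite add0r.
  have dY := mx_deriveM (expmx_derive Aq t) dZ.
  apply: (@near_eq_is_derive _ _ _ Y).
    by near=> s; rewrite xY//; apply: ltW; near: s; exact: lt_nbhsr.
  apply/mx_deriveP; apply: mx_derive_eq dY _.
  rewrite -mulmxA -/(Y t) mulmxDr controlE// /v [t <= 0]leNgt t0/= !mulmxA (expmxVr Aq) !mul1mx.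
  rewrite /closed_loop f_eq0 ?(ltW t0)// addr0 xY ?(ltW t0)//.
  by rewrite -mulmxA -/(Y t) [w1 t + _]addrC addrA.
Unshelve. all: by end_near. Qed.

End Existence.

(** * Linear gains, stacked disturbances and the theorem *)

Section DisturbanceBlocks.
Context {R : realType}.

Lemma classK_linear (k : R) : 0 < k -> classK (fun s => k * s).
Proof.
move=> k0; split; last 2 first.
- by rewrite mulr0.
- by move=> s t _ st; rewrite ltr_pM2l.
by apply: continuous_subspaceT => s; exact: mulrl_continuous.
Qed.

Lemma disturbance_image p n (g : 'cV[R]_p -> 'cV[R]_n) (d : R -> 'cV[R]_p) :
  (forall t, mx_cont d t -> mx_cont (fun s => g (d s)) t) ->
  (forall v, enorm (g v) <= enorm v) ->
  disturbance d -> disturbance (fun t => g (d t)).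
Proof.
move=> cg gle [pd bd]; split=> [T|T].
  apply: sub_finite_set (pd T) => t [tT ct]; split=> // cd; apply: ct.
  by apply/mx_contP; apply: cg; apply/mx_contP.
by have [C HC] := bd T; exists C => t tT; apply: le_trans (gle _) (HC t tT).
Qed.

Lemma disturbance_usubmx n1 n2 (d : R -> 'cV[R]_(n1 + n2)) :
  disturbance d -> disturbance (fun t => usubmx (d t)).
Proof.
apply: disturbance_image; last exact: enorm_usubmx.
move=> t cd i j; apply: continuous_ext (cd (lshift n2 i) j) => s.
by rewrite mxE.
Qed.

Lemma disturbance_dsubmx n1 n2 (d : R -> 'cV[R]_(n1 + n2)) :
  disturbance d -> disturbance (fun t => dsubmx (d t)).
Proof.
apply: disturbance_image; last exact: enorm_dsubmx.
move=> t cd i j; apply: continuous_ext (cd (rshift n1 i) j) => s.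
by rewrite mxE.
Qed.

End DisturbanceBlocks.

Theorem theorem2 (R : realType) (n m : nat) (A : 'M[R]_n) (q : nat)
    (B0 : 'M[R]_(n, m)) (tauM h : R) (S : R -> R)
    (q_le_n : (q <= n)%N) (Aq : A ^+ q = 0) (Aq1 : A ^+ q.-1 <> 0)
    (AB0 : controllable A B0) (tauM_gt0 : 0 < tauM) (h_ge : tauM <= h)
    (S_adm : admissible_weight h S) :
  let T := 3 * q.+1%:R * h in
  let rho_ := fun f0 tau0 dB l => rho A B0 h S tau0 dB f0 l in
  [/\ (* the estimate *)
      forall (eps f0 tau0 : R) (dB : 'M[R]_(n, m))
             (f : R -> 'cV[R]_n -> 'cV[R]_n),
        0 <= eps -> 0 <= f0 -> uncertainty tauM eps f0 tau0 dB f ->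
        (forall (tau : R) (l : nat), 0 <= tau <= tauM -> (q <= l)%N ->
           rho_ f0 tau dB l < 1) ->
        forall x0 w1 w2 x : R -> 'cV[R]_n,
          initial_function (h + tau0) x0 -> disturbance w1 -> disturbance w2 ->
          is_solution (h + tau0) (closed_loop A B0 h S tau0 dB f w1 w2) x0 x ->
          forall t, T <= t ->
            enorm (x t) <=
              norm_on x 0 T *
                (if rho_ f0 tau0 dB q == 0 then 0
                 else expR (ln (rho_ f0 tau0 dB q) * (t - T) / T))
              + delta A B0 h S tau0 dB * (norm_on w1 0 t + norm_on w2 0 t)
                / (1 - rho_ f0 tau0 dB q) ^+ 2,
      (* the upper bound on rho(q) tends to zero *)
      (exists etab alpha1b, uniform_bounds A B0 h S tauM etab alpha1b) /\
      (forall etab alpha1b, uniform_bounds A B0 h S tauM etab alpha1b ->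
         (forall (eps f0 tau0 : R) (dB : 'M[R]_(n, m)),
            0 <= eps ->
            eps < 1 / (2 * q%:R * Mbound A h tauM ^+ q.-1
                       * c_Theta A B0 h S tauM) ->
            0 <= f0 -> 0 <= tau0 <= tauM -> opnorm dB <= eps ->
            rho_ f0 tau0 dB q
              <= rhobar A B0 h S tauM q etab alpha1b eps f0) /\
         (fun b : R * R => rhobar A B0 h S tauM q etab alpha1b b.1 b.2)
           @ bounds_to_0 --> (0 : R)),
      (* the convergence rate tends to infinity, uniformly *)
      forall a : R, \forall b \near bounds_to_0,
        forall (tau0 : R) (dB : 'M[R]_(n, m)),
          0 <= tau0 <= tauM -> opnorm dB <= b.1 ->
          (a%:E < conv_rate h q (rho_ b.2 tau0 dB q))%E,
      (* the estimate is an almost fixed-time ISS estimate *)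
      almost_fixed_time_ISS_estimate
        (fun (b : R * R)
             (u : R * 'M[R]_(n, m) * (R -> 'cV[R]_n -> 'cV[R]_n)) =>
           uncertainty tauM b.1 b.2 u.1.1 u.1.2 u.2)
        (fun u => h + u.1.1)
        (fun u => closed_loop A B0 h S u.1.1 u.1.2 u.2)
        T
        (fun b u => conv_rate h q (rho_ b.2 u.1.1 u.1.2 q))
        (fun b u s => delta A B0 h S u.1.1 u.1.2 * s
                      / (1 - rho_ b.2 u.1.1 u.1.2 q) ^+ 2)
    & (* the case dB = 0, f0 = 0 *)
      forall (tau0 : R) (f : R -> 'cV[R]_n -> 'cV[R]_n),
        0 <= tau0 <= tauM -> nonlinearity 0 f ->
        [/\ rho_ 0 tau0 0 q = 0,
            forall x0 w1 w2 x : R -> 'cV[R]_n,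
              initial_function (h + tau0) x0 ->
              disturbance w1 -> disturbance w2 ->
              is_solution (h + tau0) (closed_loop A B0 h S tau0 0 f w1 w2)
                x0 x ->
              forall t, T <= t ->
                enorm (x t) <= delta A B0 h S tau0 0
                               * (norm_on w1 (t - T) t + norm_on w2 (t - T) t)
          & fixed_time_ISS (h + tau0)
              (fun (d : R -> 'cV[R]_(n + n)) =>
                 closed_loop A B0 h S tau0 0 f
                   (fun t => usubmx (d t)) (fun t => dsubmx (d t)))]].
Proof.
move=> T rho_.
(* For q = 0 both powers in the hypotheses are A^0, which cannot be zero and nonzero. *)
have q0 : (0 < q)%N by rewrite lt0n; apply: contra_notN Aq1 => /eqP q0; rewrite q0 in Aq *.
have n0 : (0 < n)%N.
  rewrite lt0n; apply: contra_notN Aq1 => /eqP n0.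
  by apply/matrixP => -[i i_lt]; exfalso; rewrite n0 in i_lt.
have h0 : 0 < h by exact: lt_le_trans tauM_gt0 h_ge.
have W_unit := Wc_unit Aq AB0 h0 S_adm.
have tau_le tau : 0 <= tau <= tauM -> 0 <= tau /\ tau <= h.
  by move=> /andP[t0 t1]; split=> //; exact: le_trans t1 h_ge.
have T_ge0 : 0 <= T by exact/ltW/T_gt0.
have estimate f0 tau0 (dB : 'M[R]_(n, m)) (f : R -> 'cV[R]_n -> 'cV[R]_n) x0 w1 w2 x t :
    0 <= f0 -> 0 <= tau0 <= tauM -> nonlinearity f0 f -> rho_ f0 tau0 dB q < 1 ->
    disturbance w1 -> disturbance w2 ->
    is_solution (h + tau0) (closed_loop A B0 h S tau0 dB f w1 w2) x0 x -> T <= t ->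
    enorm (x t) <= norm_on x 0 T *
        (if rho_ f0 tau0 dB q == 0 then 0
         else expR (ln (rho_ f0 tau0 dB q) * (t - T) / T))
      + delta A B0 h S tau0 dB * (norm_on w1 0 t + norm_on w2 0 t)
        / (1 - rho_ f0 tau0 dB q) ^+ 2.
  move=> f0_ge0 /tau_le[t0 t1] [_ _ f_le] r1 dw1 dw2 sol Tt.
  have r0 : 0 < h + tau0 by exact: ltr_wpDr.
  have traj := solution_trajectory r0 sol.
  exact: (decay_estimate Aq q0 h0 S_adm W_unit t0 t1 f0_ge0 f_le traj dw1 dw2 r1 Tt).
have near_ge0 : \forall b \near bounds_to_0, 0 <= b.1 /\ 0 <= b.2 :> R by exact: withinT.
split.
- move=> eps f0 tau0 dB f eps0 f0_ge0 [t0 _ nf] rho_lt1 x0 w1 w2 x _ dw1 dw2 sol t Tt.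
  by apply: (estimate f0 tau0 dB f x0) => //; exact: rho_lt1.
- split; first exact: (uniform_bounds_exist Aq n0 h0 S_adm AB0 tauM_gt0 h_ge).
  move=> etab alpha1b UB; split; last exact: rhobar_cvg0.
  move=> eps f0 tau0 dB eps0 eps_lt f0_ge0 t0 dBe.
  exact: (rho_le_rhobar Aq q0 n0 h0 S_adm AB0 tauM_gt0 h_ge UB).
- by move=> a; exact: (near_rate Aq q0 n0 h0 S_adm AB0 tauM_gt0 h_ge a).
- split; last first.
    move=> a; apply: filterS (near_rate Aq q0 n0 h0 S_adm AB0 tauM_gt0 h_ge a).
    by move=> b H [[tau0 dB] f] [t0 dBb _]; exact: H.
  (* Near (0, 0) three conditions hold together: nonnegative bounds, rho < 1, which the estimate
     presupposes, and a positive rate, from a = 0. *)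
  apply: filterS3 near_ge0
    (near_rho_lt Aq q0 n0 h0 S_adm AB0 tauM_gt0 h_ge (ltr01 : 0 < 1 :> R))
    (near_rate Aq q0 n0 h0 S_adm AB0 tauM_gt0 h_ge 0).
  move=> b [b1 b2] rho_lt1 rate_gt0 [[tau0 dB] f] [/= t0 dBb nf].
  have r1 := rho_lt1 tau0 dB t0 dBb.
  have [t1 t2] := tau_le tau0 t0.
  split=> //.
  + exact: rate_gt0.
  + have k0 : 0 < delta A B0 h S tau0 dB / (1 - rho_ b.2 tau0 dB q) ^+ 2.
      by rewrite divr_gt0 ?exprn_gt0 ?subr_gt0// (delta_gt0 B0 Aq h0 S_adm).
    have := classK_linear k0.
    by under [X in classK X -> _]eq_fun do rewrite mulrAC.
  + move=> x0 w1 w2 x _ dw1 dw2 sol t Tt.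
    have := estimate b.2 tau0 dB f x0 w1 w2 x t b2 t0 nf r1 dw1 dw2 sol Tt.
    rewrite /conv_rate -/(rho_ b.2 tau0 dB q); case: ifP => // rN.
    have -> // : expR (ln (rho_ b.2 tau0 dB q) * (t - T) / T) =
      decay (- ln (rho_ b.2 tau0 dB q) / (3 * q.+1%:R * h))%:E (t - T).
    by rewrite /decay mulNr mulNr opprK mulrAC.
- move=> tau0 f t0M nf.
  have [t0 t1] := tau_le tau0 t0M.
  have F0 : Theta A B0 h S tau0 0 (3 * h) = 0.
    apply: opnorm_eq0; apply/eqP; rewrite eq_le opnorm_ge0 andbT.
    apply: le_trans (opnorm_Theta_le B0 Aq h0 S_adm h_ge 0 t0M) _.
    by rewrite opnorm0 mul0r.
  have rho0E : rho_ 0 tau0 0 q = 0.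
    rewrite /rho_ /rho /rho0 (Fmx_Theta B0 Aq h0 S_adm) F0 addr0.
    by rewrite (nominal_map_nilpotent Aq q0) opnorm0 !mulr0 addr0.
  (* The growth bound with f0 = 0 forces f = 0, which makes the loop affine and existence and
     uniqueness available. *)
  have f_eq0 t v : 0 <= t -> f t v = 0.
    move=> t_ge0; apply: enorm_le0; case: nf => _ _ /(_ t v t_ge0).
    by rewrite mul0r.
  have windowed x0 w1 w2 x : disturbance w1 -> disturbance w2 ->
      is_solution (h + tau0) (closed_loop A B0 h S tau0 0 f w1 w2) x0 x ->
      forall t, T <= t -> enorm (x t) <= delta A B0 h S tau0 0
        * (norm_on w1 (t - T) t + norm_on w2 (t - T) t).
    move=> dw1 dw2 sol t Tt.
    have r0 : 0 < h + tau0 by exact: ltr_wpDr.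
    have traj := solution_trajectory r0 sol.
    have [_ _ f_le] := nf.
    have r1 : rho A B0 h S tau0 0 0 q < 1 by rewrite -[rho _ _ _ _ _ _ _ _]/(rho_ 0 tau0 0 q) rho0E.
    (* With rho = 0 the state disappears from the right-hand side of the delay inequality, and only
       disturbances on the window remain. *)
    have := windowed_estimate Aq q0 h0 S_adm W_unit t0 t1 (lexx 0) f_le traj dw1 dw2 r1 Tt.
    by rewrite -[rho _ _ _ _ _ _ _ _]/(rho_ 0 tau0 0 q) rho0E mul0r add0r.
  split=> //.
    by move=> x0 w1 w2 x _ dw1 dw2 sol; exact: windowed dw1 dw2 sol.
  have d0 : 0 < delta A B0 h S tau0 (0 : 'M[R]_(n, m)) by exact: (delta_gt0 B0 Aq h0 S_adm).
  (* The factor 2 arises because each of the two blocks is bounded by the stacked disturbance; the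
     estimate looks back by T and holds from T on. *)
  exists (fun s => delta A B0 h S tau0 0 * 2 * s), T, T; split=> //.
    by apply: classK_linear; rewrite mulr_gt0.
  move=> x0 d x0_init dd.
  have du := disturbance_usubmx dd; have dds := disturbance_dsubmx dd.
  have [x sol] := closed_loop_exists B0 Aq h0 S_adm 0 t0 t1 f_eq0 x0_init du dds.
  exists x; split=> //.
    by move=> y soly t rt; exact: (closed_loop_unique Aq h0 S_adm t0 t1 f_eq0 sol soly).
  move=> t Tt; apply: le_trans (windowed _ _ _ _ du dds sol t Tt) _.
  have tT : 0 <= t - T by rewrite subr_ge0.
  have tt : t - T <= t by rewrite gerBl.
  rewrite -mulrA ler_wpM2l ?(ltW d0)// mulr_natl mulr2n; apply: lerD; apply: norm_on_le => // s st.
    by apply: le_trans (enorm_usubmx _) _; exact: le_norm_on_disturbance.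
  by apply: le_trans (enorm_dsubmx _) _; exact: le_norm_on_disturbance.
Qed.
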